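(* Let $I$ be a set and $1 \leq p < \infty$. (1) The space $\mathfrak{M}_{p,cb}^I$ of completely bounded Schur multipliers on $S_p^I$ is the closure, in $CB(S_p^I)$, of the linear span of the isometric Schur multipliers on $S_p^I$, both in the weak* topology and in the weak operator topology. (2) The space $\mathfrak{M}_p^I$ of bounded Schur multipliers on $S_p^I$ is the closure, in $B(S_p^I)$, of the linear span of the isometric Schur multipliers on $S_p^I$, both in the weak* topology and in the weak operator topology.
   Context: For $1\le p<\infty$, $S_p^I$ is the Schatten class of compact operators $A$ on $\ell_2^I$ with $\|A\|_{S_p^I}=(\mathrm{Tr}\,(A^*A)^{p/2})^{1/p}<\infty$; $S_\infty^I$ is the space of compact operators on $\ell_2^I$ with the operator norm. Elements are regarded as $I\times I$ matrices. $p^*$ is the conjugate exponent. Duality pairing: $\langle A,B\rangle_{S_p^I,S_{p^*}^I}=\mathrm{Tr}(AB^T)$, with $B^T$ the matrix transpose. Operator space structures: $S_\infty^I$ has its $C^*$-algebra structure, $S_1^I$ is the dual of $S_\infty^I$ (via the pairing $\langle A,B\rangle_{S_1^I,S_\infty^I}=\mathrm{Tr}(AB^T)$), and $S_p^I=(S_\infty^I,S_1^I)_{1/p}$ by complex interpolation, with $M_n(E_\theta)=(M_n(E_0),M_n(E_1))_\theta$. $*$ is the Schur (entrywise) product $[a_{ij}]*[b_{ij}]=[a_{ij}b_{ij}]$. A matrix $A$ defines a Schur multiplier $M_A$ on $S_p^I$ if $M_A(B)=A*B\in S_p^I$ for all $B\in S_p^I$ (then $M_A$ is bounded); it is isometric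 if $\|M_A(B)\|_{S_p^I}=\|B\|_{S_p^I}$ for all $B\in S_p^I$. $\mathfrak{M}_p^I\subset B(S_p^I)$ is the space of bounded Schur multipliers, and $\mathfrak{M}_{p,cb}^I\subset CB(S_p^I)$ the space of completely bounded ones. In (1) the span of the isometric Schur multipliers is considered as a subspace of $\mathfrak{M}_{p,cb}^I$. Weak* topologies: $\widehat{\otimes}$ is the operator space projective tensor product and $\otimes_\gamma$ the Banach space projective tensor product; $CB(S_p^I)=(S_p^I\widehat{\otimes}S_{p^*}^I)^*$ and $B(S_p^I)=(S_p^I\otimes_\gamma S_{p^*}^I)^*$ via $\langle T,A\otimes B\rangle=\langle T(A),B\rangle_{S_p^I,S_{p^*}^I}$. *)

(* Defs.v *)
From HB Require Import structures.
From mathcomp Require Import all_boot all_order all_algebra.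
From mathcomp Require Import finmap.
From mathcomp Require Import complex.
From mathcomp Require Import all_classical all_reals all_analysis.
From mathcomp.analysis.showcase Require Import summability.

Set Implicit Arguments.
Unset Strict Implicit.
Unset Printing Implicit Defensive.

Import Order.TTheory GRing.Theory Num.Theory.
Import numFieldNormedType.Exports.

Local Open Scope classical_set_scope.
Local Open Scope ring_scope.
Local Open Scope complex_scope.

(* The complex numbers, typed so that the library topology and normed module
   structure of a numFieldType are found by unification. *)
Definition Cx (R : realType) : numClosedFieldType := R[i].

(* Throughout, a normed space sitting inside an ambient vector space V is given
   by its norm N : V -> \bar R, extended by +oo off the space; membership in the
   space is N x < +oo. *)

Section Interpolation.
Context {R : realType} {V : lmodType (Cx R)}.
Implicit Type N : V -> \bar R.

(* The norm of X0 + X1. *)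
Definition sum_norm N0 N1 (x : V) : \bar R :=
  ereal_inf [set (N0 y + N1 (x - y)%R)%E | y in [set: V]].

Definition closed_strip : set (Cx R) :=
  [set z | 0 <= complex.Re z /\ complex.Re z <= 1].
Definition open_strip : set (Cx R) :=
  [set z | 0 < complex.Re z /\ complex.Re z < 1].

Definition bdry_sup N (f : Cx R -> V) (j : R) : \bar R :=
  ereal_sup [set N (f (Complex j t)) | t in [set: R]].

(* t |-> f (j + i t) is a continuous bounded X-valued function on the line
   which tends to 0 at infinity *)
Definition bdry_C0 N (f : Cx R -> V) (j : R) : Prop :=
  [/\ (bdry_sup N f j < +oo)%E,
      forall s : R, N (f (Complex j t) - f (Complex j s)) @[t --> s] --> 0%E,
      N (f (Complex j t)) @[t --> +oo%R] --> 0%E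
    & N (f (Complex j t)) @[t --> -oo%R] --> 0%E].

(* Calderon's space F(X0, X1), as in Bergh and Loefstrom, section 4.1. *)
Definition calderon N0 N1 : set (Cx R -> V) :=
  [set f |
    [/\ (ereal_sup [set sum_norm N0 N1 (f z) | z in closed_strip] < +oo)%E,
        forall z, closed_strip z ->
          sum_norm N0 N1 (f w - f z) @[w --> within closed_strip (nbhs z)]
            --> 0%E,
        forall z, open_strip z -> exists2 d : V, (sum_norm N0 N1 d < +oo)%E &
          sum_norm N0 N1 (h^-1 *: (f (z + h) - f z) - d)
            @[h --> (0 : Cx R)^'] --> 0%E,
        bdry_C0 N0 f 0
      & bdry_C0 N1 f 1]].

(* The norm of the complex interpolation space (X0, X1)_theta. *)
Definition interp_norm N0 N1 (theta : R) (x : V) : \bar R :=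
  ereal_inf [set maxe (bdry_sup N0 f 0) (bdry_sup N1 f 1) |
             f in [set f | calderon N0 N1 f /\ f theta%:C = x]].

End Interpolation.

Section Operators.
Context {R : realType} {J : choiceType}.
Implicit Types (A B P Q : J -> J -> Cx R) (x y : J -> Cx R).

Definition l2norm x : \bar R :=
  ((\esum_(i in [set: J]) (Normc.normc (x i) ^+ 2)%:E) `^ 2^-1)%E.

(* Sums over J are unordered: limits along the net of finite subsets. *)
Definition mat_apply A x : J -> Cx R :=
  fun i => summability.sum (fun j => A i j * x j).

Definition mat_mul A B : J -> J -> Cx R :=
  fun i k => summability.sum (fun j => A i j * B j k).

Definition mat_tr A : J -> J -> Cx R := fun i j => A j i.

Definition mat_adj A : J -> J -> Cx R := fun i j => (A j i)^*.

Definition mat_trace A : Cx R := summability.sum (fun i => A i i).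

(* The matrix A defines an operator of norm at most M on ell_2^J. *)
Definition op_bound A (M : R) : Prop :=
  forall x, (l2norm x < +oo)%E ->
    (forall i, cvg (partial_sum (fun j => A i j * x j) F @[F --> totally])) /\
    (l2norm (mat_apply A x) <= M%:E * l2norm x)%E.

(* +oo when A does not define a bounded operator *)
Definition opnorm A : \bar R :=
  ereal_inf [set M%:E | M in [set M : R | 0 <= M /\ op_bound A M]].

Definition compact_op A : Prop :=
  (opnorm A < +oo)%E /\
  forall u : nat -> J -> Cx R, (forall n, (l2norm (u n) <= 1)%E) ->
    exists2 s : nat -> nat, {homo s : m n / (m < n)%N} &
    exists2 y, (l2norm y < +oo)%E &
      l2norm (mat_apply A (u (s n)) - y) @[n --> \oo] --> 0%E.

(* Functional calculus: for P compact and positive and s > 0, P^s is the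
   bounded operator acting as lambda^s on the eigenspace of P for lambda (these
   eigenspaces, kernel included, span a dense subspace of ell_2^J). *)
Definition is_op_power P (s : R) Q : Prop :=
  (opnorm Q < +oo)%E /\
  forall (lambda : R) x, (l2norm x < +oo)%E ->
    mat_apply P x = lambda%:C *: x ->
    mat_apply Q x = (lambda `^ s)%:C *: x.

Definition op_power P (s : R) : J -> J -> Cx R :=
  xget (fun _ _ => 0) [set Q | is_op_power P s Q].

(* The trace of a positive operator, in [0, +oo]; its diagonal entries are
   real and nonnegative. *)
Definition pos_trace Q : \bar R :=
  (\esum_(i in [set: J]) (complex.Re (Q i i))%:E)%E.

Definition schatten_norm (p : \bar R) A : \bar R :=
  if `[< compact_op A >] then
    if p == +oo%E then opnorm A
    else (pos_trace (op_power (mat_mul (mat_adj A) A) (fine p / 2))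
           `^ (fine p)^-1)%E
  else +oo%E.

Definition pairing A B : Cx R := mat_trace (mat_mul A (mat_tr B)).

Definition schur A B : J -> J -> Cx R := fun i j => A i j * B i j.

End Operators.

Section OperatorSpaceStructure.
Context {R : realType} {I : choiceType}.

(* M_n(S_oo): n x n block matrices, acting on ell_2^{I x n}. *)
Definition Mn_Sinf n (X : 'I_n -> 'I_n -> I -> I -> Cx R) : \bar R :=
  schatten_norm +oo%E (fun a b : I * 'I_n => X a.2 b.2 a.1 b.1).

(* M_n(S_1): the completely bounded norm of B |-> [<x_kl, B>]_kl, from S_oo
   to M_n. *)
Definition Mn_S1 n (X : 'I_n -> 'I_n -> I -> I -> Cx R) : \bar R :=
  if `[< forall k l, (schatten_norm 1%E (X k l) < +oo)%E >] then
    ereal_sup (\bigcup_m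
      [set opnorm (fun a b : 'I_m * 'I_n => pairing (X a.2 b.2) (Y a.1 b.1)) |
       Y in [set Y : 'I_m -> 'I_m -> I -> I -> Cx R | (Mn_Sinf Y <= 1)%E]])
  else +oo%E.

(* M_n(S_p) = (M_n(S_oo), M_n(S_1))_{1/p}; at the end points these are the
   given structures of S_oo and S_1. *)
Definition Mn_S (p : \bar R) n (X : 'I_n -> 'I_n -> I -> I -> Cx R) : \bar R :=
  if p == +oo%E then Mn_Sinf X
  else if p == 1%E then Mn_S1 X
  else interp_norm (@Mn_Sinf n) (@Mn_S1 n) (fine p)^-1 X.

End OperatorSpaceStructure.

Section OperatorsOnSchatten.
Context {R : realType} (I : choiceType) (p : \bar R).

Definition schatten : set (I -> I -> Cx R) :=
  [set A | (schatten_norm p A < +oo)%E].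

(* Linearity of a map defined on S_p, phrased without naming the vector space
   operations of the subtype. *)
Definition linear_on (W : lmodType (Cx R)) (f : schatten -> W) : Prop :=
  forall (a : Cx R) (x y z : schatten),
    \val z = a *: \val x + \val y -> f z = a *: f x + f y.

(* B(S_p) *)
Definition Bop : set (schatten -> schatten) :=
  [set T | linear_on (fun x => \val (T x)) /\
     exists2 M : R, 0 <= M & forall x,
       (schatten_norm p (\val (T x)) <= M%:E * schatten_norm p (\val x))%E].

(* CB(S_p) *)
Definition CBop : set Bop :=
  [set T | exists2 M : R, 0 <= M &
     forall n (X : 'I_n -> 'I_n -> schatten),
       (Mn_S p (fun k l => \val ((\val T) (X k l)))
          <= M%:E * Mn_S p (fun k l => \val (X k l)))%E].

(* The dual of S_p. *)
Definition schatten_dual : set (schatten -> Cx R) :=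
  [set phi | linear_on (phi : schatten -> (Cx R)^o) /\
     exists2 M : R, 0 <= M & forall x,
       ((Normc.normc (phi x))%:E <= M%:E * schatten_norm p (\val x))%E].

Definition schur_mult : set Bop :=
  [set T | exists A, forall x, \val ((\val T) x) = schur A (\val x)].

Definition isometric_schur_mult : set Bop :=
  [set T | schur_mult T /\
     forall x, schatten_norm p (\val ((\val T) x)) = schatten_norm p (\val x)].

Definition Bspan (D : set Bop) : set Bop :=
  [set T | exists m (c : 'I_m -> Cx R) (S : 'I_m -> Bop),
     (forall k, D (S k)) /\
     forall x, \val ((\val T) x) = \sum_(k < m) c k *: \val ((\val (S k)) x)].

End OperatorsOnSchatten.

Arguments schatten {R} I p.
Arguments Bop {R} I p.
Arguments CBop {R} I p.
Arguments schatten_dual {R} I p.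
Arguments schur_mult {R} I p.
Arguments isometric_schur_mult {R} I p.

Section Topologies.
Context {R : realType} (I : choiceType) (p : \bar R).
Local Notation q := (hoelder_conjugate p).
Local Notation Sp := (schatten I p).
Local Notation Sq := (schatten I q).

(* Elements of the algebraic tensor product of S_p and S_p* are written as
   lists of elementary tensors; two lists denote the same element iff they have
   the same value under the injection (A, B) |-> a_ij b_kl. *)
Definition tensor_val (u : seq (Sp * Sq)) : I -> I -> I -> I -> Cx R :=
  \sum_(x <- u) (fun i j k l => (\val x.1) i j * (\val x.2) k l).

(* The Banach space projective tensor norm. *)
Definition gamma_norm (t : I -> I -> I -> I -> Cx R) : \bar R :=
  ereal_inf
    [set (\sum_(x <- u) schatten_norm p (\val x.1) * schatten_norm q (\val x.2))%E
    | u in [set u : seq (Sp * Sq) | tensor_val u = t]].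

(* The operator space projective tensor norm (at the first matrix level): the
   infimum of |alpha| |x| |y| |beta| over the factorizations
   t = alpha (x (x) y) beta. *)
Definition opproj_norm (t : I -> I -> I -> I -> Cx R) : \bar R :=
  ereal_inf [set r | exists m n (alpha beta : 'I_m * 'I_n -> Cx R)
      (x : 'I_m -> 'I_m -> Sp) (y : 'I_n -> 'I_n -> Sq),
    t = \sum_(a : 'I_m * 'I_n) \sum_(b : 'I_m * 'I_n)
          (fun i j k l => alpha a * (\val (x a.1 b.1)) i j
                            * (\val (y a.2 b.2)) k l * beta b) /\
    r = (l2norm alpha * Mn_S p (fun i j => \val (x i j))
           * Mn_S q (fun k l => \val (y k l)) * l2norm beta)%E].

(* The completion of the algebraic tensor product for the norm N: Cauchy
   sequences (not quotiented by equivalence). *)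
Definition completion (N : (I -> I -> I -> I -> Cx R) -> \bar R) :
    set (nat -> seq (Sp * Sq)) :=
  [set u | forall e : R, 0 < e ->
     \forall m & n \near \oo,
       (N (tensor_val (u m) - tensor_val (u n))%R < e%:E)%E].

(* <T, u> *)
Definition tensor_pairing (T : Bop I p) (u : seq (Sp * Sq)) : Cx R :=
  \sum_(x <- u) pairing (\val ((\val T) x.1)) (\val x.2).

Definition B_weakstar : topologicalType :=
  initial_topology (fun T : Bop I p =>
    (fun u => lim (tensor_pairing T (\val u n) @[n --> \oo]))
      : {ptws completion gamma_norm -> Cx R}).

Definition CB_weakstar : topologicalType :=
  initial_topology (fun T : CBop I p =>
    (fun u => lim (tensor_pairing (\val T) (\val u n) @[n --> \oo]))
      : {ptws completion opproj_norm -> Cx R}).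

Definition B_wot : topologicalType :=
  initial_topology (fun T : Bop I p =>
    (fun xphi => (\val xphi.2) ((\val T) xphi.1))
      : {ptws (Sp * schatten_dual I p) -> Cx R}).

(* The weak operator topology of B(S_p), restricted to CB(S_p). *)
Definition CB_wot : topologicalType :=
  initial_topology (fun T : CBop I p => (\val T : B_wot)).

(* M_p *)
Definition Mult : set (Bop I p) := schur_mult I p.

Definition iso_span : set (Bop I p) := Bspan (isometric_schur_mult I p).

(* M_{p,cb}, and the span of the isometric Schur multipliers, inside CB(S_p) *)
Definition Mult_cb : set (CBop I p) := [set T | Mult (\val T)].

Definition iso_span_cb : set (CBop I p) := [set T | iso_span (\val T)].

End Topologies.

Arguments Mult {R} I p.
Arguments Mult_cb {R} I p.
Arguments iso_span {R} I p.
Arguments iso_span_cb {R} I p.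
Arguments B_weakstar {R} I p.
Arguments CB_weakstar {R} I p.
Arguments B_wot {R} I p.
Arguments CB_wot {R} I p.

(* Main.v *)
(* Let T be the Schur multiplier with matrix A and let P_F be the coordinate
   projection onto a finite set F of indices.  The truncations
   T_F x = P_F (T x) P_F are the approximating net.  Since 1 - 2 e_ii is a
   diagonal sign matrix, T_F is a combination of multipliers x |-> d x e with
   d, e diagonal unitary, and these are isometric.  By the singular value
   decomposition |(1 - P_F) y|_p and |y (1 - P_F)|_p tend to 0 for y in S_p,
   hence T_F -> T in the weak operator topology.  Evaluated at a tensor t, T_F
   is the sum of A_ij t_ijij over i, j in F; it is bounded uniformly in F by a
   multiple of the projective norm of t, so that the limits over F and along a
   Cauchy sequence of tensors may be exchanged.  For the Banach space norm the
   bound is Hoelder's inequality.  For the operator space norm it follows from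
   the three lines theorem applied to the pairing of f z with g (1 - z), where
   f and g are Calderon functions for the two factors: on the boundary of the
   strip the pairing is controlled by the very definition of M_n(S_1).
   Conversely, the identities (T x)_ij = x_ij (T e_ij)_ij characterize Schur
   multipliers and pass to closures. *)

Require Import Defs.
From HB Require Import structures.
From mathcomp Require Import all_boot all_order all_algebra.
From mathcomp Require Import finmap.
From mathcomp Require Import complex ring lra.
From mathcomp Require Import all_classical all_reals all_analysis.
From mathcomp.analysis.showcase Require Import summability.

Set Implicit Arguments.
Unset Strict Implicit.
Unset Printing Implicit Defensive.

Import Order.TTheory GRing.Theory Num.Theory.
Import numFieldNormedType.Exports.

Local Open Scope classical_set_scope.
Local Open Scope ring_scope.
Local Open Scope complex_scope.

Local Notation normc := Normc.normc.
Local Notation Re := complex.Re.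
Local Notation Im := complex.Im.

Local Notation "z ^*" := (conjc z) : ring_scope.

(** The norms come from definitions that offer little to compute with: [op_power] is a choice among
    operators specified on eigenvectors, the norm of M_n(S_1) is a supremum over blocks of all
    sizes, and that of M_n(S_p) an infimum over analytic functions. The Schatten norm is therefore
    turned into a sum of powers of singular values, and then into bounds on sums of |<T z_l, w_l>|^p
    over finite families [z], [w] satisfying Bessel's inequality. Such families are stable under
    contractions, so that multiplication by diagonal contractions, decay of tails and Hoelder's
    inequality all reduce to finite sums. Cutting a pairing to a finite set [F] has a further
    purpose: it becomes a polynomial in finitely many entries, and an entry is a functional bounded
    for both end point norms, so that the pairing is bounded and holomorphic along Calderon
    functions. The three lines theorem itself rests on Goursat's theorem for rectangles and on a
    Cauchy estimate with an unspecified constant. *)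

Section CxNorm.
Variable R : realType.
Implicit Types z w : Cx R.

Lemma normCE z : `|z| = (normc z)%:C. Proof. by []. Qed.

Lemma normc_ge0 z : 0 <= normc z.
Proof. by rewrite -lecR -normCE normr_ge0. Qed.

Lemma normcE2 z : normc z ^+ 2 = Re z ^+ 2 + Im z ^+ 2.
Proof. by case: z => a b; rewrite /= sqr_sqrtr ?addr_ge0 ?sqr_ge0. Qed.

Lemma ler_normcD z w : normc (z + w) <= normc z + normc w.
Proof. exact: le_normcD. Qed.

Lemma normcN z : normc (- z) = normc z.
Proof. by apply: complexI; rewrite -!normCE normrN. Qed.

Lemma normcBC z w : normc (z - w) = normc (w - z).
Proof. by rewrite -normcN opprB. Qed.

Lemma ler_normcB z w : normc (z - w) <= normc z + normc w.
Proof. by rewrite -(normcN w) ler_normcD. Qed.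

Lemma ler_distcD y z w : normc (z - w) <= normc (z - y) + normc (y - w).
Proof. by rewrite (le_trans _ (ler_normcD _ _))// addrA subrK. Qed.

Lemma normcM z w : normc (z * w) = normc z * normc w.
Proof. exact: Normc.normcM. Qed.

Lemma normcX z n : normc (z ^+ n) = normc z ^+ n.
Proof. by apply: complexI; rewrite -normCE normrX normCE rmorphXn. Qed.

Lemma normcV z : normc z^-1 = (normc z)^-1.
Proof. exact: Normc.normcV. Qed.

Lemma normc0E : normc (0 : Cx R) = 0. Proof. exact: Normc.normc0. Qed.
Lemma normc1E : normc (1 : Cx R) = 1. Proof. exact: Normc.normc1. Qed.

Lemma normc_eq0 z : (normc z == 0) = (z == 0).
Proof.
by apply/idP/idP => [/eqP/Normc.eq0_normc ->//|/eqP ->]; rewrite normc0E.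
Qed.

Lemma normc_gt0 z : (0 < normc z) = (z != 0).
Proof. by rewrite lt_def normc_ge0 andbT normc_eq0. Qed.

Lemma normc_real (x : R) : normc (x%:C : Cx R) = `|x|.
Proof. by rewrite /= expr0n/= addr0 sqrtr_sqr. Qed.

Lemma normc_i : normc ('i : Cx R) = 1.
Proof. by rewrite /= expr0n/= expr1n add0r sqrtr1. Qed.

Lemma normcJ z : normc (z^*) = normc z.
Proof. by case: z => a b; rewrite /= sqrrN. Qed.

Lemma normc_Re z : `|Re z| <= normc z.
Proof.
rewrite -(@ler_pXn2r _ 2)// ?nnegrE ?normc_ge0// normcE2.
by rewrite real_normK ?num_real// lerDl sqr_ge0.
Qed.

Lemma normc_Im z : `|Im z| <= normc z.
Proof.
rewrite -(@ler_pXn2r _ 2)// ?nnegrE ?normc_ge0// normcE2.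
by rewrite real_normK ?num_real// lerDr sqr_ge0.
Qed.

Lemma normc_le z : normc z <= `|Re z| + `|Im z|.
Proof.
rewrite -(@ler_pXn2r _ 2)// ?nnegrE ?normc_ge0 ?addr_ge0// normcE2.
rewrite sqrrD !real_normK ?num_real// lerD2r lerDl mulrn_wge0// mulr_ge0//.
Qed.

Lemma ler_normc_sum (J : Type) (r : seq J) (P : pred J) (f : J -> Cx R) :
  normc (\sum_(i <- r | P i) f i) <= \sum_(i <- r | P i) normc (f i).
Proof.
elim/big_rec2: _ => [|i x y _ h]; first by rewrite normc0E.
by rewrite (le_trans (ler_normcD _ _))// lerD2l.
Qed.

(** The order of [Cx R] compares only numbers with equal imaginary parts, so the positive radii
    occurring in limits are real. This lets the lemmas below restate limits with a real [e]. *)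
Lemma Cx_gt0 z : 0 < z -> 0 < Re z /\ z = (Re z)%:C.
Proof.
rewrite (_ : (0 < z) = ((0 : R[i]) < z)%R)// ltcE => /andP[/eqP].
by case: z => a b /= -> a0.
Qed.

Lemma cvgCP (T : Type) (F : set_system T) (FF : Filter F) (f : T -> Cx R) l :
  f x @[x --> F] --> l <->
  forall e : R, 0 < e -> \forall x \near F, normc (f x - l) < e.
Proof.
split => [/cvgrPdist_lt h e e0|h].
  have := h e%:C; rewrite ltcR => /(_ e0); apply: filterS => x.
  by rewrite normCE ltcR normcBC.
apply/cvgrPdist_lt => e /Cx_gt0[e0 ->].
have := h (Re e) e0; apply: filterS => x xe.
by rewrite normCE normcBC ltcR.
Qed.

Lemma cvgC0 (T : Type) (F : set_system T) (FF : Filter F) (f : T -> Cx R) l :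
  f x @[x --> F] --> l <-> normc (f x - l) @[x --> F] --> (0 : R).
Proof.
split=> [/cvgCP h|/cvgrPdist_lt h].
  apply/cvgrPdist_lt => e e0; apply: filterS (h e e0) => x.
  by rewrite sub0r normrN ger0_norm ?normc_ge0.
apply/cvgCP => e e0; apply: filterS (h e e0) => x.
by rewrite sub0r normrN ger0_norm ?normc_ge0.
Qed.

Lemma nbhsCP z (P : set (Cx R)) :
  (\forall w \near z, P w) <->
  exists2 e : R, 0 < e & forall w, normc (w - z) < e -> P w.
Proof.
split=> [/nbhs_ballP[e]|[e e0 h]].
  move=> /Cx_gt0[e0 eE] h; exists (Re e) => // w wz; apply: h.
  by rewrite /ball/= normCE normcBC eE ltcR.
apply/nbhs_ballP; exists e%:C; first by rewrite /= ltcR.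
by move=> w; rewrite /ball/= normCE normcBC ltcR => /h.
Qed.

Lemma continuous_Re : continuous (@complex.Re R : Cx R -> R).
Proof.
move=> z; apply/(@cvgrPdist_lt _ _ _ (nbhs z)) => e e0; apply/nbhsCP; exists e => // w wz.
have -> : Re z - Re w = Re (z - w) by case: z {wz}; case: w.
by rewrite (le_lt_trans (normc_Re _))// normcBC.
Qed.

Lemma continuous_Im : continuous (@complex.Im R : Cx R -> R).
Proof.
move=> z; apply/(@cvgrPdist_lt _ _ _ (nbhs z)) => e e0; apply/nbhsCP; exists e => // w wz.
have -> : Im z - Im w = Im (z - w) by case: z {wz}; case: w.
by rewrite (le_lt_trans (normc_Im _))// normcBC.
Qed.

Lemma continuous_Complex (T : topologicalType) (f g : T -> R) x :
  {for x, continuous f} -> {for x, continuous g} ->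
  {for x, continuous (fun t => Complex (f t) (g t) : Cx R)}.
Proof.
move=> /cvgrPdist_lt cf /cvgrPdist_lt cg; apply/cvgCP => e e0.
have e20 : 0 < e / 2 by rewrite divr_gt0.
apply: filterS2 (cf _ e20) (cg _ e20) => t ft gt.
rewrite (le_lt_trans (normc_le _))//= [ltRHS]splitr.
by rewrite ltrD// distrC.
Qed.

Lemma continuous_normc : continuous (@Normc.normc R : Cx R -> R).
Proof.
move=> z; apply/(@cvgrPdist_lt _ _ _ (nbhs z)) => e e0; apply/nbhsCP; exists e => // w wz.
rewrite (le_lt_trans _ wz)// ler_norml.
have h1 : normc z <= normc (w - z) + normc w.
  by rewrite (normcBC w); have := ler_normcD (z - w) w; rewrite subrK.
have h2 : normc w <= normc (w - z) + normc z.
  by have := ler_normcD (w - z) z; rewrite subrK.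
by rewrite lerBrDl lerBlDr addrC; apply/andP; split; lra.
Qed.

End CxNorm.

(** * The three lines theorem *)

Section ContourIntegral.
Variable R : realType.
Implicit Types (a b c d t x y : R) (f g : R -> Cx R).

Definition cint a b f : Cx R :=
  Complex (\int[lebesgue_measure]_(t in `[a, b]) Re (f t))
          (\int[lebesgue_measure]_(t in `[a, b]) Im (f t)).

Definition seg_cont a b f := forall t, a <= t <= b -> {for t, continuous f}.

Lemma seg_cont_Re a b f : seg_cont a b f ->
  lebesgue_measure.-integrable `[a, b] (EFin \o (fun t => Re (f t))).
Proof.
move=> cf; apply: continuous_compact_integrable; first exact: segment_compact.
apply: continuous_in_subspaceT => t; rewrite inE/= in_itv/= => /cf ft.
exact: (continuous_comp ft (@continuous_Re R _)).
Qed.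

Lemma seg_cont_Im a b f : seg_cont a b f ->
  lebesgue_measure.-integrable `[a, b] (EFin \o (fun t => Im (f t))).
Proof.
move=> cf; apply: continuous_compact_integrable; first exact: segment_compact.
apply: continuous_in_subspaceT => t; rewrite inE/= in_itv/= => /cf ft.
exact: (continuous_comp ft (@continuous_Im R _)).
Qed.

Lemma cintD a b f g : seg_cont a b f -> seg_cont a b g ->
  cint a b (fun t => f t + g t) = cint a b f + cint a b g.
Proof.
move=> cf cg; rewrite /cint.
have -> : (fun t => Re (f t + g t)) = (fun t => Re (f t) + Re (g t)).
  by apply/funext => t; case: (f t) => ? ?; case: (g t).
have -> : (fun t => Im (f t + g t)) = (fun t => Im (f t) + Im (g t)).
  by apply/funext => t; case: (f t) => ? ?; case: (g t).
by rewrite !RintegralD//; [exact: seg_cont_Im|exact: seg_cont_Im|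
  exact: seg_cont_Re|exact: seg_cont_Re].
Qed.

Lemma cintZ a b f (k : Cx R) : seg_cont a b f ->
  cint a b (fun t => k * f t) = k * cint a b f.
Proof.
move=> cf; rewrite /cint; case: k => u v.
have iR := seg_cont_Re cf; have iI := seg_cont_Im cf.
have Z w h : lebesgue_measure.-integrable `[a, b] (EFin \o h) ->
    lebesgue_measure.-integrable `[a, b] (EFin \o (fun t => w * h t : R)).
  by move=> ih; apply: (integrableZl _ w ih).
have -> : (fun t => Re (Complex u v * f t)) =
    (fun t => u * Re (f t) - v * Im (f t)).
  by apply/funext => t; case: (f t).
have -> : (fun t => Im (Complex u v * f t)) =
    (fun t => u * Im (f t) + v * Re (f t)).
  by apply/funext => t; case: (f t).
by rewrite RintegralB ?RintegralD ?RintegralZl//; apply: Z.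
Qed.

Lemma eq_cint a b f g : (forall t, a <= t <= b -> f t = g t) ->
  cint a b f = cint a b g.
Proof.
move=> fg; rewrite /cint; congr Complex; apply: eq_Rintegral => t;
  by rewrite inE/= in_itv/= => /fg ->.
Qed.

Lemma cint_cst a b (k : Cx R) : a <= b -> cint a b (fun=> k) = (b - a)%:C * k.
Proof.
move=> ab; rewrite /cint !Rintegral_cst//= lebesgue_measure_itv/= lte_fin.
have -> : fine (if a < b then (b%:E - a%:E)%E else 0%E) = b - a.
  by case: ltP => //= ba; apply/esym/eqP; rewrite subr_eq0 eq_le ba.
case: k => u v /=; apply/eqP; rewrite eq_complex/=; apply/andP; split; apply/eqP; ring.
Qed.

Lemma cint_split a b m f : a <= m <= b -> seg_cont a b f ->
  cint a b f = cint a m f + cint m b f.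
Proof.
move=> /andP[am mb] cf.
have key (h : R -> R) : lebesgue_measure.-integrable `[a, b] (EFin \o h) ->
    \int[lebesgue_measure]_(t in `[a, b]) h t =
    \int[lebesgue_measure]_(t in `[a, m]) h t +
    \int[lebesgue_measure]_(t in `[m, b]) h t.
  move=> ih; rewrite -[X in _ + X]Rintegral_itv_obnd_cbnd; last first.
    by apply: integrableS ih => //; apply: subset_itvr; rewrite bnd_simp.
  rewrite -(Rintegral_itvB (x := m) ih) ?bnd_simp//.
  by rewrite addrC subrK.
rewrite /cint (key _ (seg_cont_Re cf)) (key _ (seg_cont_Im cf)).
by [].
Qed.

Lemma le_normr_cint (M : R) a b (h : R -> R) : a <= b ->
  lebesgue_measure.-integrable `[a, b] (EFin \o h) ->
  (forall t, a <= t <= b -> `|h t| <= M) ->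
  `|\int[lebesgue_measure]_(t in `[a, b]) h t| <= M * (b - a).
Proof.
move=> ab ih hM; rewrite (le_trans (le_normr_Rintegral _ _))//.
have -> : M * (b - a) = \int[lebesgue_measure]_(t in `[a, b]) M.
  rewrite Rintegral_cst//= lebesgue_measure_itv/= lte_fin; congr (_ * _).
  by case: ltP => //= ba; apply/eqP; rewrite subr_eq0 eq_le ba.
apply: le_Rintegral => //.
- exact: integrable_norm ih.
- apply: continuous_compact_integrable; first exact: segment_compact.
  by apply: continuous_subspaceT => t; exact: cvg_cst.
Qed.

(** Real and imaginary parts are bounded separately, whence the factor 2. Sharp constants are
    immaterial: in the maximum principle they enter the constant of [cauchy_bound], which [rect_max]
    removes. *)
Lemma normc_cint_le (M : R) a b f : a <= b -> seg_cont a b f ->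
  (forall t, a <= t <= b -> normc (f t) <= M) ->
  normc (cint a b f) <= 2 * M * (b - a).
Proof.
move=> ab cf fM; rewrite (le_trans (normc_le _))//= -mulrA mulr_natl mulr2n.
by rewrite lerD// le_normr_cint//; [exact: seg_cont_Re| |exact: seg_cont_Im|];
  move=> t /fM; apply: le_trans; [exact: normc_Re|exact: normc_Im].
Qed.

Lemma seg_contS a b a' b' f : a <= a' -> b' <= b -> seg_cont a b f ->
  seg_cont a' b' f.
Proof.
move=> aa bb cf t /andP[at_ tb]; apply: cf.
by rewrite (le_trans aa at_) (le_trans tb bb).
Qed.

Lemma seg_contD a b f g : seg_cont a b f -> seg_cont a b g ->
  seg_cont a b (fun t => f t + g t).
Proof. by move=> cf cg t tab; apply: cvgD; [exact: cf|exact: cg]. Qed.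

Lemma seg_contN a b f : seg_cont a b f -> seg_cont a b (fun t => - f t).
Proof. by move=> cf t tab; apply: cvgN; exact: cf. Qed.

Lemma seg_contZ a b f (k : Cx R) : seg_cont a b f ->
  seg_cont a b (fun t => k * f t).
Proof. by move=> cf t tab; apply: cvgMr; exact: cf. Qed.

Lemma cintN a b f : seg_cont a b f ->
  cint a b (fun t => - f t) = - cint a b f.
Proof.
move=> cf; rewrite -mulN1r -cintZ//; congr cint.
by apply/funext => t; rewrite mulN1r.
Qed.

Lemma cintB a b f g : seg_cont a b f -> seg_cont a b g ->
  cint a b (fun t => f t - g t) = cint a b f - cint a b g.
Proof.
by move=> cf cg; rewrite (cintD cf (seg_contN cg)) (cintN cg).
Qed.

End ContourIntegral.

(** * Boundary integrals over rectangles and Goursat's theorem *)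

Section Goursat.
Variable R : realType.
Implicit Types (a b c d x y s u e : R) (g : Cx R -> Cx R) (z w : Cx R).

(** Differentiability with an explicit first order remainder, the form which Goursat's argument
    compares with an affine function; it covers w = z as well. *)
Definition cdif g z := exists D : Cx R, forall e, 0 < e ->
  exists2 r : R, 0 < r & forall w, normc (w - z) < r ->
    normc (g w - g z - D * (w - z)) <= e * normc (w - z).

Lemma cdif_cont g z : cdif g z -> {for z, continuous g}.
Proof.
move=> [D hD]; apply/(@cvgCP _ _ (nbhs z)) => e e0.
have [r r0 hr] := hD 1 ltr01.
have K0 : 0 < normc D + 1 by rewrite ltr_wpDl// normc_ge0.
apply/nbhsCP; exists (Num.min r (e / (normc D + 1))).
  by rewrite lt_min r0 divr_gt0.
move=> w; rewrite lt_min => /andP[wr we].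
have := hr w wr; rewrite mul1r => h.
have -> : g w - g z = (g w - g z - D * (w - z)) + D * (w - z) by ring.
rewrite (le_lt_trans (ler_normcD _ _))// normcM.
rewrite (@le_lt_trans _ _ ((normc D + 1) * normc (w - z)))//.
  by rewrite mulrDl mul1r addrC lerD.
by rewrite mulrC -ltr_pdivlMr.
Qed.

Definition edge_cont g a b c d :=
  [/\ seg_cont a b (fun t => g (Complex t c)), seg_cont a b (fun t => g (Complex t d)),
      seg_cont c d (fun t => g (Complex a t)) & seg_cont c d (fun t => g (Complex b t))].

(** The counterclockwise boundary integral. Opposite edges share one integral, so that the
    integrands are constant when [g] is affine. *)
Definition rint g a b c d : Cx R :=
  cint a b (fun t => g (Complex t c) - g (Complex t d)) +
  'i * cint c d (fun t => g (Complex b t) - g (Complex a t)).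

Lemma rintE g a b c d : edge_cont g a b c d ->
  rint g a b c d =
  cint a b (fun t => g (Complex t c)) - cint a b (fun t => g (Complex t d)) +
  'i * (cint c d (fun t => g (Complex b t)) - cint c d (fun t => g (Complex a t))).
Proof. by case=> h1 h2 h3 h4; rewrite /rint (cintB h1 h2) (cintB h4 h3). Qed.

Lemma edge_contD g1 g2 a b c d : edge_cont g1 a b c d -> edge_cont g2 a b c d ->
  edge_cont (fun z => g1 z + g2 z) a b c d.
Proof.
by move=> [? ? ? ?] [? ? ? ?]; split; apply: seg_contD.
Qed.

Lemma edge_contZ k g a b c d : edge_cont g a b c d ->
  edge_cont (fun z => k * g z) a b c d.
Proof. by move=> [? ? ? ?]; split; apply: seg_contZ. Qed.

Lemma rintD g1 g2 a b c d : edge_cont g1 a b c d -> edge_cont g2 a b c d ->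
  rint (fun z => g1 z + g2 z) a b c d = rint g1 a b c d + rint g2 a b c d.
Proof.
move=> h1 h2; rewrite (rintE (edge_contD h1 h2)) (rintE h1) (rintE h2).
case: h1 h2 => [p1 p2 p3 p4] [q1 q2 q3 q4].
rewrite (cintD p1 q1) (cintD p2 q2) (cintD p3 q3) (cintD p4 q4); ring.
Qed.

Lemma rintZ k g a b c d : edge_cont g a b c d ->
  rint (fun z => k * g z) a b c d = k * rint g a b c d.
Proof.
move=> h1; rewrite (rintE (edge_contZ k h1)) (rintE h1).
case: h1 => [p1 p2 p3 p4].
rewrite (cintZ k p1) (cintZ k p2) (cintZ k p3) (cintZ k p4); ring.
Qed.

Lemma eq_rint g1 g2 a b c d : a <= b -> c <= d ->
  (forall t, a <= t <= b -> g1 (Complex t c) = g2 (Complex t c)) ->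
  (forall t, a <= t <= b -> g1 (Complex t d) = g2 (Complex t d)) ->
  (forall t, c <= t <= d -> g1 (Complex a t) = g2 (Complex a t)) ->
  (forall t, c <= t <= d -> g1 (Complex b t) = g2 (Complex b t)) ->
  rint g1 a b c d = rint g2 a b c d.
Proof.
move=> ab cd h1 h2 h3 h4; rewrite /rint; congr (_ + 'i * _); apply: eq_cint => t tt.
  by rewrite h1// h2.
by rewrite h3// h4.
Qed.

Lemma rint_vsplit g a b c d m : a <= m <= b -> edge_cont g a b c d ->
  seg_cont c d (fun t => g (Complex m t)) ->
  rint g a b c d = rint g a m c d + rint g m b c d.
Proof.
move=> /andP[am mb] hg hm; have [h1 h2 h3 h4] := hg.
have e1 : edge_cont g a m c d.
  exact: And4 (seg_contS (lexx a) mb h1) (seg_contS (lexx a) mb h2) h3 hm.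
have e2 : edge_cont g m b c d.
  exact: And4 (seg_contS am (lexx b) h1) (seg_contS am (lexx b) h2) hm h4.
have amb : a <= m <= b by rewrite am mb.
rewrite (rintE hg) (rintE e1) (rintE e2) (cint_split amb h1) (cint_split amb h2).
ring.
Qed.

Lemma rint_hsplit g a b c d m : c <= m <= d -> edge_cont g a b c d ->
  seg_cont a b (fun t => g (Complex t m)) ->
  rint g a b c d = rint g a b c m + rint g a b m d.
Proof.
move=> /andP[am mb] hg hm; have [h1 h2 h3 h4] := hg.
have e1 : edge_cont g a b c m.
  exact: And4 h1 hm (seg_contS (lexx c) mb h3) (seg_contS (lexx c) mb h4).
have e2 : edge_cont g a b m d.
  exact: And4 hm h2 (seg_contS am (lexx d) h3) (seg_contS am (lexx d) h4).
have amb : c <= m <= d by rewrite am mb.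
rewrite (rintE hg) (rintE e1) (rintE e2) (cint_split amb h3) (cint_split amb h4).
ring.
Qed.

Definition in_rect a b c d z := (a <= Re z <= b) && (c <= Im z <= d).

Lemma seg_cont_h g a b c d m : c <= m <= d ->
  (forall z, in_rect a b c d z -> {for z, continuous g}) ->
  seg_cont a b (fun t => g (Complex t m)).
Proof.
move=> cmd hg t tab.
have hC : {for t, continuous (fun t => Complex t m : Cx R)}.
  by apply: continuous_Complex; [exact: cvg_id|exact: cvg_cst].
by apply: (continuous_comp hC (hg _ _)); rewrite /in_rect tab.
Qed.

Lemma seg_cont_v g a b c d m : a <= m <= b ->
  (forall z, in_rect a b c d z -> {for z, continuous g}) ->
  seg_cont c d (fun t => g (Complex m t)).
Proof.
move=> cmd hg t tab.
have hC : {for t, continuous (fun t => Complex m t : Cx R)}.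
  by apply: continuous_Complex; [exact: cvg_cst|exact: cvg_id].
by apply: (continuous_comp hC (hg _ _)); rewrite /in_rect tab cmd.
Qed.

Lemma rect_edge_cont g a b c d : a <= b -> c <= d ->
  (forall z, in_rect a b c d z -> {for z, continuous g}) ->
  edge_cont g a b c d.
Proof.
move=> ab cd hg; split; [apply: seg_cont_h hg|apply: seg_cont_h hg|
  apply: seg_cont_v hg|apply: seg_cont_v hg]; by rewrite ?lexx ?ab ?cd.
Qed.

(** An affine function has boundary integral 0, so [g] may be replaced by its deviation from one.
    The constants [k1] and [k2] are what the affine part contributes to the two integrands; their
    integrals cancel. *)
Lemma normc_rint_affine (al be : Cx R) (M : R) g a b c d : a <= b -> c <= d ->
  edge_cont g a b c d ->
  (forall z, in_rect a b c d z -> normc (g z - (al + be * z)) <= M) ->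
  normc (rint g a b c d) <= 4 * M * ((b - a) + (d - c)).
Proof.
move=> ab cd [h1 h2 h3 h4] hM; rewrite /rint.
have s1 : seg_cont a b (fun t => g (Complex t c) - g (Complex t d)).
  exact: seg_contD h1 (seg_contN h2).
have s2 : seg_cont c d (fun t => g (Complex b t) - g (Complex a t)).
  exact: seg_contD h4 (seg_contN h3).
have sk l m (k : Cx R) : seg_cont l m (fun=> k) by move=> t _; exact: cvg_cst.
pose k1 : Cx R := be * 'i * (d - c)%:C.
pose k2 : Cx R := - (be * (b - a)%:C).
have e1 : cint a b (fun t => g (Complex t c) - g (Complex t d)) =
    cint a b (fun t => g (Complex t c) - g (Complex t d) + k1) - (b - a)%:C * k1.
  by rewrite (cintD s1 (sk _ _ _)) (cint_cst _ ab) addrK.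
have e2 : cint c d (fun t => g (Complex b t) - g (Complex a t)) =
    cint c d (fun t => g (Complex b t) - g (Complex a t) + k2) - (d - c)%:C * k2.
  by rewrite (cintD s2 (sk _ _ _)) (cint_cst _ cd) addrK.
rewrite e1 e2 (_ : _ + _ =
  cint a b (fun t => g (Complex t c) - g (Complex t d) + k1) +
  'i * cint c d (fun t => g (Complex b t) - g (Complex a t) + k2)); last first.
  by rewrite /k1 /k2; ring.
rewrite (le_trans (ler_normcD _ _))// normcM normc_i mul1r mulrDr.
apply: lerD.
  rewrite (_ : 4 * M = 2 * (M + M)); last by ring.
  apply: (normc_cint_le ab (seg_contD s1 (sk _ _ _))).
  move=> t tab.
  rewrite (_ : _ + k1 = (g (Complex t c) - (al + be * Complex t c)) -
      (g (Complex t d) - (al + be * Complex t d))); last first.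
    rewrite /k1 (_ : be * 'i * (d - c)%:C = be * (Complex t d - Complex t c)).
      by ring.
    rewrite -mulrA; congr (_ * _); apply/eqP; rewrite eq_complex /=.
    by apply/andP; split; apply/eqP; ring.
  rewrite (le_trans (ler_normcB _ _))// lerD//; apply: hM;
    by rewrite /in_rect/= tab ?lexx ?cd.
rewrite (_ : 4 * M = 2 * (M + M)); last by ring.
apply: (normc_cint_le cd (seg_contD s2 (sk _ _ _))).
move=> t tab.
rewrite (_ : _ + k2 = (g (Complex b t) - (al + be * Complex b t)) -
    (g (Complex a t) - (al + be * Complex a t))); last first.
  rewrite /k2 (_ : be * (b - a)%:C = be * (Complex b t - Complex a t)).
    by ring.
  congr (_ * _); apply/eqP; rewrite eq_complex /=.
  by apply/andP; split; apply/eqP; ring.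
rewrite (le_trans (ler_normcB _ _))// lerD//; apply: hM;
  by rewrite /in_rect/= tab ?lexx ?ab.
Qed.

(** Pigeonhole over the four quarters, whose boundary integrals add up to the whole one. The chosen
    quarter is described by bounds on its lower left corner [p], which is the form that nesting
    uses. *)
Lemma rint_quad g x y s u (eta : R) : 0 <= s -> 0 <= u ->
  (forall z, in_rect x (x + 2 * s) y (y + 2 * u) z -> {for z, continuous g}) ->
  4 * eta <= normc (rint g x (x + 2 * s) y (y + 2 * u)) ->
  exists p : R * R, [/\ x <= p.1 <= x + s, y <= p.2 <= y + u &
    eta <= normc (rint g p.1 (p.1 + s) p.2 (p.2 + u))].
Proof.
move=> s0 u0 hg hn; apply: contrapT => hN.
have lt1 p1 p2 : x <= p1 <= x + s -> y <= p2 <= y + u ->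
    normc (rint g p1 (p1 + s) p2 (p2 + u)) < eta.
  by move=> h1 h2; rewrite ltNge; apply/negP => h; apply: hN; exists (p1, p2).
have xs : x <= x + 2 * s by rewrite lerDl mulr_ge0.
have yu : y <= y + 2 * u by rewrite lerDl mulr_ge0.
have hx : x <= x + s <= x + 2 * s by apply/andP; split; lra.
have hy : y <= y + u <= y + 2 * u by apply/andP; split; lra.
have [/andP[hx1 hx2] /andP[hy1 hy2]] := (hx, hy).
have ec a b c d : a <= b -> c <= d -> x <= a -> b <= x + 2 * s -> y <= c ->
    d <= y + 2 * u -> edge_cont g a b c d.
  move=> ab cd xa bx yc dy; apply: rect_edge_cont => // z.
  rewrite /in_rect => /andP[/andP[z1 z2] /andP[z3 z4]]; apply: hg.
  by rewrite /in_rect; apply/andP; split; apply/andP; split; lra.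
have e0 : edge_cont g x (x + 2 * s) y (y + 2 * u) by apply: ec.
have e1 : edge_cont g x (x + s) y (y + 2 * u) by apply: ec => //; lra.
have e2 : edge_cont g (x + s) (x + 2 * s) y (y + 2 * u) by apply: ec => //; lra.
have vs : seg_cont y (y + 2 * u) (fun t => g (Complex (x + s) t)).
  exact: (seg_cont_v hx hg).
have hs := seg_cont_h hy hg.
rewrite (rint_vsplit hx e0 vs) (rint_hsplit hy e1 (seg_contS (lexx _) hx2 hs)) in hn.
rewrite (rint_hsplit hy e2 (seg_contS hx1 (lexx _) hs)) in hn.
have xx : x + 2 * s = x + s + s by ring.
have yy : y + 2 * u = y + u + u by ring.
rewrite xx yy in hn.
have l1 := lt1 x y; have l2 := lt1 x (y + u); have l3 := lt1 (x + s) y.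
have l4 := lt1 (x + s) (y + u).
rewrite !lexx ?hx1 ?hy1 in l1 l2 l3 l4.
have tri4 (A B C D : Cx R) :
    normc (A + B + (C + D)) <= normc A + normc B + normc C + normc D.
  rewrite (le_trans (ler_normcD _ _))// -addrA.
  by rewrite lerD// ler_normcD.
have := le_lt_trans (le_trans hn (tri4 _ _ _ _))
  (ltrD (ltrD (ltrD (l1 isT isT) (l2 isT isT)) (l3 isT isT)) (l4 isT isT)).
by rewrite (_ : eta + eta + eta + eta = 4 * eta) ?ltxx//; ring.
Qed.

Lemma nested_sup (x s : nat -> R) : (forall n, x n <= x n.+1) ->
  (forall n, x n.+1 + s n.+1 <= x n + s n) -> (forall n, 0 <= s n) ->
  exists l, forall n, x n <= l <= x n + s n.
Proof.
move=> xi xd s0.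
have xm m n : (m <= n)%N -> x m <= x n 
  by move=> /subnK <-; elim: (n - m)%N => //= k h; rewrite addSn (le_trans h).
have xsm m n : (m <= n)%N -> x n + s n <= x m + s m.
  by move=> /subnK <-; elim: (n - m)%N => //= k; rewrite addSn; apply: le_trans.
have mix m n : x n <= x m + s m.
  have [mn|/ltnW nm] := leqP m n.
    by rewrite (le_trans _ (xsm _ _ mn))// lerDl.
  by rewrite (le_trans (xm _ _ nm))// lerDl.
exists (sup (range x)) => n; apply/andP; split.
  apply: ub_le_sup; last by exists n.
  by exists (x 0%N + s 0%N) => _ [k _ <-].
by apply: ge_sup => [|_ [k _ <-]//]; exists (x 0%N); exists 0%N.
Qed.

End Goursat.

Section MaximumPrinciple.
Variable R : realType.
Implicit Types (a b c d x y s u e : R) (g h m : Cx R -> Cx R) (z w : Cx R).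

Lemma itv_dist x s t y : x <= t <= x + s -> x <= y <= x + s -> `|t - y| <= s.
Proof.
by move=> /andP[? ?] /andP[? ?]; rewrite ler_norml; apply/andP; split; lra.
Qed.

Lemma goursat g x0 y0 (w v : R) : 0 <= w -> 0 <= v ->
  (forall z, in_rect x0 (x0 + w) y0 (y0 + v) z -> cdif g z) ->
  rint g x0 (x0 + w) y0 (y0 + v) = 0.
Proof.
move=> w0 v0 hg; apply/eqP; rewrite -normc_eq0 eq_le normc_ge0 andbT leNgt.
apply/negP => eta0; set eta := normc _ in eta0.
pose s n : R := w / 2 ^+ n; pose u n : R := v / 2 ^+ n.
have s0 n : 0 <= s n by rewrite divr_ge0// exprn_ge0.
have u0 n : 0 <= u n by rewrite divr_ge0// exprn_ge0.
have sS n : 2 * s n.+1 = s n by rewrite /s exprS invfM mulrCA mulVKf.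
have uS n : 2 * u n.+1 = u n by rewrite /u exprS invfM mulrCA mulVKf.
(* The n-th rectangle, with corner [p], lies in the initial one and keeps at least the share 1 / 4^n
   of its integral. *)
pose inv n (p : R * R) := [/\ x0 <= p.1 /\ p.1 + s n <= x0 + w,
  y0 <= p.2 /\ p.2 + u n <= y0 + v &
  eta / 4 ^+ n <= normc (rint g p.1 (p.1 + s n) p.2 (p.2 + u n))].
(* The invariant is a premise inside the existential, so that [choice] gives a total function for
   the recursion [P]. *)
have step : forall np : nat * (R * R), exists p' : R * R, inv np.1 np.2 ->
    [/\ inv np.1.+1 p', np.2.1 <= p'.1 /\ p'.1 + s np.1.+1 <= np.2.1 + s np.1 &
      np.2.2 <= p'.2 /\ p'.2 + u np.1.+1 <= np.2.2 + u np.1].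
  move=> [n p] /=; have [hi|] := pselect (inv n p); last by exists p.
  have [[i1 i2] [i3 i4] i5] := hi.
  have [||p' [/andP[q1 q2] /andP[q3 q4] q5]] := @rint_quad R g p.1 p.2 (s n.+1) (u n.+1)
    (eta / 4 ^+ n.+1) (s0 _) (u0 _).
  - rewrite sS uS => z; rewrite /in_rect => /andP[/andP[z1 z2] /andP[z3 z4]].
    apply: cdif_cont; apply: hg; rewrite /in_rect (le_trans i1 z1) (le_trans i3 z3).
    by rewrite (le_trans z2 i2) (le_trans z4 i4).
  - by rewrite sS uS exprS invfM mulrCA mulVKf.
  exists p' => _; have := sS n; have := uS n => u2 s2.
  split; first split => //.
  - by split; lra.
  - by split; lra.
  - by split; lra.
  - by split; lra.
have [f hf] := choice step.
pose P := fix P n := if n is n'.+1 then f (n', P n') else (x0, y0).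
have Pinv n : inv n (P n).
  elim: n => [|n ih]; last by have [] := hf (n, P n) ih.
  by split=> /=; rewrite /s /u !expr0 !divr1 ?lexx.
have Pst n := hf (n, P n) (Pinv n).
have [||//|lx hlx] := @nested_sup R (fun n => (P n).1) s.
- by move=> n; have [_ [] ] := Pst n.
- by move=> n; have [_ [] ] := Pst n.
have [||//|ly hly] := @nested_sup R (fun n => (P n).2) u.
- by move=> n; have [_ _ [] ] := Pst n.
- by move=> n; have [_ _ [] ] := Pst n.
pose z : Cx R := Complex lx ly.
have [D hD] : cdif g z.
  apply: hg; rewrite /in_rect/=; have := hlx 0%N; have := hly 0%N.
  by rewrite /= /s /u !expr0 !divr1 => -> ->.
pose L := w + v.
have L0 : 0 <= L by rewrite addr_ge0.
(* On the n-th rectangle the remainder is at most e L / 2^n and the half perimeter is L / 2^n, so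
   the integral is at most 4 e L^2 / 4^n; this [e] makes that less than eta / 4^n. The + 1 covers L
   = 0. *)
pose e : R := eta / (4 * (L + 1) ^+ 2).
have L10 : 0 < L + 1 by rewrite ltr_wpDl.
have e0 : 0 < e by rewrite divr_gt0// mulr_gt0// exprn_gt0.
have [r r0 hr] := hD e e0.
have [n hn] : exists n, L / 2 ^+ n < r.
  have [n _ hn] : \forall n \near \oo, L * (2^-1) ^+ n < r.
    have : L * 2^-1 ^+ n @[n --> \oo] --> L * 0.
      apply: cvgMr; apply: cvg_expr; rewrite gtr0_norm ?invr_gt0// invf_lt1//.
      by rewrite ltr1n.
    by rewrite mulr0 => /cvgrPdist_lt/(_ r r0); apply: filterS => n;
      rewrite sub0r normrN; apply: le_lt_trans; exact: ler_norm.
  by exists n; have := hn n (leqnn n); rewrite /= exprVn.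
have [[i1 i2] [i3 i4] i5] := Pinv n.
have sL : s n + u n = L / 2 ^+ n by rewrite /s /u -mulrDl.
have hxn := hlx n; have hyn := hly n.
have ec : edge_cont g (P n).1 ((P n).1 + s n) (P n).2 ((P n).2 + u n).
  apply: rect_edge_cont; rewrite ?lerDl// => z'.
  rewrite /in_rect => /andP[/andP[z1 z2] /andP[z3 z4]].
  apply: cdif_cont; apply: hg; rewrite /in_rect (le_trans i1 z1) (le_trans i3 z3).
  by rewrite (le_trans z2 i2) (le_trans z4 i4).
have := @normc_rint_affine R (g z - D * z) D (e * (L / 2 ^+ n)) g _ _ _ _ _ _ ec.
rewrite !lerDl => /(_ (s0 n) (u0 n)) hb.
have hz' z' : in_rect (P n).1 ((P n).1 + s n) (P n).2 ((P n).2 + u n) z' ->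
    normc (g z' - (g z - D * z + D * z')) <= e * (L / 2 ^+ n).
  rewrite /in_rect => /andP[/andP[z1 z2] /andP[z3 z4]].
  have zz : normc (z' - z) <= L / 2 ^+ n.
    rewrite (le_trans (normc_le _))// -sL.
    have rB (A B : Cx R) : Re (A - B) = Re A - Re B by case: A; case: B.
    have iB (A B : Cx R) : Im (A - B) = Im A - Im B by case: A; case: B.
    by rewrite rB iB; apply: lerD; [apply: itv_dist hxn|apply: itv_dist hyn];
      apply/andP; split.
  rewrite (_ : _ - _ = g z' - g z - D * (z' - z)); last by ring.
  by rewrite (le_trans (hr _ (le_lt_trans zz hn)))// ler_wpM2l// ltW.
have := le_trans i5 (hb hz').
rewrite ![_.1 + _]addrC ![_.2 + _]addrC !addrK sL.
rewrite (_ : 4 * _ * _ = (4 * e * L ^+ 2) / 4 ^+ n); last first.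
  rewrite (_ : 4 ^+ n = 2 ^+ n * 2 ^+ n :> R); last first.
    by rewrite -exprMn; congr (_ ^+ _); rewrite -natrM.
  by rewrite invfM; ring.
rewrite ler_pM2r ?invr_gt0 ?exprn_gt0//.
rewrite /e => h; have : eta * (L + 1) ^+ 2 <= eta * L ^+ 2.
  rewrite -ler_pdivlMr ?exprn_gt0// (le_trans h)//.
  rewrite le_eqVlt; apply/orP; left; apply/eqP; field.
  by rewrite gt_eqF.
rewrite ler_pM2l// leNgt ltr_pXn2r ?nnegrE ?ltrDl ?ltr01//.
exact: ltW.
Qed.

Lemma goursat_rect g a b c d : a <= b -> c <= d ->
  (forall z, in_rect a b c d z -> cdif g z) -> rint g a b c d = 0.
Proof.
move=> ab cd hg; have := @goursat g a c (b - a) (d - c).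
by rewrite !subr_ge0 ![_ + (_ - _)]addrC !subrK; apply.
Qed.

Lemma derivable_cdif g z : derivable (g : (Cx R)^o -> (Cx R)^o) z 1 -> cdif g z.
Proof.
move=> dg; have [D hD] : exists D : Cx R,
    (fun k : Cx R => k^-1 * (g (z + k) - g z)) @ 0^' --> D.
  exists (lim ((fun k : Cx R => k^-1 * (g (z + k) - g z)) @ 0^')).
  have dE : (fun h : Cx R => h^-1 *: (((g : (Cx R)^o -> (Cx R)^o) \o shift z)
      (h *: (1 : (Cx R)^o)) - g z : (Cx R)^o)) =
      (fun k : Cx R => k^-1 * (g (z + k) - g z)).
    by apply/funext => k /=; rewrite /GRing.scale/= mulr1 [k + z]addrC.
  by move: dg; rewrite /derivable dE.
exists D => e e0.
have /cvgCP/(_ e e0) := hD.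
rewrite /dnbhs /within/= => /nbhsCP[r r0 hr].
exists r => // w wz; have [->|wz0] := eqVneq w z.
  by rewrite !subrr mulr0 subrr normc0E mulr0.
have wz1 : w - z != 0 by rewrite subr_eq0.
have := hr (w - z); rewrite subr0 => /(_ wz wz1) hh.
rewrite [z + _]addrC subrK in hh.
rewrite (_ : g w - g z - D * (w - z) = ((w - z)^-1 * (g w - g z) - D) * (w - z)).
  by rewrite normcM ler_wpM2r ?normc_ge0// ltW.
by rewrite mulrBl mulrAC mulVf ?mul1r.
Qed.

End MaximumPrinciple.

(** * Cauchy estimate and maximum principle on rectangles *)

Section RectangleMaximum.
Variable R : realType.
Implicit Types (a b c d x y s u e t B : R) (g h m : Cx R -> Cx R) (z w : Cx R).

Definition on_edges a b c d (P : Cx R -> Prop) :=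
  [/\ forall t, a <= t <= b -> P (Complex t c),
      forall t, a <= t <= b -> P (Complex t d),
      forall t, c <= t <= d -> P (Complex a t) &
      forall t, c <= t <= d -> P (Complex b t)].

Lemma normc_rint_le (M : R) g a b c d : a <= b -> c <= d ->
  edge_cont g a b c d -> on_edges a b c d (fun z => normc (g z) <= M) ->
  normc (rint g a b c d) <= 4 * M * ((b - a) + (d - c)).
Proof.
move=> ab cd [h1 h2 h3 h4] [M1 M2 M3 M4].
rewrite (le_trans (ler_normcD _ _))// normcM normc_i mul1r mulrDr.
rewrite (_ : 4 * M = 2 * (M + M)); last by ring.
apply: lerD.
  apply: (normc_cint_le ab (seg_contD h1 (seg_contN h2))) => t tab.
  by rewrite (le_trans (ler_normcB _ _))// lerD ?M1 ?M2.
apply: (normc_cint_le cd (seg_contD h4 (seg_contN h3))) => t tab.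
by rewrite (le_trans (ler_normcB _ _))// lerD ?M3 ?M4.
Qed.

Section Interior.
Variables (a b c d tx ty : R).
Hypotheses (atx : a < tx) (txb : tx < b) (cty : c < ty) (tyd : ty < d).
Let th : Cx R := Complex tx ty.
Let ab : a <= b. Proof. exact: ltW (lt_trans atx txb). Qed.
Let cd : c <= d. Proof. exact: ltW (lt_trans cty tyd). Qed.

Lemma on_edgesP (P : Cx R -> Prop) :
  (forall z, in_rect a b c d z -> z != th -> P z) -> on_edges a b c d P.
Proof.
move=> hP; split => t /andP[t1 t2]; apply: hP;
  rewrite ?/in_rect/= ?t1 ?t2 ?lexx ?ab ?cd//;
  by apply/eqP => -[] h1 h2; move: atx txb cty tyd; rewrite -?h1 -?h2 ltxx.
Qed.

(** A bounded singularity does not contribute: around a square of half side [s] centred at [th]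
    there remain four rectangles with zero integral, and the square itself gives at most 16 K s. *)
Lemma rint_punctured g (K r : R) : 0 < r ->
  (forall z, in_rect a b c d z -> z != th -> cdif g z) ->
  (forall z, normc (z - th) < r -> normc (g z) <= K) ->
  rint g a b c d = 0.
Proof.
move=> r0 hg hK; apply/eqP; rewrite -normc_eq0 eq_le normc_ge0 andbT.
have K0 : 0 <= K by rewrite (le_trans (normc_ge0 _) (hK th _))// subrr normc0E.
have gc z : in_rect a b c d z -> z != th -> {for z, continuous g}.
  by move=> z1 z2; apply: cdif_cont; exact: hg.
(* Points of the square of half side [s] are at distance at most 2 s from [th], hence within [r]
   when s <= r / 4. *)
pose d0 := Num.min (Num.min (tx - a) (b - tx)) (Num.min (Num.min (ty - c) (d - ty)) (r / 4)).
have d00 : 0 < d0 by rewrite !lt_min !subr_gt0 atx txb cty tyd divr_gt0.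
have main s : 0 < s -> s <= d0 -> normc (rint g a b c d) <= 16 * K * s.
  move=> s0; rewrite !le_min => /andP[/andP[s1 s2] /andP[/andP[s3 s4] s5]].
  have hs t m : a <= t <= b -> forall c' d', c <= c' -> d' <= d ->
      (forall y, c' <= y <= d' -> Complex t y != th) ->
      seg_cont c' d' (fun y => g (Complex t y)).
    move=> tab c' d' cc dd hne y /andP[y1 y2].
    have hC : {for y, continuous (fun y => Complex t y : Cx R)}.
      by apply: continuous_Complex; [exact: cvg_cst|exact: cvg_id].
    apply: (continuous_comp hC (gc _ _ _)); last by apply: hne; rewrite y1.
    by rewrite /in_rect/= tab (le_trans cc y1) (le_trans y2 dd).
  have vs t m : c <= t <= d -> forall c' d', a <= c' -> d' <= b ->
      (forall y, c' <= y <= d' -> Complex y t != th) ->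
      seg_cont c' d' (fun y => g (Complex y t)).
    move=> tab c' d' cc dd hne y /andP[y1 y2].
    have hC : {for y, continuous (fun y => Complex y t : Cx R)}.
      by apply: continuous_Complex; [exact: cvg_id|exact: cvg_cst].
    apply: (continuous_comp hC (gc _ _ _)); last by apply: hne; rewrite y1.
    by rewrite /in_rect/= tab (le_trans cc y1) (le_trans y2 dd).
  have nx t y : t != tx -> Complex t y != th.
    by move=> h; apply/eqP => -[] /eqP; rewrite (negbTE h).
  have ny t y : y != ty -> Complex t y != th.
    by move=> h; apply/eqP => -[] _ /eqP; rewrite (negbTE h).
  have Vs t c' d' : t != tx -> a <= t -> t <= b -> c <= c' -> d' <= d ->
      seg_cont c' d' (fun y => g (Complex t y)).
    by move=> tt t1 t2 cc dd; apply: hs => //; [rewrite t1|move=> y _; exact: nx].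
  have Hs t c' d' : t != ty -> c <= t -> t <= d -> a <= c' -> d' <= b ->
      seg_cont c' d' (fun y => g (Complex y t)).
    by move=> tt t1 t2 cc dd; apply: vs => //; [rewrite t1|move=> y _; exact: ny].
  have [x1 x2] : tx - s != tx /\ tx + s != tx.
    by rewrite lt_eqF ?gt_eqF ?ltrDl// ltrBlDr ltrDl.
  have [y1 y2] : ty - s != ty /\ ty + s != ty.
    by rewrite lt_eqF ?gt_eqF ?ltrDl// ltrBlDr ltrDl.
  have [an bn cn dn] : [/\ a != tx, b != tx, c != ty & d != ty].
    by rewrite (lt_eqF atx) (gt_eqF txb) (lt_eqF cty) (gt_eqF tyd).
  have [p1 p2 p3 p4] : [/\ a <= tx - s, tx - s <= tx + s, tx + s <= b &
      tx - s <= b] by split; lra.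
  have [q1 q2 q3 q4] : [/\ c <= ty - s, ty - s <= ty + s, ty + s <= d &
      ty - s <= d] by split; lra.
  have p5 := le_trans p1 p2; have q5 := le_trans q1 q2.
  have e0 : edge_cont g a b c d.
    exact: And4 (Hs _ _ _ cn (lexx _) cd (lexx _) (lexx _))
      (Hs _ _ _ dn cd (lexx _) (lexx _) (lexx _))
      (Vs _ _ _ an (lexx _) ab (lexx _) (lexx _))
      (Vs _ _ _ bn ab (lexx _) (lexx _) (lexx _)).
  have v1 := Vs _ _ _ x1 p1 p4 (lexx c) (lexx d).
  have v2 := Vs _ _ _ x2 p5 p3 (lexx c) (lexx d).
  have e1 : edge_cont g (tx - s) b c d.
    case: e0 => E1 E2 _ E4.
    exact: And4 (seg_contS p1 (lexx b) E1) (seg_contS p1 (lexx b) E2) v1 E4.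
  have e2 : edge_cont g (tx - s) (tx + s) c d.
    case: e1 => E1 E2 E3 _.
    exact: And4 (seg_contS (lexx _) p3 E1) (seg_contS (lexx _) p3 E2) E3 v2.
  have h1 := Hs _ _ _ y1 q1 q4 p1 p3.
  have h2 := Hs _ _ _ y2 q5 q3 p1 p3.
  have e3 : edge_cont g (tx - s) (tx + s) (ty - s) d.
    case: e2 => E1 E2 E3 E4.
    exact: And4 h1 E2 (seg_contS q1 (lexx _) E3) (seg_contS q1 (lexx _) E4).
  have e4 : edge_cont g (tx - s) (tx + s) (ty - s) (ty + s).
    case: e3 => E1 E2 E3 E4.
    exact: And4 E1 h2 (seg_contS (lexx _) q3 E3) (seg_contS (lexx _) q3 E4).
  rewrite (@rint_vsplit _ g a b c d (tx - s) _ e0 v1) ?p1//.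
  rewrite (@rint_vsplit _ g (tx - s) b c d (tx + s) _ e1 v2) ?p2//.
  rewrite (@rint_hsplit _ g (tx - s) (tx + s) c d (ty - s) _ e2 h1) ?q1//.
  rewrite (@rint_hsplit _ g (tx - s) (tx + s) (ty - s) d (ty + s) _ e3 h2) ?q2//.
  rewrite (@goursat_rect _ g a (tx - s) c d)//; last first.
    move=> z /andP[/andP[z1 z2] /andP[z3 z4]]; apply: hg.
      by rewrite /in_rect z1 z3 z4 (le_trans z2).
    by apply/eqP => ze; move: z2; rewrite ze /=; apply/negP; rewrite -ltNge; lra.
  rewrite (@goursat_rect _ g (tx + s) b c d)//; last first.
    move=> z /andP[/andP[z1 z2] /andP[z3 z4]]; apply: hg.
      by rewrite /in_rect z2 z3 z4 (le_trans _ z1).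
    by apply/eqP => ze; move: z1; rewrite ze /=; apply/negP; rewrite -ltNge; lra.
  rewrite (@goursat_rect _ g (tx - s) (tx + s) c (ty - s))//; last first.
    move=> z /andP[/andP[z1 z2] /andP[z3 z4]]; apply: hg.
      by rewrite /in_rect z3 (le_trans p1 z1) (le_trans z2 p3) (le_trans z4 q4).
    by apply/eqP => ze; move: z4; rewrite ze /=; apply/negP; rewrite -ltNge; lra.
  rewrite (@goursat_rect _ g (tx - s) (tx + s) (ty + s) d)//; last first.
    move=> z /andP[/andP[z1 z2] /andP[z3 z4]]; apply: hg.
      by rewrite /in_rect z4 (le_trans p1 z1) (le_trans z2 p3) (le_trans q5 z3).
    by apply/eqP => ze; move: z3; rewrite ze /=; apply/negP; rewrite -ltNge; lra.
  rewrite !add0r !addr0.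
  have := @normc_rint_affine R 0 0 K g _ _ _ _ p2 q2 e4.
  move=> h; rewrite (le_trans (h _))//; last first.
    rewrite le_eqVlt; apply/orP; left; apply/eqP; ring.
  move=> z /andP[/andP[z1 z2] /andP[z3 z4]]; rewrite mul0r addr0 subr0; apply: hK.
  rewrite (le_lt_trans (normc_le _))//.
  have rB (A C : Cx R) : Re (A - C) = Re A - Re C by case: A; case: C.
  have iB (A C : Cx R) : Im (A - C) = Im A - Im C by case: A; case: C.
  have : `|Re (z - th)| <= s.
    by rewrite rB /= ler_norml; apply/andP; split; lra.
  have : `|Im (z - th)| <= s.
    by rewrite iB /= ler_norml; apply/andP; split; lra.
  by move=> ? ?; lra.
rewrite leNgt; apply/negP => n0.
have K1 : 0 < 16 * K + 1 by rewrite ltr_wpDl// mulr_ge0.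
pose s := Num.min d0 (normc (rint g a b c d) / (16 * K + 1) / 2).
have s0 : 0 < s by rewrite lt_min d00 !divr_gt0.
have := main s s0; rewrite ge_min lexx => /(_ isT).
apply/negP; rewrite -ltNge.
apply: (@le_lt_trans _ _ ((16 * K + 1) * s)).
  by rewrite ler_wpM2r ?(ltW s0)// lerDl.
rewrite mulrC -ltr_pdivlMr// gt_min; apply/orP; right.
by rewrite ltr_pdivrMr// ltr_pMr ?divr_gt0// ltr1n.
Qed.

Let k z : Cx R := (z - th)^-1.

Lemma derivable_k z : z != th -> derivable (k : (Cx R)^o -> (Cx R)^o) z 1.
Proof.
move=> zth; apply: derivableV; first by rewrite subr_eq0.
exact: (@derivableB _ (Cx R)^o (Cx R)^o id (cst th) z 1
  (@derivable_id _ _ z 1) (@derivable_cst _ _ _ th z 1)).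
Qed.

(** Instead of the value 2 pi i, only the sign of the imaginary part is computed: the horizontal
    edges contribute a nonnegative amount and the vertical ones a positive amount. *)
Lemma rint_k_neq0 : rint k a b c d != 0.
Proof.
have kc z : in_rect a b c d z -> z != th -> {for z, continuous k}.
  by move=> _ z2; apply: cdif_cont; apply: derivable_cdif; exact: derivable_k.
suff : 0 < Im (rint k a b c d).
  by apply: contraTneq => ->; rewrite ltxx.
have kE x y : k (Complex x y) =
    Complex ((x - tx) / ((x - tx) ^+ 2 + (y - ty) ^+ 2))
            (- (y - ty) / ((x - tx) ^+ 2 + (y - ty) ^+ 2)).
  by rewrite /k /GRing.inv /= mulNr.
have cr : seg_cont c d (fun t => k (Complex b t) - k (Complex a t)).
  apply: seg_contD => [t tcd|]; last apply: seg_contN => t tcd.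
    have hC : {for t, continuous (fun t => Complex b t : Cx R)}.
      by apply: continuous_Complex; [exact: cvg_cst|exact: cvg_id].
    apply: (continuous_comp hC (kc _ _ _)); first by rewrite /in_rect/= ab lexx.
    by apply/eqP => -[] h _; move: txb; rewrite h ltxx.
  have hC : {for t, continuous (fun t => Complex a t : Cx R)}.
    by apply: continuous_Complex; [exact: cvg_cst|exact: cvg_id].
  apply: (continuous_comp hC (kc _ _ _)); first by rewrite /in_rect/= ab lexx.
  by apply/eqP => -[] h _; move: atx; rewrite h ltxx.
have ImD (A B : Cx R) : Im (A + 'i * B) = Im A + Re B.
  by case: A => A1 A2; case: B => B1 B2 /=; rewrite mul0r mul1r add0r.
have ImC x y : Im (Complex x y : Cx R) = y by [].
have ReC x y : Re (Complex x y : Cx R) = x by [].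
rewrite /rint ImD /cint ImC ReC.
pose den t := (b - tx) ^+ 2 + t ^+ 2.
(* A lower bound for the real part of [k] on the right edge, since |t - ty| <= d - c there. *)
pose M := (b - tx) / den (d - c).
have den0 t : 0 < den t by rewrite ltr_pwDl ?sqr_ge0// exprn_gt0// subr_gt0.
have M0 : 0 < M by rewrite divr_gt0// subr_gt0.
apply: (@lt_le_trans _ _ (0 + M * (d - c))).
  by rewrite add0r mulr_gt0// subr_gt0 (lt_trans cty).
apply: lerD.
  apply: Rintegral_ge0 => t tab; rewrite !kE /=.
  have sq : (c - ty) / ((t - tx) ^+ 2 + (c - ty) ^+ 2) <= 0.
    by rewrite mulr_le0_ge0 ?subr_le0 ?ltW// invr_gt0 ltr_wpDl ?sqr_ge0//
      exprn_even_gt0//= subr_eq0 lt_eqF.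
  have sq2 : 0 <= (d - ty) / ((t - tx) ^+ 2 + (d - ty) ^+ 2).
    by rewrite divr_ge0 ?subr_ge0 ?ltW// ltr_wpDl ?sqr_ge0// exprn_gt0// subr_gt0.
  by rewrite !mulNr opprK addr_ge0// oppr_ge0.
rewrite -[leLHS](_ : \int[lebesgue_measure]_(t in `[c, d]) M = _); last first.
  rewrite Rintegral_cst//= lebesgue_measure_itv/= lte_fin.
  by rewrite (lt_trans cty tyd).
apply: le_Rintegral => //.
- apply: continuous_compact_integrable; first exact: segment_compact.
  by apply: continuous_subspaceT => t; exact: cvg_cst.
- exact: seg_cont_Re cr.
have tdist (t : R) : c <= t <= d -> `|t - ty| <= d - c.
  by move=> /andP[? ?]; rewrite ler_norml opprB !lerB// ltW.
move=> t tcd; rewrite !kE /=.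
have q1 : (a - tx) / ((a - tx) ^+ 2 + (t - ty) ^+ 2) <= 0.
  by rewrite mulr_le0_ge0 ?subr_le0 ?(ltW atx)// invr_ge0 addr_ge0 ?sqr_ge0.
have q2 : M <= (b - tx) / ((b - tx) ^+ 2 + (t - ty) ^+ 2).
  rewrite ler_pM2l ?subr_gt0// lef_pV2 ?posrE ?den0 ?(den0 (t - ty))//.
  rewrite lerD2l -[leLHS]real_normK ?num_real// ler_pXn2r ?nnegrE ?subr_ge0//.
  by apply: tdist; move: tcd; rewrite /= in_itv.
by rewrite (le_trans q2)// lerDl oppr_ge0.
Qed.

(** Cauchy's formula: [k z * (m z - m th)] is bounded near [th], so its boundary integral vanishes
    and [m th] is a quotient of two boundary integrals. The point is that [K] depends on the
    rectangle and on [th] but not on [m], so that the estimate may be applied to powers. *)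
Lemma cauchy_bound : exists K, forall m B, 0 <= B ->
  (forall z, in_rect a b c d z -> derivable (m : (Cx R)^o -> (Cx R)^o) z 1) ->
  on_edges a b c d (fun z => normc (m z) <= B) -> normc (m th) <= K * B.
Proof.
pose r := Num.min (Num.min (tx - a) (b - tx)) (Num.min (ty - c) (d - ty)).
have r0 : 0 < r by rewrite !lt_min !subr_gt0 atx txb cty tyd.
have n0 : 0 < normc (rint k a b c d) by rewrite normc_gt0 rint_k_neq0.
exists (4 / r * ((b - a) + (d - c)) / normc (rint k a b c d)) => m B B0 dm mB.
have econt g : (forall z, in_rect a b c d z -> z != th ->
    derivable (g : (Cx R)^o -> (Cx R)^o) z 1) -> edge_cont g a b c d.
  move=> dg; have gc z : in_rect a b c d z -> z != th -> {for z, continuous g}.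
    by move=> z1 z2; apply: cdif_cont; apply: derivable_cdif; exact: dg.
  have [E1 E2 E3 E4] := on_edgesP gc.
  have hC t u : {for u, continuous (fun y => Complex t y : Cx R)}.
    by apply: continuous_Complex; [exact: cvg_cst|exact: cvg_id].
  have hC' t u : {for u, continuous (fun y => Complex y t : Cx R)}.
    by apply: continuous_Complex; [exact: cvg_id|exact: cvg_cst].
  split=> t tt.
  - exact: (continuous_comp (hC' _ _) (E1 _ tt)).
  - exact: (continuous_comp (hC' _ _) (E2 _ tt)).
  - exact: (continuous_comp (hC _ _) (E3 _ tt)).
  - exact: (continuous_comp (hC _ _) (E4 _ tt)).
pose g z := k z * (m z - m th).
have dk z : in_rect a b c d z -> z != th -> derivable (k : (Cx R)^o -> (Cx R)^o) z 1.
  by move=> _; exact: derivable_k.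
have dmk z : in_rect a b c d z -> z != th ->
    derivable ((fun z => k z * m z) : (Cx R)^o -> (Cx R)^o) z 1.
  by move=> z1 z2; apply: derivableM; [exact: derivable_k|exact: dm].
have thr : in_rect a b c d th by rewrite /in_rect/= !ltW.
have g0 : rint g a b c d = 0.
  have [D hD] := derivable_cdif (dm th thr).
  have [s s0 hs] := hD 1 ltr01.
  apply: (@rint_punctured g (normc D + 1) s) => // z.
    move=> z1 z2; apply: derivable_cdif; apply: derivableM; first exact: derivable_k.
    exact: (@derivableB _ (Cx R)^o (Cx R)^o m (cst (m th)) z 1
      (dm _ z1) (@derivable_cst _ _ _ (m th) z 1)).
  move=> /hs; rewrite mul1r /g /k => h.
  have [->|zth] := eqVneq z th.
    by rewrite !subrr mulr0 normc0E addr_ge0// normc_ge0.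
  have zn : 0 < normc (z - th) by rewrite normc_gt0 subr_eq0.
  rewrite normcM normcV mulrC ler_pdivrMr//.
  rewrite (_ : m z - m th = (m z - m th - D * (z - th)) + D * (z - th)); last by ring.
  by rewrite (le_trans (ler_normcD _ _))// normcM mulrDl mul1r addrC lerD.
have ek := econt _ dk; have emk := econt _ dmk.
have key : rint (fun z => k z * m z) a b c d = m th * rint k a b c d.
  rewrite -[LHS](subrK (m th * rint k a b c d)) -[X in _ = X]add0r -g0; congr (_ + _).
  rewrite -mulNr -(rintZ (- m th) ek) -(rintD emk (edge_contZ (- m th) ek)).
  by apply: (eq_rint ab cd) => t _; rewrite /g; ring.
rewrite mulrAC ler_pdivlMr// -normcM -key.
have -> : 4 / r * (b - a + (d - c)) * B = 4 * (r^-1 * B) * (b - a + (d - c)) by ring.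
apply: (normc_rint_le ab cd emk).
have kr : on_edges a b c d (fun z => normc (k z) <= r^-1).
  have hk z : r <= normc (z - th) -> normc (k z) <= r^-1.
    by move=> rz; rewrite /k normcV lef_pV2// posrE// (lt_le_trans r0).
  have [rm1 rm2 rm3 rm4] : [/\ r <= tx - a, r <= b - tx, r <= ty - c & r <= d - ty].
    by rewrite /r !ge_min !lexx ?orbT.
  split => t _; apply: hk.
  - by apply: le_trans (normc_Im _); rewrite /= distrC; apply: le_trans (ler_norm _).
  - by apply: le_trans (normc_Im _); rewrite /=; apply: le_trans (ler_norm _).
  - by apply: le_trans (normc_Re _); rewrite /= distrC; apply: le_trans (ler_norm _).
  - by apply: le_trans (normc_Re _); rewrite /=; apply: le_trans (ler_norm _).
case: kr mB => k1 k2 k3 k4 [m1 m2 m3 m4].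
by split => t tt; rewrite normcM; apply: ler_pM; rewrite ?normc_ge0//; auto.
Qed.

Lemma pow_bounded_le1 (x K : R) : 0 <= x -> (forall n, x ^+ n <= K) -> x <= 1.
Proof.
move=> x0 hx; rewrite leNgt; apply/negP => x1.
have y0 : 0 < x - 1 by rewrite subr_gt0.
have K1 : 1 <= K by have := hx 0%N; rewrite expr0.
have bern n : 1 + (x - 1) *+ n <= x ^+ n.
  elim: n => [|n ih]; first by rewrite mulr0n addr0 expr0.
  rewrite exprS mulrS (le_trans _ (ler_wpM2l x0 ih))//.
  have N0 : 0 <= (x - 1) *+ n by rewrite mulrn_wge0// ltW.
  move: (_ *+ n) N0 => N N0.
  rewrite (_ : x * _ = 1 + (x - 1 + N) + (x - 1) * N); last by ring.
  by rewrite lerDl mulr_ge0// ltW.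
have [n hn] : exists n, K < (x - 1) *+ n.
  exists (Num.bound (K / (x - 1))).
  rewrite -mulr_natr mulrC -ltr_pdivrMr//.
  by rewrite archi_boundP// divr_ge0 ?(ltW y0)// (le_trans ler01).
have := le_lt_trans (le_trans (bern n) (hx n)) hn.
by rewrite ltNge lerDr ler01.
Qed.

(* Applying the Cauchy estimate to all the powers of h removes its constant. *)
Lemma rect_max h B : 0 <= B ->
  (forall z, in_rect a b c d z -> derivable (h : (Cx R)^o -> (Cx R)^o) z 1) ->
  on_edges a b c d (fun z => normc (h z) <= B) -> normc (h th) <= B.
Proof.
move=> B0 dh hB; have [K hK] := cauchy_bound.
have hn n : normc (h th) ^+ n <= K * B ^+ n.
  rewrite -normcX; apply: (hK (fun z => h z ^+ n)); first exact: exprn_ge0.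
    move=> z /dh dz; elim: n => [|n ih].
      rewrite (_ : (fun z => _) = cst 1); first exact: derivable_cst.
      by apply/funext => y; rewrite expr0.
    rewrite (_ : (fun z => _) = fun z => h z * h z ^+ n).
      exact: derivableM dz ih.
    by apply/funext => y; rewrite exprS.
  have pw z : normc (h z) <= B -> normc (h z ^+ n) <= B ^+ n.
    by move=> hz; rewrite normcX lerXn2r// nnegrE normc_ge0.
  by case: hB => h1 h2 h3 h4; split => t tt; apply: pw; auto.
have [B0'|Bn0] := eqVneq B 0.
  by have := hn 1%N; rewrite !expr1 B0' mulr0.
have Bp : 0 < B by rewrite lt_def Bn0.
rewrite -[leRHS]mul1r -ler_pdivrMr//.
apply: (@pow_bounded_le1 _ K); first by rewrite divr_ge0 ?normc_ge0.
by move=> n; rewrite expr_div_n ler_pdivrMr ?exprn_gt0.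
Qed.

End Interior.
End RectangleMaximum.

(** * Bounded holomorphic functions on the strip *)

Section Strip.
Variable R : realType.
Implicit Types (h g : Cx R -> Cx R) (z w : Cx R).
Local Notation cstrip := (@closed_strip R).
Local Notation ostrip := (@open_strip R).

(** What a Calderon function becomes under a functional bounded for both end point norms, see
    [calderon_strip_hol]. *)
Definition strip_hol h := [/\ exists S, forall z, cstrip z -> normc (h z) <= S,
  forall z, cstrip z -> h w @[w --> within cstrip (nbhs z)] --> h z &
  forall z, ostrip z -> derivable (h : (Cx R)^o -> (Cx R)^o) z 1].

Lemma strip_hol_cst (k : Cx R) : strip_hol (fun=> k).
Proof.
split; first by exists (normc k).
  by move=> z _; exact: cvg_cst.
by move=> z _; exact: derivable_cst.
Qed.

Lemma strip_holD h g : strip_hol h -> strip_hol g ->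
  strip_hol (fun z => h z + g z).
Proof.
move=> [[S hS] ch dh] [[S' gS] cg dg]; split.
- exists (S + S') => z zs; rewrite (le_trans (ler_normcD _ _))// lerD//; [exact: hS|exact: gS].
- by move=> z zs; apply: cvgD; [exact: ch|exact: cg].
- by move=> z zs; exact: derivableD (dh _ zs) (dg _ zs).
Qed.

Lemma strip_holM h g : strip_hol h -> strip_hol g ->
  strip_hol (fun z => h z * g z).
Proof.
move=> [[S hS] ch dh] [[S' gS] cg dg]; split.
- exists (S * S') => z zs; rewrite normcM ler_pM ?normc_ge0//; [exact: hS|exact: gS].
- by move=> z zs; apply: cvgM; [exact: ch|exact: cg].
- by move=> z zs; exact: derivableM (dh _ zs) (dg _ zs).
Qed.

Lemma strip_hol_sum (J : Type) (r : seq J) (P : pred J) (f : J -> Cx R -> Cx R) :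
  (forall j, strip_hol (f j)) -> strip_hol (fun z => \sum_(j <- r | P j) f j z).
Proof.
move=> hf; elim: r => [|j r ih].
  rewrite (_ : (fun z => _) = fun=> 0); first exact: strip_hol_cst.
  by apply/funext => z; rewrite big_nil.
case/boolP: (P j) => Pj.
  rewrite (_ : (fun z => _) = fun z => f j z + \sum_(j <- r | P j) f j z).
    exact: (strip_holD (hf j) ih).
  by apply/funext => z; rewrite big_cons Pj.
rewrite (_ : (fun z => _) = fun z => \sum_(j <- r | P j) f j z)//.
by apply/funext => z; rewrite big_cons (negbTE Pj).
Qed.

Lemma cstrip1B z : cstrip (1 - z) <-> cstrip z.
Proof.
rewrite /closed_strip/=; case: z => a b /=.
by split=> -[h1 h2]; split; lra.
Qed.

Lemma ostrip1B z : ostrip (1 - z) <-> ostrip z.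
Proof.
rewrite /open_strip/=; case: z => a b /=.
by split=> -[h1 h2]; split; lra.
Qed.

(** The reflection exchanges the boundary lines and carries 1/p to 1/q for conjugate exponents, so
    that Calderon functions for [p] and for [q] can be paired at one point. *)
Lemma strip_hol_reflect h : strip_hol h -> strip_hol (fun z => h (1 - z)).
Proof.
move=> [[S hS] ch dh]; split.
- by exists S => z /cstrip1B /hS.
- move=> z /cstrip1B zs; apply/cvgCP => e e0.
  have /cvgCP/(_ e e0) := ch _ zs.
  rewrite /within/= => /nbhsCP[r r0 hr]; apply/nbhsCP; exists r => // w wz ws.
  apply: hr; last exact/cstrip1B.
  by rewrite normcBC; congr (normc _ < _): wz; ring.
- move=> z /ostrip1B zs; apply/derivable1_diffP.
  apply: (@differentiable_comp _ _ _ _ (fun z : (Cx R)^o => 1 - z : (Cx R)^o) h).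
    apply/derivable1_diffP; exact: (@derivableB _ (Cx R)^o (Cx R)^o (cst (1 : Cx R)) id z 1
      (@derivable_cst _ (Cx R)^o (Cx R)^o (1 : Cx R) z 1) (@derivable_id _ _ z 1)).
  by apply/derivable1_diffP; exact: dh.
Qed.

(** The maximum principle needs rectangles inside the open strip, where [h] is differentiable.
    Compactness of the segment gives a collar of uniform width on which a strict boundary bound
    persists. *)
Lemma strip_tube h x0 (B L : R) : x0 = 0 \/ x0 = 1 -> strip_hol h ->
  (forall t, normc (h (Complex x0 t)) < B) ->
  exists2 r : R, 0 < r & forall x t, 0 <= x <= 1 -> `|x - x0| < r -> `|t| <= L ->
    normc (h (Complex x t)) <= B.
Proof.
move=> x01 [_ ch _] hB.
have cK : compact (`[- L, L] : set R) by exact: segment_compact.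
have /compact_near_coveringP := cK.
move=> /(_ _ (nbhs x0) (fun x t => 0 <= x <= 1 -> normc (h (Complex x t)) <= B) _).
have x0s : 0 <= x0 <= 1 by case: x01 => ->; rewrite lexx ler01.
case=> [t _|/= ].
  have zs : cstrip (Complex x0 t) by move/andP: x0s.
  have e0 : 0 < B - normc (h (Complex x0 t)) by rewrite subr_gt0.
  have /cvgCP/(_ _ e0) := ch _ zs.
  rewrite /within/= => /nbhsCP[r r0 hr].
  exists (ball t (r / 2), ball x0 (r / 2)) => /=.
    by split; apply: nbhsx_ballx; rewrite divr_gt0.
  move=> [t' x] /= [tt xx] xs.
  have := hr (Complex x t'); rewrite /= => /(_ _).
  have -> : normc (Complex x t' - Complex x0 t) < r.
    rewrite (le_lt_trans (normc_le _))//= [ltRHS]splitr ltrD//.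
      by rewrite distrC.
    by rewrite distrC.
  move=> /(_ isT) hh; have {}hh := hh (andP xs).
  have := ler_normcD (h (Complex x t') - h (Complex x0 t)) (h (Complex x0 t)).
  by rewrite subrK => h1; rewrite (le_trans h1)// -lerBrDr ltW.
move=> e e0 he; exists e => // x t xs xe tL.
apply: (he x _ t) => //; first by rewrite /ball_ /= distrC.
by rewrite /= in_itv/= -ler_norml.
Qed.

Lemma derivable_affineV (e : R) z : 1 + e%:C * z != 0 ->
  derivable ((fun z => (1 + e%:C * z)^-1) : (Cx R)^o -> (Cx R)^o) z 1.
Proof.
move=> n0; apply: derivableV; first exact: n0.
apply: (@derivableD _ (Cx R)^o (Cx R)^o (cst (1 : Cx R)) (fun z => e%:C * z) z 1
  (@derivable_cst _ (Cx R)^o (Cx R)^o (1 : Cx R) z 1)).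
exact: (@derivableM _ (Cx R)^o (cst e%:C) id z 1 (@derivable_cst _ _ _ _ z 1)
  (@derivable_id _ _ z 1)).
Qed.

(* Dividing by 1 + e z makes h vanish at infinity in the strip. *)
Lemma three_lines h (B th : R) : 0 < th < 1 -> strip_hol h -> 0 <= B ->
  (forall t, normc (h (Complex 0 t)) <= B) ->
  (forall t, normc (h (Complex 1 t)) <= B) -> normc (h th%:C) <= B.
Proof.
move=> /andP[th0 th1] hh B0 h0 h1.
have [[S hS] ch dh] := hh.
suff main B' e : B < B' -> 0 < e -> normc (h th%:C) <= B' * (1 + e).
  apply/ler_addgt0Pr => e e0.
  have e20 : 0 < e / 2 by rewrite divr_gt0.
  have p0 : 0 < B + e / 2 by rewrite ltr_wpDl.
  have := main (B + e / 2) (e / 2 / (B + e / 2)); rewrite ltrDl => /(_ e20).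
  move=> /(_ (divr_gt0 e20 p0)) hm; rewrite (le_trans hm)//.
  rewrite mulrDr mulr1 mulrCA divff ?gt_eqF// mulr1.
  by rewrite -addrA -splitr.
move=> BB' e0; have B'0 : 0 < B' by exact: le_lt_trans BB'.
(* At height [L] the damping factor is at most 1 / (e L), which brings the global bound [S] below
   B'. *)
pose L := Num.max 1 (S / (e * B')).
have L1 : 1 <= L by rewrite le_max lexx.
have L0 : 0 < L by rewrite (lt_le_trans ltr01).
have LS : S <= B' * (e * L).
  have : S / (e * B') <= L by rewrite le_max lexx orbT.
  by rewrite ler_pdivrMr ?mulr_gt0//; congr (_ <= _); ring.
have [r0 r00 hr0] := @strip_tube h 0 B' L (or_introl erefl) hh
  (fun t => le_lt_trans (h0 t) BB').
have [r1 r10 hr1] := @strip_tube h 1 B' L (or_intror erefl) hh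
  (fun t => le_lt_trans (h1 t) BB').
(* The vertical edges, at distance [s] from the boundary lines, lie in the two collars and have [th]
   strictly between them. *)
pose s := Num.min (Num.min (r0 / 2) (r1 / 2)) (Num.min (th / 2) ((1 - th) / 2)).
have s0 : 0 < s by rewrite !lt_min !divr_gt0// subr_gt0.
have [s1 s2 s3 s4] : [/\ s < r0, s < r1, s < th & s < 1 - th].
  have lthalf (x : R) : 0 < x -> s <= x / 2 -> s < x.
    by move=> x0 sx; rewrite (le_lt_trans sx)// ltr_pdivrMr// ltr_pMr// ltr1n.
  have [q1 q2 q3 q4] : [/\ s <= r0 / 2, s <= r1 / 2, s <= th / 2 &
      s <= (1 - th) / 2] by rewrite /s !ge_min !lexx ?orbT.
  by split; apply: lthalf => //; rewrite subr_gt0.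
have t1s : th < 1 - s by rewrite ltrBrDr -ltrBrDl.
pose v z := (1 + e%:C * z)^-1 : Cx R.
have RE z : Re (1 + e%:C * z) = 1 + e * Re z.
  by case: z => a b /=; rewrite mul0r subr0.
have IE z : Im (1 + e%:C * z) = e * Im z.
  by case: z => a b /=; rewrite mul0r addr0 add0r.
have n1 z : 0 <= Re z -> 1 <= normc (1 + e%:C * z).
  move=> z0; rewrite (le_trans _ (normc_Re _))// RE (le_trans _ (ler_norm _))//.
  by rewrite lerDl mulr_ge0// ltW.
have vn z : 0 <= Re z -> 1 + e%:C * z != 0.
  by move=> /n1 n1z; rewrite -normc_gt0 (lt_le_trans ltr01).
have v1 z : 0 <= Re z -> normc (v z) <= 1.
  by move=> /n1 n1z; rewrite normcV invf_le1// (lt_le_trans ltr01).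
have key : normc (h th%:C * v th%:C) <= B'.
  apply: (@rect_max R s (1 - s) (- L) L th 0 s3 t1s _ L0 (fun z => h z * v z)).
  - by rewrite oppr_lt0.
  - exact: ltW.
  - move=> z /andP[/andP[z1 z2] _].
    have z0 : 0 < Re z by rewrite (lt_le_trans s0).
    apply: (@derivableM _ (Cx R)^o h v z 1).
      by apply: dh; split => //; rewrite (le_lt_trans z2)// ltrBlDr ltrDl.
    by apply: derivable_affineV; apply: vn; exact: ltW.
  have bd z : cstrip z -> `|Im z| = L -> normc (h z * v z) <= B'.
    move=> zs zL; rewrite normcM normcV.
    have np : e * L <= normc (1 + e%:C * z).
      by rewrite (le_trans _ (normc_Im _))// IE normrM zL gtr0_norm.
    have eL : 0 < e * L by rewrite mulr_gt0.
    rewrite ler_pdivrMr ?(lt_le_trans eL)// (le_trans (hS _ zs))//.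
    by rewrite (le_trans LS)// ler_pM2l.
  have sd z : 0 <= Re z -> normc (h z) <= B' -> normc (h z * v z) <= B'.
    move=> z0 hz; rewrite normcM -[leRHS]mulr1 ler_pM ?normc_ge0//.
    exact: v1.
  have s12 : s < 1 - s by rewrite (lt_trans s3).
  have s11 : 1 - s <= 1 by rewrite gerBl ltW.
  split=> t /andP[t1 t2].
  - apply: bd; last by rewrite /= normrN gtr0_norm.
    by split => /=; [rewrite (le_trans _ t1)// ltW|rewrite (le_trans t2)].
  - apply: bd; last by rewrite /= gtr0_norm.
    by split => /=; [rewrite (le_trans _ t1)// ltW|rewrite (le_trans t2)].
  - apply: sd; first exact: ltW.
    apply: hr0; rewrite ?subr0 ?ler_norml ?t1//.
      by rewrite (ltW s0) (le_trans (ltW s12)).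
    by rewrite gtr0_norm.
  - apply: sd => /=; first by rewrite (le_trans (ltW s0) (ltW s12)).
    apply: hr1; rewrite ?ler_norml ?t1//.
      by rewrite s11 (le_trans (ltW s0) (ltW s12)).
    by rewrite addrAC subrr add0r normrN gtr0_norm.
move: key; rewrite normcM normcV ler_pdivrMr; last first.
  by rewrite (lt_le_trans ltr01)// n1 //= ltW.
move=> key; rewrite (le_trans key)// ler_pM2l//.
rewrite (_ : 1 + e%:C * th%:C = (1 + e * th)%:C); last first.
  by rewrite rmorphD rmorphM.
have p0 : 0 <= 1 + e * th by rewrite ltW// addr_gt0// mulr_gt0.
by rewrite normc_real ger0_norm// lerD2l ger_pMr// ltW.
Qed.

End Strip.

(** * Unordered sums and the Hilbert space l2 *)

#[global] Existing Instance totally_filter.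

Section UnorderedSums.
Variables (R : realType) (J : choiceType).
Implicit Types (f g : J -> Cx R) (F G : {fset J}).

Definition fsum (V : nmodType) (f : J -> V) (F : {fset J}) : V := \sum_(i <- F) f i.

Lemma esum_le_fset (a : J -> \bar R) (M : \bar R) :
  (\esum_(i in [set: J]) a i <= M)%E <->
  forall F : {fset J}, (\sum_(i <- F) a i <= M)%E.
Proof.
split=> [h F|h].
  apply: le_trans h; apply: ereal_sup_ubound; exists [set` F].
    by split=> //; exact: finite_fset.
  by rewrite -fsbig_seq// fset_uniq.
apply: ge_ereal_sup => _ [X [finX _] <-].
by rewrite fsbig_finite// h.
Qed.

Lemma esumEFin_le (a : J -> R) (M : R) :
  (\esum_(i in [set: J]) (a i)%:E <= M%:E)%E <->
  forall F : {fset J}, \sum_(i <- F) a i <= M.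
Proof.
rewrite esum_le_fset; split => h F; have := h F.
  by rewrite sumEFin lee_fin.
by rewrite sumEFin lee_fin.
Qed.

Lemma partial_sumE (V : zmodType) (f : J -> V) F :
  partial_sum f F = \sum_(i <- F) f i.
Proof. by rewrite /partial_sum big_seq_fsetE. Qed.

Lemma totally_ge (F : {fset J}) : \forall G \near totally, (F `<=` G)%fset.
Proof. by exists F. Qed.

Lemma sum_fsub (V : nmodType) (a : J -> V) F G : (F `<=` G)%fset ->
  \sum_(i <- G) a i = \sum_(i <- F) a i + \sum_(i <- (G `\` F)%fset) a i.
Proof.
move=> FG; rewrite (big_fsetID _ (fun i => i \in F) G)/=; congr (_ + _).
  congr (\sum_(i <- enum_fset _) _); apply/fsetP => i; rewrite !inE andb_idl// => iF.
  exact: (fsubsetP FG).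
by congr (\sum_(i <- enum_fset _) _); apply/fsetP => i; rewrite !inE andbC.
Qed.

Lemma ler_sum_fsub (a : J -> R) F G : (forall i, 0 <= a i) ->
  (F `<=` G)%fset -> \sum_(i <- F) a i <= \sum_(i <- G) a i.
Proof.
by move=> a0 /(sum_fsub a) ->; rewrite lerDl sumr_ge0.
Qed.

Definition abs_bounded (f : J -> Cx R) (M : R) := forall F : {fset J}, \sum_(i <- F) normc (f i) <= M.

Lemma cvg_nonneg_sum (a : J -> R) (M : R) : (forall i, 0 <= a i) ->
  (forall F : {fset J}, \sum_(i <- F) a i <= M) ->
  exists l : R, fsum a @ totally --> l.
Proof.
move=> a0 aM; pose S := [set \sum_(i <- F) a i | F in [set: {fset J}]].
have hS : has_sup S.
  by split; [exists (\sum_(i <- fset0) a i), fset0|exists M => _ [F _ <-]].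
exists (sup S); apply/cvgrPdist_lt => e e0.
have [_ [F _ <-] hF] := sup_adherent e0 hS.
apply: filterS (totally_ge F) => G FG.
have G1 : \sum_(i <- G) a i <= sup S by apply: sup_upper_bound => //; exists G.
rewrite ger0_norm ?subr_ge0// ltrBlDr -ltrBlDl (lt_le_trans hF)//.
exact: ler_sum_fsub.
Qed.

(** A real family [a] dominated by |f| is the difference of the nonnegative families |f| + a and
    |f|, whose partial sums are monotone and bounded. *)
Lemma abs_bounded_cvg f M : abs_bounded f M ->
  exists l : Cx R, fsum f @ totally --> l.
Proof.
move=> fM.
have sub (a : J -> R) : (forall i, `|a i| <= normc (f i)) ->
    exists l : R, fsum a @ totally --> l.
  move=> af.
  have [l0 h0] := cvg_nonneg_sum (fun i => normc_ge0 (f i)) fM.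
  have [i|F|l1 h1] := @cvg_nonneg_sum (fun i => normc (f i) + a i) (M + M).
  - have := af i; rewrite ler_norml => /andP[h _].
    by rewrite -lerBlDl sub0r.
  - rewrite big_split/= lerD// (le_trans _ (fM F))//.
    by apply: ler_sum => i _; rewrite (le_trans (ler_norm _)).
  exists (l1 - l0).
  rewrite (_ : fsum a = fsum (fun i => normc (f i) + a i) \- fsum (fun i => normc (f i))).
    exact: cvgB.
  by apply/funext => F; rewrite /fsum /= big_split/= addrAC subrr add0r.
have [lr hr] := sub (fun i => Re (f i)) (fun i => normc_Re _).
have [li hi] := sub (fun i => Im (f i)) (fun i => normc_Im _).
exists (Complex lr li); apply/cvgCP => e e0.
have e20 : 0 < e / 2 by rewrite divr_gt0.
move/cvgrPdist_lt/(_ _ e20) : hr; move/cvgrPdist_lt/(_ _ e20) : hi.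
apply: filterS2 => F h1 h2.
rewrite /fsum; have -> : \sum_(i <- F) f i = Complex (\sum_(i <- F) Re (f i)) (\sum_(i <- F) Im (f i)).
  elim/big_rec3: _ => // i x y z _ ->.
  by case: (f i).
rewrite (le_lt_trans (normc_le _))//= [ltRHS]splitr ltrD// distrC//.
Qed.

Lemma cvgC_unique (T : Type) (F : set_system T) (FF : ProperFilter F)
  (f : T -> Cx R) (l l' : Cx R) : f x @[x --> F] --> l -> f x @[x --> F] --> l' -> l = l'.
Proof. by apply: cvg_unique; exact: norm_hausdorff. Qed.

Lemma sum_eq f (l : Cx R) : fsum f @ totally --> l ->
  summability.sum f = l.
Proof.
move=> h; apply: cvg_lim; first exact: norm_hausdorff.
by rewrite (_ : partial_sum f = fsum f)//; apply/funext => F; exact: partial_sumE.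
Qed.

Lemma cvg_sum f M : abs_bounded f M ->
  fsum f @ totally --> summability.sum f.
Proof. by move=> /abs_bounded_cvg[l hl]; rewrite (sum_eq hl). Qed.

Lemma sum_fin_supp f F : (forall i, i \notin F -> f i = 0) ->
  summability.sum f = \sum_(i <- F) f i.
Proof.
move=> f0; apply: sum_eq; apply/cvgCP => e e0.
apply: filterS (totally_ge F) => G FG.
have <- : \sum_(i <- F) f i = \sum_(i <- G) f i by apply/big_fset_incl => // i _ /f0.
by rewrite subrr normc0E.
Qed.

Lemma cvgC_le (T : Type) (F : set_system T) (FF : ProperFilter F)
  (f : T -> Cx R) (l : Cx R) (M : R) : f x @[x --> F] --> l ->
  (\forall x \near F, normc (f x) <= M) -> normc l <= M.
Proof.
move=> /cvgCP h hM; apply/ler_addgt0Pr => e e0.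
have [x [x1 x2]] := filter_ex (filterI hM (h e e0)).
rewrite -[l](subrK (f x)) (le_trans (ler_normcD _ _))// addrC lerD//.
by rewrite normcBC ltW.
Qed.

End UnorderedSums.

(** * The space of square summable families *)

Section L2.
Variables (R : realType) (J : choiceType).
Implicit Types (x y : J -> Cx R) (F G : {fset J}).

Definition sqs x F : R := \sum_(i <- F) normc (x i) ^+ 2.

Lemma sqs_ge0 x F : 0 <= sqs x F.
Proof. by apply: sumr_ge0 => i _; rewrite sqr_ge0. Qed.

Lemma l2norm_ge0 x : (0 <= l2norm x)%E.
Proof. exact: poweR_ge0. Qed.

Lemma le_poweR (u v : \bar R) (r : R) : 0 <= r -> (0 <= u)%E -> (u <= v)%E ->
  (u `^ r <= v `^ r)%E.
Proof.
move=> r0 u0 uv; apply: gt0_ler_poweR => //; rewrite in_itv/= leey andbT//.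
exact: le_trans uv.
Qed.

Lemma l2norm_le x (M : R) : 0 <= M ->
  (l2norm x <= M%:E)%E <-> forall F, sqs x F <= M ^+ 2.
Proof.
move=> M0; rewrite /l2norm -(esumEFin_le (fun i => normc (x i) ^+ 2)).
set E := esum _ _.
have E0 : (0 <= E)%E by apply: esum_ge0 => i _; rewrite lee_fin sqr_ge0.
have -> : (M%:E = (M ^+ 2)%:E `^ 2^-1)%E.
  by rewrite poweR_EFin powR12_sqrt ?sqr_ge0// sqrtr_sqr ger0_norm.
split=> h; last by apply: le_poweR => //; rewrite invr_ge0.
rewrite -[E]poweRe1// -[leRHS]poweRe1 ?lee_fin ?sqr_ge0//.
rewrite -(mulVf (_ : 2 != 0 :> R))// 2!poweRrM le_poweR ?poweR_ge0//.
Qed.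

Lemma l2norm_lty x : (l2norm x < +oo)%E <-> exists M, forall F, sqs x F <= M.
Proof.
split=> [h|[M hM]].
  have : (l2norm x <= (fine (l2norm x))%:E)%E.
    by rewrite fineK// ge0_fin_numE ?l2norm_ge0.
  rewrite l2norm_le ?fine_ge0 ?l2norm_ge0// => h2.
  by exists (fine (l2norm x) ^+ 2).
have M0 : 0 <= M by rewrite (le_trans _ (hM fset0))// sqs_ge0.
apply: (@le_lt_trans _ _ (Num.sqrt M)%:E); last exact: ltry.
by rewrite l2norm_le ?sqrtr_ge0// => F; rewrite sqr_sqrtr.
Qed.

Definition l2pred : {pred (J -> Cx R)} := fun x => `[< (l2norm x < +oo)%E >].

Lemma l2pred_submod : submod_closed l2pred.
Proof.
have n2 (u v : Cx R) : normc (u + v) ^+ 2 <= 2 * normc u ^+ 2 + 2 * normc v ^+ 2.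
  apply: (@le_trans _ _ ((normc u + normc v) ^+ 2)).
    by rewrite lerXn2r ?nnegrE ?addr_ge0 ?normc_ge0// ler_normcD.
  have := sqr_ge0 (normc u - normc v); rewrite sqrrB sqrrD; lra.
split=> [|a x y].
  apply/asboolP/l2norm_lty; exists 0 => F.
  by rewrite /sqs big1// => i _; rewrite normc0E expr0n.
move=> /asboolP/l2norm_lty[M hM] /asboolP/l2norm_lty[N hN].
apply/asboolP/l2norm_lty; exists (2 * (normc a ^+ 2 * M) + 2 * N) => F.
apply: (@le_trans _ _ (2 * (normc a ^+ 2 * sqs x F) + 2 * sqs y F)).
  rewrite /sqs !mulr_sumr -big_split/=; apply: ler_sum => i _.
  by rewrite (le_trans (n2 _ _))// normcM exprMn.
by rewrite lerD// ?ler_wpM2l// ?sqr_ge0.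
Qed.

HB.instance Definition _ := GRing.isSubmodClosed.Build (Cx R) (J -> Cx R) l2pred
  l2pred_submod.

(** Operators are maps of this bundled type, where summability is automatic and linear algebra is
    available; matrices are tied to them by [mx]. *)
Record l2 := L2 { l2val :> J -> Cx R; _ : l2val \in l2pred }.
HB.instance Definition _ := [isSub for l2val].
HB.instance Definition _ := [Choice of l2 by <:].
HB.instance Definition _ := [SubChoice_isSubLmodule of l2 by <:].

Lemma l2D (x y : l2) i : (x + y) i = x i + y i. Proof. by []. Qed.
Lemma l2B (x y : l2) i : (x - y) i = x i - y i. Proof. by []. Qed.
Lemma l2Z a (x : l2) i : (a *: x) i = a * x i. Proof. by []. Qed.
Lemma l2P (x y : l2) : x =1 y -> x = y.
Proof. by move=> xy; apply: val_inj; apply/funext. Qed.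

End L2.

Lemma cvgC_cauchy (R : realType) (T : Type) (F : set_system T)
    (FF : ProperFilter F) (f : T -> Cx R) :
  (forall e : R, 0 < e -> exists2 A, F A & forall x y, A x -> A y -> normc (f x - f y) < e) ->
  exists l : Cx R, f x @[x --> F] --> l.
Proof.
move=> hf.
have key (g : T -> R) : (forall x y, `|g x - g y| <= normc (f x - f y)) ->
    exists l : R, g x @[x --> F] --> l.
  move=> gf; suff : cvg (g x @[x --> F]) by move=> gc; exists (lim (g x @[x --> F])).
  apply/cauchy_cvgP/cauchy_ballP => e e0; have [A FA hA] := hf e e0.
  have gA : F (g @^-1` (g @` A)) by apply: filterS FA => x Ax; exists x.
  exists (g @` A, g @` A) => /=; first by split; exact: gA.
  move=> [_ _] /= [[x Ax <-] [y Ay <-]].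
  exact: le_lt_trans (gf _ _) (hA _ _ Ax Ay).
have [x y|lr hr] := key (fun x => Re (f x)).
  by rewrite (_ : _ - _ = Re (f x - f y)) ?normc_Re//; case: (f x); case: (f y).
have [x y|li hi] := key (fun x => Im (f x)).
  by rewrite (_ : _ - _ = Im (f x - f y)) ?normc_Im//; case: (f x); case: (f y).
exists (Complex lr li); apply/cvgCP => e e0.
have e20 : 0 < e / 2 by rewrite divr_gt0.
move/cvgrPdist_lt/(_ _ e20) : hr; move/cvgrPdist_lt/(_ _ e20) : hi.
apply: filterS2 => x h1 h2; rewrite (le_lt_trans (normc_le _))// [ltRHS]splitr.
by rewrite distrC in h1; rewrite distrC in h2; case: (f x) h1 h2 => a b /= *; rewrite ltrD.
Qed.

Lemma cvgR_ge (R : realType) (T : Type) (F : set_system T) (FF : ProperFilter F)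
    (f : T -> R) (l M : R) : f x @[x --> F] --> l ->
  (\forall x \near F, M <= f x) -> M <= l.
Proof.
move=> /cvgrPdist_lt h hM; apply/ler_addgt0Pr => e e0.
have [x [x1 x2]] := filter_ex (filterI hM (h e e0)).
rewrite (le_trans x1)//; have : f x - l <= `|l - f x| by rewrite distrC ler_norm.
by move=> x3; rewrite -lerBlDl (le_trans x3)// ltW.
Qed.

Lemma cvgR_le (R : realType) (T : Type) (F : set_system T) (FF : ProperFilter F)
    (f : T -> R) (l M : R) : f x @[x --> F] --> l ->
  (\forall x \near F, f x <= M) -> l <= M.
Proof.
move=> /cvgN h hM; rewrite -lerN2; apply: (@cvgR_ge R T F FF (fun x => - f x)) => //.
by apply: filterS hM => x; rewrite lerN2.
Qed.

Lemma cvg_sum_fset (R : realType) (J : choiceType) (T : Type) (F : set_system T)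
    (FF : Filter F) (f : T -> J -> R) (l : J -> R) (r : seq J) :
  (forall i, f x i @[x --> F] --> l i) ->
  \sum_(i <- r) f x i @[x --> F] --> \sum_(i <- r) l i.
Proof.
move=> h; elim: r => [|i r ih].
  rewrite big_nil (_ : (fun x => _) = fun=> 0); first exact: cvg_cst.
  by apply/funext => x; rewrite big_nil.
rewrite big_cons (_ : (fun x => _) = fun x => f x i + \sum_(j <- r) f x j).
  exact: cvgD.
by apply/funext => x; rewrite big_cons.
Qed.

(** * Inner product, truncations, bounded functionals and completeness *)

Section InnerProduct.
Variables (R : realType) (J : choiceType).
Local Notation l2 := (l2 R J).
Implicit Types (x y z : l2) (F G : {fset J}).

Lemma l2_sqs x : exists M, forall F, sqs x F <= M.
Proof. by case: x => x /= /asboolP/l2norm_lty. Qed.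

Lemma mk_l2 (f : J -> Cx R) M : (forall F, sqs f F <= M) -> exists x : l2, x =1 f.
Proof.
move=> fM; have fl : f \in @l2pred R J by apply/asboolP/l2norm_lty; exists M.
by exists (L2 fl).
Qed.

Definition ip x y : Cx R := summability.sum (fun i => x i * (y i)^*).

Lemma ip_cvg x y : fsum (fun i => x i * (y i)^*) @ totally --> ip x y.
Proof.
have [M hM] := l2_sqs x; have [N hN] := l2_sqs y.
apply: (@cvg_sum _ _ _ (M + N)) => F.
apply: (@le_trans _ _ (sqs x F + sqs y F)); last exact: lerD.
rewrite -big_split/=; apply: ler_sum => i _; rewrite normcM normcJ.
have := sqr_ge0 (normc (x i) - normc (y i)); rewrite sqrrB.
have := mulr_ge0 (normc_ge0 (x i)) (normc_ge0 (y i)); lra.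
Qed.

Lemma ipPl a x y z : ip (a *: x + y) z = a * ip x z + ip y z.
Proof.
apply: sum_eq.
rewrite (_ : fsum _ = (fun F => a * fsum (fun i => x i * (z i)^*) F
  + fsum (fun i => y i * (z i)^*) F)).
  by apply: cvgD; [apply: cvgMr|]; exact: ip_cvg.
apply/funext => F; rewrite /fsum mulr_sumr -big_split/=; apply: eq_bigr => i _.
by rewrite mulrA -mulrDl.
Qed.

Lemma normc_subJ (u v : Cx R) : normc (u^* - v^*) = normc (u - v).
Proof. by rewrite -rmorphB normcJ. Qed.

Lemma ipC x y : ip y x = (ip x y)^*.
Proof.
apply: sum_eq.
rewrite (_ : fsum _ = (fun F => (fsum (fun i => x i * (y i)^*) F)^*)).
  apply/cvgC0; under eq_fun do rewrite normc_subJ.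
  by apply/cvgC0; exact: ip_cvg.
apply/funext => F; rewrite /fsum rmorph_sum/=; apply: eq_bigr => i _.
by rewrite rmorphM/= conjcK mulrC.
Qed.

Lemma ipDl x y z : ip (x + y) z = ip x z + ip y z.
Proof. by rewrite -[x]scale1r ipPl mul1r scale1r. Qed.
Lemma ip0l x : ip 0 x = 0.
Proof. by apply: (@addIr _ (ip 0 x)); rewrite -ipDl !add0r. Qed.
Lemma ipZl a x y : ip (a *: x) y = a * ip x y.
Proof. by rewrite -[a *: x]addr0 ipPl ip0l addr0. Qed.
Lemma ipNl x y : ip (- x) y = - ip x y.
Proof. by rewrite -scaleN1r ipZl mulN1r. Qed.
Lemma ipBl x y z : ip (x - y) z = ip x z - ip y z.
Proof. by rewrite ipDl ipNl. Qed.
Lemma ipDr x y z : ip x (y + z) = ip x y + ip x z.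
Proof. by rewrite ipC ipDl rmorphD/= -!ipC. Qed.
Lemma ipZr a x y : ip x (a *: y) = a^* * ip x y.
Proof. by rewrite ipC ipZl rmorphM/= -ipC. Qed.
Lemma ip0r x : ip x 0 = 0. Proof. by rewrite ipC ip0l conjc0. Qed.
Lemma ipNr x y : ip x (- y) = - ip x y.
Proof. by rewrite ipC ipNl rmorphN/= -ipC. Qed.
Lemma ipBr x y z : ip x (y - z) = ip x y - ip x z.
Proof. by rewrite ipDr ipNr. Qed.
Lemma ip_suml (K : Type) (r : seq K) (P : pred K) (f : K -> l2) y :
  ip (\sum_(k <- r | P k) f k) y = \sum_(k <- r | P k) ip (f k) y.
Proof. by elim/big_rec2: _ => [|k a b _ <-]; rewrite ?ip0l ?ipDl. Qed.
Lemma ip_sumr (K : Type) (r : seq K) (P : pred K) (f : K -> l2) y :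
  ip y (\sum_(k <- r | P k) f k) = \sum_(k <- r | P k) ip y (f k).
Proof. by elim/big_rec2: _ => [|k a b _ <-]; rewrite ?ip0r ?ipDr. Qed.

Definition nrm2 x : R := Re (ip x x).
Definition nrm x : R := Num.sqrt (nrm2 x).

Lemma mulcJ (u : Cx R) : u * u^* = (normc u ^+ 2)%:C.
Proof.
rewrite normcE2; case: u => a b; apply/eqP; rewrite eq_complex/=.
by apply/andP; split; apply/eqP; ring.
Qed.

Lemma sqs_cvg x : sqs x @ totally --> nrm2 x.
Proof.
have := @cvg_comp _ _ _ _ (@complex.Re R) totally _ _ (@ip_cvg x x) (@continuous_Re R (ip x x)).
rewrite (_ : _ \o _ = sqs x)//; apply/funext => F /=.
rewrite /fsum /sqs raddf_sum; apply: eq_bigr => i _.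
by rewrite mulcJ.
Qed.

Lemma sqs_le x F : sqs x F <= nrm2 x.
Proof.
apply: (@cvgR_ge R _ totally _ (sqs x) _ _ (@sqs_cvg x)); apply: filterS (totally_ge F) => G FG.
by apply: ler_sum_fsub => // i; rewrite sqr_ge0.
Qed.

Lemma nrm2_le x M : (forall F, sqs x F <= M) -> nrm2 x <= M.
Proof.
by move=> h; apply: (@cvgR_le R _ totally _ (sqs x) _ _ (@sqs_cvg x)); apply: filterS (totally_ge fset0) => G _.
Qed.

Lemma nrm2_ge0 x : 0 <= nrm2 x.
Proof. by rewrite (le_trans (sqs_ge0 x fset0))// sqs_le. Qed.

Lemma nrm_ge0 x : 0 <= nrm x. Proof. exact: sqrtr_ge0. Qed.

Lemma nrmK x : nrm x ^+ 2 = nrm2 x. Proof. by rewrite sqr_sqrtr ?nrm2_ge0. Qed.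

Lemma ipxx x : ip x x = (nrm x ^+ 2)%:C.
Proof.
have : ip x x = (ip x x)^* by rewrite -ipC.
rewrite nrmK /nrm2; case: (ip x x) => a b [] /eqP; rewrite -subr_eq0 opprK -mulr2n.
by rewrite mulrn_eq0/= => /eqP ->.
Qed.

Lemma l2normE x : l2norm x = (nrm x)%:E.
Proof.
apply/eqP; rewrite eq_le; apply/andP; split.
  by apply/l2norm_le; [exact: nrm_ge0|move=> F; rewrite nrmK sqs_le].
have [M hM] := l2_sqs x.
have lf : l2norm x \is a fin_num.
  by rewrite ge0_fin_numE ?l2norm_ge0//; apply/l2norm_lty; exists M.
rewrite -(fineK lf) lee_fin -(@ler_pXn2r _ 2)// ?nnegrE ?nrm_ge0 ?fine_ge0 ?l2norm_ge0//.
rewrite nrmK; apply: nrm2_le; apply/l2norm_le; first by rewrite fine_ge0 ?l2norm_ge0.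
by rewrite fineK.
Qed.

Lemma nrmP x M : 0 <= M -> (forall F, sqs x F <= M ^+ 2) -> nrm x <= M.
Proof.
move=> M0 h; rewrite -(@ler_pXn2r _ 2)// ?nnegrE ?nrm_ge0//.
by rewrite nrmK nrm2_le.
Qed.

Lemma normc_nrm x i : normc (x i) <= nrm x.
Proof.
rewrite -(@ler_pXn2r _ 2)// ?nnegrE ?nrm_ge0 ?normc_ge0// nrmK.
by rewrite (le_trans _ (sqs_le x [fset i]%fset))// /sqs big_seq_fset1.
Qed.

Lemma nrm_eq0 x : nrm x = 0 -> x = 0.
Proof.
move=> x0; apply: l2P => i; apply/eqP; rewrite -normc_eq0 eq_le normc_ge0 andbT.
by rewrite -x0 normc_nrm.
Qed.

Lemma nrm0 : nrm 0 = 0.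
Proof. by rewrite /nrm /nrm2 ip0l /= sqrtr0. Qed.

Lemma nrmZ a x : nrm (a *: x) = normc a * nrm x.
Proof.
apply/eqP; rewrite -(@eqrXn2 _ 2)// ?mulr_ge0 ?nrm_ge0 ?normc_ge0//.
rewrite exprMn !nrmK /nrm2 ipZl ipZr mulrA mulcJ ipxx.
by rewrite -rmorphM.
Qed.

Lemma nrmN x : nrm (- x) = nrm x.
Proof. by rewrite -scaleN1r nrmZ normcN normc1E mul1r. Qed.

Lemma nrmB x y : nrm (x - y) = nrm (y - x).
Proof. by rewrite -nrmN opprB. Qed.

Lemma ReD (a b : Cx R) : Re (a + b) = Re a + Re b. Proof. by case: a; case: b. Qed.
Lemma ReN (a : Cx R) : Re (- a) = - Re a. Proof. by case: a. Qed.
Lemma ReJ (a : Cx R) : Re (a^*) = Re a. Proof. by case: a. Qed.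

Lemma nrm2D x y : nrm2 (x + y) = nrm2 x + nrm2 y + 2 * Re (ip x y).
Proof.
rewrite /nrm2 ipDl !ipDr (ipC x y) !ReD ReJ; ring.
Qed.

Lemma cauchy_schwarz x y : normc (ip x y) <= nrm x * nrm y.
Proof.
have [->|y0] := eqVneq y 0; first by rewrite ip0r normc0E mulr_ge0 ?nrm_ge0.
have ny0 : 0 < nrm y.
  by rewrite lt_def nrm_ge0 andbT; apply: contraNneq y0 => /nrm_eq0 ->.
pose t : Cx R := - (ip x y / (nrm y ^+ 2)%:C).
have := nrm2_ge0 (x + t *: y).
have ny2 : (nrm y ^+ 2)%:C != 0 :> Cx R.
  by rewrite -normc_eq0 normc_real normr_eq0 gt_eqF ?exprn_gt0.
rewrite nrm2D -[nrm2 (t *: _)]nrmK nrmZ ipZr.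
have -> : t^* * ip x y = - (normc (ip x y) ^+ 2 / nrm y ^+ 2)%:C.
  rewrite /t rmorphN rmorphM mulNr; congr (- _).
  rewrite mulrAC -[X in _ = X]/((normc (ip x y) ^+ 2 * (nrm y ^+ 2)^-1)%:C).
  rewrite [X in X * _]mulrC mulcJ [RHS]rmorphM; congr (_ * _).
  by rewrite [LHS]conjc_inv conjc_real fmorphV.
have -> : normc t = normc (ip x y) / nrm y ^+ 2.
  by rewrite normcN normcM normcV normc_real ger0_norm ?sqr_ge0.
rewrite ReN /= -nrmK.
have -> : (normc (ip x y) / nrm y ^+ 2 * nrm y) ^+ 2 = normc (ip x y) ^+ 2 / nrm y ^+ 2.
  by field; rewrite gt_eqF.
move=> h; rewrite -(@ler_pXn2r _ 2)// ?nnegrE ?mulr_ge0 ?nrm_ge0 ?normc_ge0// exprMn.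
rewrite -ler_pdivrMr ?exprn_gt0//; lra.
Qed.

Lemma ler_nrmD x y : nrm (x + y) <= nrm x + nrm y.
Proof.
rewrite -(@ler_pXn2r _ 2)// ?nnegrE ?addr_ge0 ?nrm_ge0// nrmK nrm2D sqrrD !nrmK.
have := le_trans (le_trans (ler_norm _) (normc_Re _)) (cauchy_schwarz x y).
rewrite mulr2n; lra.
Qed.

Lemma ler_nrm_dist y x z : nrm (x - z) <= nrm (x - y) + nrm (y - z).
Proof. by rewrite (le_trans _ (ler_nrmD _ _))// addrA subrK. Qed.

Fact l2_basis_subproof (j : J) : (fun i => (i == j)%:R : Cx R) \in @l2pred R J.
Proof.
apply/asboolP/l2norm_lty; exists 1 => F; rewrite /sqs.
have [jF|jF] := boolP (j \in F).
  rewrite (big_fsetD1 j)//= eqxx normc1E expr1n big_seq big1 ?addr0// => i.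
  by rewrite !inE => /andP[/negbTE -> _]; rewrite normc0E expr0n.
rewrite big_seq big1 // => i iF.
by have [ij|_] := eqVneq i j; [rewrite -ij iF in jF|rewrite normc0E expr0n].
Qed.

Definition basis (j : J) : l2 := L2 (l2_basis_subproof j).

Lemma basisE j i : basis j i = (i == j)%:R. Proof. by []. Qed.

Lemma ip_basis x j : ip x (basis j) = x j.
Proof.
rewrite /ip (@sum_fin_supp _ _ _ [fset j]%fset).
  by rewrite big_seq_fset1 basisE eqxx conjc_nat mulr1.
by move=> i; rewrite inE basisE => /negbTE ->; rewrite conjc_nat mulr0.
Qed.

Lemma nrm_basis j : nrm (basis j) = 1.
Proof. by rewrite /nrm /nrm2 ip_basis basisE eqxx sqrtr1. Qed.

Definition trunc F x : l2 := \sum_(j <- F) x j *: basis j.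

Lemma l2_sum (K : Type) (r : seq K) (P : pred K) (f : K -> l2) i :
  (\sum_(k <- r | P k) f k) i = \sum_(k <- r | P k) f k i.
Proof. by elim/big_rec2: _ => [|k a b _ <-]. Qed.

Lemma truncE F x i : trunc F x i = if i \in F then x i else 0.
Proof.
rewrite l2_sum; under eq_bigr do rewrite l2Z basisE.
case: ifPn => iF.
  rewrite (big_fsetD1 i)//= eqxx mulr1 big_seq big1 ?addr0// => j.
  by rewrite !inE eq_sym => /andP[/negbTE -> _]; rewrite mulr0.
rewrite big_seq big1 // => j jF.
by have [ij|_] := eqVneq i j; [rewrite ij jF in iF|rewrite mulr0].
Qed.

Lemma nrm2_trunc F x : nrm2 (trunc F x) = sqs x F.
Proof.
rewrite /nrm2 {2}/trunc ip_sumr raddf_sum /sqs big_seq [RHS]big_seq.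
apply: eq_bigr => j jF.
by rewrite ipZr ip_basis truncE jF mulrC mulcJ.
Qed.

Lemma nrm2_truncB F x : nrm2 (x - trunc F x) = nrm2 x - sqs x F.
Proof.
have h : ip (x - trunc F x) (trunc F x) = 0.
  rewrite /trunc ip_sumr big_seq big1// => j jF.
  by rewrite ipZr ipBl !ip_basis truncE jF subrr mulr0.
have := nrm2D (x - trunc F x) (trunc F x).
by rewrite subrK h mulr0 addr0 nrm2_trunc => ->; rewrite addrK.
Qed.

Lemma trunc_cvg x e : 0 < e -> \forall F \near totally, nrm (x - trunc F x) < e.
Proof.
move=> e0; have /cvgrPdist_lt/(_ _ (exprn_gt0 2 e0)) := @sqs_cvg x.
apply: filterS => F h; rewrite -(@ltr_pXn2r _ 2)// ?nnegrE ?nrm_ge0 ?(ltW e0)//.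
by rewrite nrmK nrm2_truncB (le_lt_trans (ler_norm _)).
Qed.

Definition bfun (phi : l2 -> Cx R) :=
  (forall a x y, phi (a *: x + y) = a * phi x + phi y) /\
  exists K, forall x, normc (phi x) <= K * nrm x.

Lemma bfun_trunc (phi : l2 -> Cx R) F x :
  (forall a x y, phi (a *: x + y) = a * phi x + phi y) ->
  phi (trunc F x) = \sum_(j <- F) x j * phi (basis j).
Proof.
move=> pl; have p0 : phi 0 = 0.
  by have := pl 1 0 0; rewrite scale1r mul1r addr0 -[LHS]addr0 => /addrI.
rewrite /trunc; elim/big_rec2: _ => // j a b _ <-.
by rewrite pl.
Qed.

Lemma bfun_cvg (phi : l2 -> Cx R) x : bfun phi ->
  fsum (fun j => x j * phi (basis j)) @ totally --> phi x.
Proof.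
move=> [pl [K hK]]; apply/cvgCP => e e0.
have K1 : 0 < `|K| + 1 by rewrite ltr_wpDl.
apply: filterS (trunc_cvg x (divr_gt0 e0 K1)) => F h.
rewrite /fsum -bfun_trunc// normcBC.
have -> : phi x - phi (trunc F x) = phi (x - trunc F x).
  by rewrite [x - _]addrC -(scaleN1r (trunc F x)) pl mulN1r addrC.
rewrite (le_lt_trans (hK _))//.
rewrite (@le_lt_trans _ _ ((`|K| + 1) * nrm (x - trunc F x)))//.
  by rewrite ler_wpM2r ?nrm_ge0// (le_trans (ler_norm _))// lerDl.
by rewrite mulrC -ltr_pdivlMr.
Qed.

Lemma bfun_sum (phi : l2 -> Cx R) x : bfun phi ->
  summability.sum (fun j => x j * phi (basis j)) = phi x.
Proof. by move=> h; exact: sum_eq (@bfun_cvg phi x h). Qed.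

Lemma bfun_ext (phi psi : l2 -> Cx R) : bfun phi -> bfun psi ->
  (forall j, phi (basis j) = psi (basis j)) -> phi =1 psi.
Proof.
move=> hp hq e x; rewrite -(bfun_sum x hp) -(bfun_sum x hq).
by congr (summability.sum _); apply/funext => j; rewrite e.
Qed.

Lemma l2_complete (x : nat -> l2) :
  (forall e, 0 < e -> exists N, forall m n, (N <= m)%N -> (N <= n)%N ->
     nrm (x m - x n) < e) ->
  exists y, nrm (x n - y) @[n --> \oo] --> (0 : R).
Proof.
move=> hx.
have hc i : exists l : Cx R, x n i @[n --> \oo] --> l.
  apply: cvgC_cauchy => e e0; have [N hN] := hx e e0.
  exists [set n | (N <= n)%N]; first by exists N.
  by move=> m n Nm Nn; rewrite -l2B (le_lt_trans (normc_nrm _ _))// hN.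
have [y hy] := choice hc.
have sq e : 0 < e -> exists N, forall n, (N <= n)%N ->
    forall F, sqs (fun i => x n i - y i) F <= e ^+ 2.
  move=> e0; have [N hN] := hx e e0; exists N => n Nn F.
  have hm : sqs (fun i => x n i - x m i) F @[m --> \oo] -->
      sqs (fun i => x n i - y i) F.
    rewrite /sqs; apply: (@cvg_sum_fset R J nat \oo _ (fun m i => normc (x n i - x m i) ^+ 2)
      (fun i => normc (x n i - y i) ^+ 2) F) => i.
    rewrite !expr2; have h : normc (x n i - x m i) @[m --> \oo] --> normc (x n i - y i).
      have hd : (x n i - x m i : Cx R) @[m --> \oo] --> (x n i - y i : Cx R).
        by apply: cvgB; [exact: cvg_cst|exact: hy].
      exact: (@cvg_comp _ _ _ _ (@Normc.normc R) \oo _ _ hd (@continuous_normc R _)).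
    exact: cvgM.
  apply: (@cvgR_le R nat \oo _ (fun m => sqs (fun i => x n i - x m i) F) _ _ hm).
  exists N => // m /= Nm.
  by rewrite (le_trans (sqs_le (x n - x m) F))// -nrmK lerXn2r ?nnegrE ?nrm_ge0 ?(ltW e0)//
    ltW// hN.
have [N hN] := sq 1 ltr01.
(* The coordinatewise limit is not yet known to be square summable, but its difference from [x N]
   is; the limit is recovered as [x N - w]. *)
have [w hw] := mk_l2 (hN N (leqnn N)).
exists (x N - w); apply/cvgrPdist_lt => e e0.
have e20 : 0 < e / 2 by rewrite divr_gt0.
have [M hM] := sq _ e20; exists M => // n /= Mn.
rewrite sub0r normrN ger0_norm ?nrm_ge0//.
rewrite (@le_lt_trans _ _ (e / 2))//; last by rewrite ltr_pdivrMr// ltr_pMr// ltr1n.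
apply: nrmP => [|F]; first exact: ltW.
rewrite (le_trans _ (hM n Mn F))// le_eqVlt; apply/orP; left; apply/eqP.
rewrite /sqs; apply: eq_bigr => i _; congr (normc _ ^+ 2).
by rewrite !l2B hw opprB addrC; ring.
Qed.

End InnerProduct.

Arguments basis {R J} j.

(** * Singular value decomposition of compact operators *)

Section Schmidt.
Variables (R : realType) (J : choiceType).
Local Notation l2 := (l2 R J).
Implicit Types (x y : l2) (T S : l2 -> l2) (s : R).

Definition linop T := forall a x y, T (a *: x + y) = a *: T x + T y.
Definition obnd T (K : R) := forall x, nrm (T x) <= K * nrm x.
Definition adjoint T S := forall x y, ip (T x) y = ip x (S y).
Definition cptop T := forall w : nat -> l2, (forall n, nrm (w n) <= 1) ->
  exists2 f : nat -> nat, {homo f : m n / (m < n)%N} &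
  exists y, nrm (T (w (f n)) - y) @[n --> \oo] --> (0 : R).

Lemma linop0 T : linop T -> T 0 = 0.
Proof.
by move=> h; have := h 1 0 0; rewrite !scale1r addr0 -[LHS]addr0 => /addrI.
Qed.
Lemma linopD T x y : linop T -> T (x + y) = T x + T y.
Proof. by move=> h; have := h 1 x y; rewrite !scale1r. Qed.
Lemma linopZ T a x : linop T -> T (a *: x) = a *: T x.
Proof. by move=> h; have := h a x 0; rewrite !addr0 (linop0 h) addr0. Qed.
Lemma linopN T x : linop T -> T (- x) = - T x.
Proof. by move=> h; rewrite -scaleN1r (linopZ _ _ h) scaleN1r. Qed.
Lemma linopB T x y : linop T -> T (x - y) = T x - T y.
Proof. by move=> h; rewrite (linopD _ _ h) (linopN _ h). Qed.
Lemma linop_sum T (K : Type) (r : seq K) (P : pred K) (f : K -> l2) : linop T ->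
  T (\sum_(k <- r | P k) f k) = \sum_(k <- r | P k) T (f k).
Proof.
by move=> h; elim/big_rec2: _ => [|k a b _ <-]; [exact: linop0|exact: linopD].
Qed.

Lemma ip_inj x y : (forall z, ip z x = ip z y) -> x = y.
Proof.
move=> h; apply/eqP; rewrite -subr_eq0; apply/eqP/nrm_eq0.
by rewrite /nrm /nrm2 ipBr h subrr /= sqrtr0.
Qed.

Lemma adjointC T S : adjoint T S -> adjoint S T.
Proof. by move=> h x y; rewrite ipC -h -ipC. Qed.

Lemma adjoint_linop T S : adjoint T S -> linop S.
Proof.
move=> h a x y; apply: ip_inj => z; rewrite -h.
by rewrite !ipDr !ipZr !h.
Qed.

Lemma adjoint_obnd T S K : 0 <= K -> adjoint T S -> obnd T K -> obnd S K.
Proof.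
move=> K0 TS hT y; have [Sy0|Sy0] := eqVneq (nrm (S y)) 0.
  by rewrite Sy0 mulr_ge0 ?nrm_ge0.
have n0 : 0 < nrm (S y) by rewrite lt_def Sy0 nrm_ge0.
rewrite -(ler_pM2r n0) -expr2.
have : nrm (S y) ^+ 2 = Re (ip (T (S y)) y) by rewrite TS ipxx.
move=> ->; rewrite (le_trans (ler_norm _))// (le_trans (normc_Re _))//.
rewrite (le_trans (cauchy_schwarz _ _))// mulrAC ler_wpM2r ?nrm_ge0//.
Qed.

Definition opsup T := sup [set nrm (T x) | x in [set x | nrm x <= 1]].

Lemma opsup_ub T K x : linop T -> obnd T K -> nrm x <= 1 -> nrm (T x) <= opsup T.
Proof.
move=> hT hK x1; apply: sup_upper_bound; last by exists x.
split; first by exists (nrm (T 0)), 0 => //=; rewrite nrm0.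
exists `|K| => _ [z /= z1 <-]; rewrite (le_trans (hK z))//.
rewrite (@le_trans _ _ (`|K| * nrm z))//; first by rewrite ler_wpM2r ?nrm_ge0// ler_norm.
by rewrite -[leRHS]mulr1 ler_wpM2l.
Qed.

Lemma opsup_ge0 T K : linop T -> obnd T K -> 0 <= opsup T.
Proof.
move=> hT hK; have := @opsup_ub T K 0 hT hK; rewrite nrm0 (linop0 hT) nrm0.
by apply.
Qed.

Lemma opsup_obnd T K : linop T -> obnd T K -> obnd T (opsup T).
Proof.
move=> hT hK x; have [->|x0] := eqVneq x 0; first by rewrite (linop0 hT) nrm0 mulr0.
have n0 : 0 < nrm x.
  by rewrite lt_def nrm_ge0 andbT; apply: contraNneq x0 => /nrm_eq0 ->.
have := @opsup_ub T K (((nrm x)^-1)%:C *: x) hT hK.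
rewrite (linopZ _ _ hT) !nrmZ normc_real gtr0_norm ?invr_gt0// mulVf ?gt_eqF// lexx.
by move=> /(_ isT); rewrite ler_pdivrMl// mulrC.
Qed.

Lemma homo_ge (f : nat -> nat) : {homo f : m n / (m < n)%N} -> forall n, (n <= f n)%N.
Proof. by move=> h; elim=> // n ih; apply: leq_ltn_trans ih (h _ _ _). Qed.

(* A maximizing sequence x_n of a compact operator has T x_n -> y with
   |y| = |T|; then v = T^* y / |T|^2 attains the norm. *)
Lemma top_singular T S K : linop T -> obnd T K -> adjoint T S -> cptop T ->
  exists s u v, [/\ 0 <= s, obnd T s, T v = s%:C *: u, S u = s%:C *: v &
    (s = 0 /\ u = 0 /\ v = 0) \/ (0 < s /\ nrm u = 1 /\ nrm v = 1)].
Proof.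
move=> hT hK TS cT; have s0 := opsup_ge0 hT hK.
have hb := opsup_obnd hT hK; move: s0 hb; set s := opsup T => s0 hb.
have hS := adjoint_linop TS.
(* The zero operator is given zero vectors, so that the extraction of singular triples can go on
   after a finite rank is exhausted. *)
have [sz|snz] := eqVneq s 0.
  exists 0, 0, 0; rewrite -sz; split => //; last by left.
    by rewrite (linop0 hT) scaler0.
  by rewrite (linop0 hS) scaler0.
have sp : 0 < s by rewrite lt_def snz.
have hw n : exists x, nrm x <= 1 /\ s - n.+1%:R^-1 < nrm (T x).
  have hs : has_sup [set nrm (T x) | x in [set x | nrm x <= 1]].
    split; first by exists (nrm (T 0)), 0 => //=; rewrite nrm0.
    by exists s => _ [z /= z1 <-]; exact: (opsup_ub hT hK).
  have e0 : 0 < n.+1%:R^-1 :> R by rewrite invr_gt0.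
  have [_ [x x1 <-] hx] := sup_adherent e0 hs.
  by exists x.
have [w hw'] := choice hw.
have [f fh [y hy]] := cT w (fun n => (hw' n).1).
have near1 e : 0 < e -> exists n, nrm (T (w (f n)) - y) < e /\ s - e < nrm (T (w (f n))).
  move=> e0; have /cvgrPdist_lt/(_ _ e0) := hy => h1.
  have /cvgrPdist_lt/(_ _ e0) := @cvg_harmonic R => h2.
  have [n [n1 n2]] := filter_ex (filterI h1 h2).
  exists n; split.
    by move: n1; rewrite sub0r normrN ger0_norm ?nrm_ge0.
  apply: le_lt_trans (hw' (f n)).2; rewrite lerB//.
  move: n2; rewrite /= /harmonic sub0r normrN ger0_norm ?invr_ge0// => /ltW n2.
  by rewrite (le_trans _ n2)// lef_pV2 ?posrE// ler_nat ltnS homo_ge.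
have ys : nrm y = s.
  apply/eqP; rewrite eq_le; apply/andP; split; apply/ler_addgt0Pr => e e0.
    have [n [n1 n2]] := near1 e e0.
    rewrite -[y](subrK (T (w (f n)))) (le_trans (ler_nrmD _ _))// addrC lerD//.
      by rewrite (opsup_ub hT hK)//; have [] := hw' (f n).
    by rewrite nrmB ltW.
  have e20 : 0 < e / 2 by rewrite divr_gt0.
  have [n [n1 n2]] := near1 _ e20.
  have := ler_nrmD (T (w (f n)) - y) y; rewrite subrK => h; lra.
have Sy1 : nrm (S y) <= s ^+ 2.
  by rewrite (le_trans (adjoint_obnd s0 TS hb _))// ys.
have Sy2 : s ^+ 2 <= nrm (S y).
  apply/ler_addgt0Pr => e e0.
  have [n [n1 _]] := near1 _ (divr_gt0 e0 sp).
  have h1 : normc (ip (T (w (f n))) y) <= nrm (S y).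
    rewrite TS (le_trans (cauchy_schwarz _ _))// -[leRHS]mul1r ler_wpM2r ?nrm_ge0//.
    by have [] := hw' (f n).
  have h2 : normc (ip (T (w (f n)) - y) y) <= e.
    rewrite (le_trans (cauchy_schwarz _ _))// ys -ler_pdivlMr// ltW//.
  have h3 : s ^+ 2 = normc (ip y y).
    by rewrite ipxx normc_real ys ger0_norm// sqr_ge0.
  rewrite h3 -[y in ip y _](subrK (T (w (f n)))) ipDl (le_trans (ler_normcD _ _))//.
  by rewrite addrC lerD// -opprB ipNl normcN.
have Sy : nrm (S y) = s ^+ 2 by apply/eqP; rewrite eq_le Sy1.
pose u := (s^-1)%:C *: y; pose v := ((s ^+ 2)^-1)%:C *: S y.
have scC (a b : R) x : a%:C *: (b%:C *: x) = (a * b)%:C *: x.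
  by rewrite scalerA rmorphM.
have nv : nrm v = 1.
  by rewrite nrmZ normc_real Sy gtr0_norm ?invr_gt0 ?exprn_gt0// mulVf// expf_neq0.
have nu : nrm u = 1 by rewrite nrmZ normc_real ys gtr0_norm ?invr_gt0// mulVf.
exists s, u, v; split=> //; last by right.
(* T v = y because |T v - y|^2 is at most s^2 + s^2 - 2 <v, S y>, where <v, S y> = |S y|^2 / s^2 =
   s^2. *)
- rewrite /u scC mulfV// scale1r; apply/eqP; rewrite -subr_eq0; apply/eqP/nrm_eq0/eqP.
  rewrite -sqrf_eq0 eq_le sqr_ge0 andbT nrmK nrm2D.
  rewrite ipNr TS /v ipZl ipxx Sy -rmorphM ReN /= -nrmK -[X in _ + X + _]nrmK nrmN ys.
  have : nrm (T v) <= s by rewrite (le_trans (hb v))// nv mulr1.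
  rewrite -(@ler_pXn2r _ 2)// ?nnegrE ?nrm_ge0// => h.
  have -> : (s ^+ 2)^-1 * (s ^+ 2) ^+ 2 = s ^+ 2 by field.
  by rewrite -/v; lra.
- rewrite /u (linopZ _ _ hS) /v scC; congr (_%:C *: _); by field.
Qed.

Definition defl T (d : R * l2 * l2) x := T x - (d.1.1%:C * ip x d.2) *: d.1.2.
Definition defl_adj S (d : R * l2 * l2) x := S x - (d.1.1%:C * ip x d.1.2) *: d.2.

Lemma nrm_proj x v : v = 0 \/ nrm v = 1 -> nrm (x - ip x v *: v) <= nrm x.
Proof.
case=> [->|nv]; first by rewrite scaler0 subr0.
rewrite -(@ler_pXn2r _ 2)// ?nnegrE ?nrm_ge0// !nrmK nrm2D ipNr ipZr.
rewrite -[nrm2 (- _)]nrmK nrmN nrmZ nv mulr1 [_^* * _]mulrC mulcJ ReN /=.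
by have := sqr_ge0 (normc (ip x v)); lra.
Qed.

(** Deflation is composition with the projection off [v]; linearity, norm bounds and compactness are
    thus inherited from [T]. *)
Lemma deflE T s u v x : linop T -> T v = s%:C *: u ->
  defl T (s, u, v) x = T (x - ip x v *: v).
Proof.
by move=> hT Tv; rewrite /defl (linopB _ _ hT) (linopZ _ _ hT) Tv scalerA mulrC.
Qed.

(** Zero vectors pad the sequences when the rank is finite. The last clause, an error of at most s_n
    after n terms, yields both the convergence of the expansion and the vanishing of [T] on vectors
    orthogonal to all [v n]. *)
Definition is_schmidt T S (s : nat -> R) (u v : nat -> l2) :=
  [/\ forall n, 0 <= s n, forall n, s n.+1 <= s n, s n @[n --> \oo] --> (0 : R) &
   [/\
      forall n, (s n = 0 /\ u n = 0 /\ v n = 0) \/ (0 < s n /\ nrm (u n) = 1 /\ nrm (v n) = 1),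
      forall m n, m != n -> ip (u m) (u n) = 0 /\ ip (v m) (v n) = 0,
      forall n, T (v n) = (s n)%:C *: u n,
      forall n, S (u n) = (s n)%:C *: v n &
      forall n x, nrm (T x - \sum_(k < n) ((s k)%:C * ip x (v k)) *: u k) <= s n * nrm x]].

(** Singular triples are split off one after the other, deflating [T] and its adjoint together; the
    norm of the n-th deflated operator is s_n, which is the error clause. *)
Lemma schmidt T S K : linop T -> obnd T K -> adjoint T S -> cptop T ->
  exists (s : nat -> R) u v, is_schmidt T S s u v.
Proof.
move=> hT hK TS cT.
pose good (p : (l2 -> l2) * (l2 -> l2)) :=
  [/\ linop p.1, exists K, obnd p.1 K, adjoint p.1 p.2 & cptop p.1].
(* With [good p] inside the existential, [choice] gives a total selector, which the fixpoint [st]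
   can call at every stage. *)
have pickP (p : (l2 -> l2) * (l2 -> l2)) : exists d : R * l2 * l2, good p ->
    [/\ 0 <= d.1.1, obnd p.1 d.1.1, p.1 d.2 = d.1.1%:C *: d.1.2,
      p.2 d.1.2 = d.1.1%:C *: d.2 &
      (d.1.1 = 0 /\ d.1.2 = 0 /\ d.2 = 0) \/ (0 < d.1.1 /\ nrm d.1.2 = 1 /\ nrm d.2 = 1)].
  have [[g1 [K' g2] g3 g4]|] := pselect (good p); last by exists (0, 0, 0).
  have [s [u [v h]]] := top_singular g1 g2 g3 g4.
  by exists (s, u, v).
have [pk hpk] := choice pickP.
pose st := fix st n := if n is n'.+1 then
  (defl (st n').1 (pk (st n')), defl_adj (st n').2 (pk (st n'))) else (T, S).
have goodn n : good (st n).
  elim: n => [|n [g1 g2 g3 g4]]; first by split=> //; exists K.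
  have [d1 d2 d3 d4 d5] := hpk (st n) (And4 g1 g2 g3 g4).
  move: d1 d2 d3 d4 d5; rewrite /good /=; case: (pk (st n)) => [[s u] v] /= d1 d2 d3 d4 d5.
  have dE x := deflE x g1 d3.
  have vv x : nrm (x - ip x v *: v) <= nrm x.
    by apply: nrm_proj; case: d5 => [[_ [_ ->]]|[_ [_ ->]]]; [left|right].
  split=> /=.
  - move=> a x y; rewrite !dE -g1; congr (_ _).
    by rewrite ipDl ipZl scalerDl -scalerA scalerBr opprD addrACA.
  - by exists s => x; rewrite dE (le_trans (d2 _))// ler_wpM2l// vv.
  - move=> x y; rewrite /defl /defl_adj ipBl ipBr g3 ipZl ipZr /=.
    have -> : (s%:C * ip y u)^* = s%:C * ip u y.
      by rewrite [LHS]rmorphM; congr (_ * _); [exact: conjc_real|by rewrite [RHS]ipC].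
    by congr (_ - _); rewrite mulrAC.
  - move=> w w1.
    have [f fh [y hy]] := g4 (fun n' => w n' - ip (w n') v *: v)
      (fun n' => le_trans (vv _) (w1 n')).
    by exists f => //; exists y; under eq_fun do rewrite dE.
pose s n := (pk (st n)).1.1; pose u n := (pk (st n)).1.2; pose v n := (pk (st n)).2.
have P n := hpk (st n) (goodn n).
have s0 n : 0 <= s n by have [] := P n.
have Tv n : (st n).1 (v n) = (s n)%:C *: u n by have [] := P n.
have Su n : (st n).2 (u n) = (s n)%:C *: v n by have [] := P n.
have nuv n : (s n = 0 /\ u n = 0 /\ v n = 0) \/ (0 < s n /\ nrm (u n) = 1 /\ nrm (v n) = 1).
  by have [] := P n.
have ob n : obnd (st n).1 (s n) by have [] := P n.
have adj n : adjoint (st n).1 (st n).2 by have [] := goodn n.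
have lin n : linop (st n).1 by have [] := goodn n.
have stS n x : (st n.+1).1 x = (st n).1 x - ((s n)%:C * ip x (v n)) *: u n by [].
have stS' n x : (st n.+1).2 x = (st n).2 x - ((s n)%:C * ip x (u n)) *: v n by [].
(* With T_n, S_n the n-th deflated pair: s_n <w, v_n> = <w, S_n u_n> = <T_n w, u_n> = 0. As earlier
   singular vectors are killed by T_n, they are orthogonal to later ones. *)
have orth0 n w z : (st n).1 w = 0 -> (st n).2 z = 0 ->
    ip w (v n) = 0 /\ ip z (u n) = 0.
  move=> Tw Sz; case: (nuv n) => [[_ [-> ->]]|[sp _]]; first by rewrite !ip0r.
  have sn0 : (s n)%:C != 0 :> Cx R by rewrite -normc_eq0 normc_real normr_eq0 gt_eqF.
  split; apply: (mulfI sn0); rewrite mulr0 -{1}(conjc_real (s n)) -ipZr.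
    by rewrite -Su -adj Tw ip0l.
  by rewrite -Tv -(adjointC (adj n)) Sz ip0l.
have ker n k : (k < n)%N -> (st n).1 (v k) = 0 /\ (st n).2 (u k) = 0.
  elim: n => // n ih; rewrite ltnS leq_eqVlt => /predU1P[->|kn].
    rewrite stS stS' Tv Su; case: (nuv n) => [[_ [-> ->]]|[_ [nu nv]]].
      by rewrite !scaler0 subrr.
    by rewrite !ipxx nu nv expr1n mulr1 !subrr.
  have [Tk Sk] := ih kn.
  have [or1 or2] := orth0 _ _ _ Tk Sk.
  by rewrite stS stS' Tk Sk or1 or2 mulr0 !scale0r subrr.
have orth m n : (m < n)%N -> ip (v m) (v n) = 0 /\ ip (u m) (u n) = 0.
  by move=> /ker[]; exact: orth0.
have orth2 m n : m != n -> ip (u m) (u n) = 0 /\ ip (v m) (v n) = 0.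
  rewrite neq_ltn => /orP[/orth[]//|/orth[h1 h2]].
  by rewrite ipC h2 ipC h1 conjc0.
have stE n x : (st n).1 x = T x - \sum_(k < n) ((s k)%:C * ip x (v k)) *: u k.
  elim: n => [|n ih]; first by rewrite big_ord0 subr0.
  by rewrite stS ih big_ord_recr/= opprD addrA.
have stE' n x : (st n).2 x = S x - \sum_(k < n) ((s k)%:C * ip x (u k)) *: v k.
  elim: n => [|n ih]; first by rewrite big_ord0 subr0.
  by rewrite stS' ih big_ord_recr/= opprD addrA.
have TV n : T (v n) = (s n)%:C *: u n.
  rewrite -Tv stE big1 ?subr0// => k _.
  by have [] := orth2 n k; [rewrite gtn_eqF|move=> _ ->; rewrite mulr0 scale0r].
have SU n : S (u n) = (s n)%:C *: v n.
  rewrite -Su stE' big1 ?subr0// => k _.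
  by have [] := orth2 n k; [rewrite gtn_eqF|move=> -> _; rewrite mulr0 scale0r].
have sdec n : s n.+1 <= s n.
  case: (nuv n.+1) => [[-> _]//|[sp [nu nv]]].
  have -> : s n.+1 = nrm ((st n.+1).1 (v n.+1)).
    by rewrite Tv nrmZ nu mulr1 normc_real gtr0_norm.
  have := ob n (v n.+1 - ip (v n.+1) (v n) *: v n).
  rewrite -(deflE _ (lin n) (Tv n)); move=> h; rewrite (le_trans h)// -[leRHS]mulr1.
  rewrite ler_wpM2l// -nv nrm_proj//.
  by case: (nuv n) => [[_ [_ ->]]|[_ [_ ->]]]; [left|right].
(* If all s_n were at least [e], the vectors T v_n = s_n u_n would be orthogonal and at mutual
   distance at least [e], against compactness. *)
have slim e : 0 < e -> exists n, s n < e.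
  move=> e0; apply: contrapT => hN.
  have hs n : e <= s n by rewrite leNgt; apply/negP => h; apply: hN; exists n.
  have un n : nrm (u n) = 1 /\ nrm (v n) = 1.
    case: (nuv n) => [[sz _]|[]]; last by [].
    by have := hs n; rewrite sz leNgt e0.
  have [f fh [y hy]] := cT v (fun n => eq_ind_r (fun t => t <= 1) (lexx 1) (un n).2).
  have e20 : 0 < e / 2 by rewrite divr_gt0.
  have /cvgrPdist_lt/(_ _ e20)[N _ hN'] := hy.
  have c1 := hN' N (leqnn N); have c2 := hN' N.+1 (leqnSn N).
  rewrite /= sub0r normrN ger0_norm ?nrm_ge0// in c1.
  rewrite /= sub0r normrN ger0_norm ?nrm_ge0// nrmB in c2.
  have c3 : nrm (T (v (f N)) - T (v (f N.+1))) < e.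
    by rewrite (le_lt_trans (ler_nrm_dist y _ _))// [ltRHS]splitr ltrD.
  move: c3; apply/negP; rewrite -leNgt.
  rewrite -(@ler_pXn2r _ 2)// ?nnegrE ?nrm_ge0 ?(ltW e0)// nrmK nrm2D !TV.
  have oru : ip (u (f N)) (u (f N.+1)) = 0.
    by apply: proj1 (orth2 (f N) (f N.+1) _); rewrite ltn_eqF// fh.
  rewrite ipNr ipZl ipZr oru !mulr0 oppr0 /= mulr0 addr0.
  rewrite -[nrm2 _]nrmK -[nrm2 (- _)]nrmK nrmN !nrmZ !(un _).1 !mulr1 !normc_real.
  rewrite !ger0_norm//; have h1 : e ^+ 2 <= s (f N) ^+ 2.
    by rewrite lerXn2r// nnegrE// ltW.
  by rewrite (le_trans h1)// lerDl sqr_ge0.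
exists s, u, v; split=> //; last by split=> // n x; rewrite -stE; exact: ob.
apply/cvgrPdist_lt => e e0; have [N hN] := slim e e0.
exists N => // n /= Nn; rewrite sub0r normrN ger0_norm//.
rewrite (le_lt_trans _ hN)//; move: Nn => /subnK <-.
by elim: (n - N)%N => // k ih; rewrite addSn (le_trans (sdec _)).
Qed.

End Schmidt.

(** * Matrices of bounded operators, adjoints and compactness *)

Section MatrixOperators.
Variables (R : realType) (J : choiceType).
Local Notation l2 := (l2 R J).
Implicit Types (x y : l2) (T S : l2 -> l2) (A B : J -> J -> Cx R).

Definition mx T : J -> J -> Cx R := fun i j => T (basis j) i.

Lemma linop_bfun T K i : linop T -> obnd T K -> bfun (fun x => T x i).
Proof.
move=> hT hK; split=> [a x y|]; first by rewrite hT.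
by exists K => x; rewrite (le_trans (normc_nrm _ _)).
Qed.

Lemma mx_cvg T K x i : linop T -> obnd T K ->
  fsum (fun j => mx T i j * x j) @ totally --> T x i.
Proof.
move=> hT hK; have := @bfun_cvg R J _ x (linop_bfun i hT hK).
by under [X in fsum X]eq_fun do rewrite mulrC.
Qed.

Lemma mat_apply_mx T K x : linop T -> obnd T K -> mat_apply (mx T) x = T x.
Proof. by move=> hT hK; apply/funext => i; exact: sum_eq (mx_cvg hT hK). Qed.

Lemma l2_ex (x : J -> Cx R) : (l2norm x < +oo)%E -> exists y : l2, l2val y = x.
Proof.
move=> h; have hx : x \in @l2pred R J by apply/asboolP.
by exists (L2 hx).
Qed.

Lemma l2norm_fin x : (l2norm x < +oo)%E.
Proof. by rewrite l2normE ltry. Qed.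

Lemma op_bound_mx T K K' : linop T -> obnd T K' ->
  op_bound (mx T) K <-> obnd T K.
Proof.
move=> hT hK'; split=> [h x|hK x /l2_ex[{}x <-]].
  have [_] := h x (l2norm_fin x).
  by rewrite (mat_apply_mx _ hT hK') !l2normE -EFinM lee_fin.
split=> [i|]; last by rewrite (mat_apply_mx _ hT hK') !l2normE -EFinM lee_fin.
apply/cvg_ex; exists (T x i); have := @mx_cvg T K x i hT hK.
by rewrite (_ : partial_sum _ = fsum (fun j => mx T i j * x j))//;
  apply/funext => F; exact: partial_sumE.
Qed.

Lemma opnorm_mx_le T K : linop T -> 0 <= K -> obnd T K -> (opnorm (mx T) <= K%:E)%E.
Proof.
move=> hT K0 hK; apply: ereal_inf_lbound; exists K => //; split=> //.
exact/(op_bound_mx K hT hK).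
Qed.

Lemma opnorm_ge0 A : (0 <= opnorm A)%E.
Proof. by apply: le_ereal_inf_tmp => _ [M [M0 _] <-]; rewrite lee_fin. Qed.

Lemma op_boundP A K : op_bound A K -> exists T, [/\ linop T, obnd T K & A = mx T].
Proof.
move=> hA.
have hx x : exists y : l2, l2val y = mat_apply A x.
  apply: l2_ex; have [_ h] := hA x (l2norm_fin x).
  by apply: le_lt_trans h _; rewrite l2normE -EFinM ltry.
have [T hT] := choice hx.
have Tc x i : fsum (fun j => A i j * x j) @ totally --> T x i.
  rewrite hT; have [/(_ i) h _] := hA x (l2norm_fin x).
  rewrite /mat_apply /summability.sum.
  rewrite (_ : fsum _ = partial_sum (fun j => A i j * x j))//.
  by apply/funext => F; rewrite partial_sumE.
have lT : linop T.
  move=> a x y; apply: l2P => i; pose z : l2 := a *: x + y.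
  apply: (@cvgC_unique R _ totally _ (fsum (fun j => A i j * z j)) _ _ (@Tc z i)).
  rewrite (_ : fsum _ = (fun F => a * fsum (fun j => A i j * x j) F
    + fsum (fun j => A i j * y j) F)).
    exact: (cvgD (cvgMr (@Tc x i)) (@Tc y i)).
  apply/funext => F; rewrite /fsum mulr_sumr -big_split/=; apply: eq_bigr => j _.
  by rewrite mulrCA -mulrDr.
exists T; split=> //.
  move=> x; have [_] := hA x (l2norm_fin x).
  by rewrite -hT !l2normE -EFinM lee_fin.
apply/funext => i; apply/funext => j; rewrite /mx hT /mat_apply.
rewrite (@sum_fin_supp _ _ _ [fset j]%fset).
  by rewrite big_seq_fset1 basisE eqxx mulr1.
by move=> k; rewrite inE basisE => /negbTE ->; rewrite mulr0.
Qed.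

Lemma opnorm_ltyP A : (opnorm A < +oo)%E ->
  exists T K, [/\ linop T, 0 <= K, obnd T K & A = mx T].
Proof.
move=> /ereal_inf_lt[_ [K [K0 /op_boundP[T [h1 h2 h3]]] <-] _].
by exists T, K.
Qed.

Lemma obnd_opnorm T K : linop T -> obnd T K -> obnd T (fine (opnorm (mx T))).
Proof.
move=> hT hK x.
have K1 : obnd T `|K|.
  by move=> z; rewrite (le_trans (hK z))// ler_wpM2r ?nrm_ge0// ler_norm.
have fn : opnorm (mx T) \is a fin_num.
  rewrite ge0_fin_numE ?opnorm_ge0//.
  by rewrite (le_lt_trans (opnorm_mx_le hT (normr_ge0 K) K1))// ltry.
have [nx0|nx0] := eqVneq (nrm x) 0.
  have := hK x; rewrite nx0 !mulr0 => h; exact: h.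
have np : 0 < nrm x by rewrite lt_def nx0 nrm_ge0.
rewrite -ler_pdivrMr// -lee_fin fineK//.
apply: le_ereal_inf_tmp => _ [M [M0 hM] <-]; rewrite lee_fin ler_pdivrMr//.
by apply: (iffLR (op_bound_mx M hT hK)).
Qed.

(** The coordinates c_i = <y, T e_i> of S y are forced. They are square summable: for the finite
    vector [x] with coordinates c_i on [F], |x|^2 = <y, T x> <= M |x|. *)
Lemma adjoint_ex T K : linop T -> obnd T K -> exists S, adjoint T S.
Proof.
move=> hT hK.
have hy y : exists z : l2, forall i, z i = ip y (T (basis i)).
  pose M := `|K| * nrm y.
  have hF F : sqs (fun i => ip y (T (basis i))) F <= M ^+ 2.
    set c := fun i => _; pose x := \sum_(i <- F) c i *: basis i.
    have xF i : x i = if i \in F then c i else 0.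
      have fF : forall G : {fset J}, sqs (fun i => if i \in F then c i else 0) G <= sqs c F.
        move=> G; rewrite /sqs; have -> : \sum_(i <- G) normc (if i \in F then c i else 0) ^+ 2 =
            \sum_(i <- G | i \in F) normc (c i) ^+ 2.
          rewrite [RHS]big_mkcond/=; apply: eq_bigr => k _.
          by case: ifP => // _; rewrite normc0E expr0n.
        rewrite big_fset_condE/=; apply: ler_sum_fsub => [k|]; first exact: sqr_ge0.
        by apply/fsubsetP => k; rewrite !inE => /andP[].
      have [w hw] := mk_l2 fF.
      rewrite (_ : x = trunc F w) ?truncE; first by case: ifP => // kF; rewrite hw kF.
      by rewrite /x /trunc big_seq [RHS]big_seq; apply: eq_bigr => k kF; rewrite hw kF.
    have nx : nrm2 x = sqs c F.
      rewrite -[x in LHS](_ : trunc F x = x) ?nrm2_trunc; last first.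
        by apply: l2P => i; rewrite truncE; case: ifP => // iF; rewrite xF iF.
      by rewrite /sqs big_seq [RHS]big_seq; apply: eq_bigr => i iF; rewrite xF iF.
    have e : ip y (T x) = (sqs c F)%:C.
      rewrite /x (linop_sum _ _ _ hT) ip_sumr /sqs rmorph_sum/=.
      by apply: eq_bigr => i _; rewrite (linopZ _ _ hT) ipZr mulrC -mulcJ.
    have s0 : 0 <= sqs c F by exact: sqs_ge0.
    have h1 : sqs c F <= M * nrm x.
      rewrite -[leLHS]ger0_norm// -normc_real -e (le_trans (cauchy_schwarz _ _))//.
      rewrite mulrC mulrAC ler_wpM2r ?nrm_ge0// (le_trans (hK x))//.
      by rewrite ler_wpM2r ?nrm_ge0// ler_norm.
    have M0 : 0 <= M by rewrite mulr_ge0 ?nrm_ge0.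
    rewrite -nx -nrmK; rewrite -nx -nrmK in h1.
    rewrite lerXn2r ?nnegrE ?nrm_ge0//.
    have [->//|n0] := eqVneq (nrm x) 0.
    by rewrite -(@ler_pM2r _ (nrm x)) ?lt_def ?n0 ?nrm_ge0// -expr2.
  exact: mk_l2 hF.
have [S hS] := choice hy; exists S => x y.
apply: (@bfun_ext R J (fun x => ip (T x) y) (fun x => ip x (S y))).
- split=> [a u v|]; first by rewrite hT ipPl.
  exists (`|K| * nrm y) => u; rewrite (le_trans (cauchy_schwarz _ _))//.
  rewrite mulrAC ler_wpM2r ?nrm_ge0// (le_trans (hK u))//.
  by rewrite ler_wpM2r ?nrm_ge0// ler_norm.
- split=> [a u v|]; first by rewrite ipPl.
  by exists (nrm (S y)) => u; rewrite mulrC cauchy_schwarz.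
- by move=> j; rewrite [RHS]ipC ip_basis hS -ipC.
Qed.

Lemma mat_adj_mx T S : adjoint T S -> mat_adj (mx T) = mx S.
Proof.
move=> TS; apply/funext => i; apply/funext => j; rewrite /mat_adj /mx.
by rewrite -!ip_basis TS -ipC.
Qed.

Lemma mat_mul_mx T K S : linop T -> obnd T K -> mat_mul (mx T) (mx S) = mx (T \o S).
Proof.
move=> hT hK; apply/funext => i; apply/funext => j.
rewrite /mx /= -(mat_apply_mx (S (basis j)) hT hK); reflexivity.
Qed.

Lemma cvg_l2norm (z : nat -> l2) :
  (l2norm (z n) @[n --> \oo] --> 0%E) <-> (nrm (z n) @[n --> \oo] --> (0 : R)).
Proof.
under eq_fun do rewrite l2normE.
by split=> [/fine_cvg//|h]; apply: cvg_EFin => //; near=> n.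
Unshelve. all: by end_near.
Qed.

Lemma compact_opP A : compact_op A <->
  exists T K, [/\ linop T, 0 <= K, obnd T K, cptop T & A = mx T].
Proof.
split.
  move=> [/opnorm_ltyP[T [K [h1 h2 h3 h4]]] hc]; exists T, K; split=> //.
  move=> w w1; have [n|s s1 [_ /l2_ex[y <-] hy]] := hc (fun n => w n).
    by rewrite l2normE lee_fin.
  exists s => //; exists y; apply/cvg_l2norm.
  by move: hy; rewrite h4; under eq_fun do rewrite (mat_apply_mx _ h1 h3).
move=> [T [K [h1 h2 h3 hc ->]]]; split.
  by rewrite (le_lt_trans (opnorm_mx_le h1 h2 h3))// ltry.
move=> w w1.
have hw n : exists y : l2, l2val y = w n.
  by apply: l2_ex; rewrite (le_lt_trans (w1 n))// ltry.
have [w' hw'] := choice hw.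
have [n|s s1 [y hy]] := hc w'.
  by rewrite -lee_fin -l2normE hw'.
exists s => //; exists y; first exact: l2norm_fin.
have e n : mat_apply (mx T) (w (s n)) - y = T (w' (s n)) - y :> (J -> Cx R).
  by rewrite -hw' (mat_apply_mx _ h1 h3).
under eq_fun do rewrite e.
exact: (iffRL (cvg_l2norm (fun n => T (w' (s n)) - y)) hy).
Qed.

End MatrixOperators.

(** * Orthonormal systems and diagonal operators *)

Section OrthoSystems.
Variables (R : realType) (J : choiceType).
Local Notation l2 := (l2 R J).
Implicit Types (x y z : l2) (T S : l2 -> l2) (X Y v : nat -> l2) (c : nat -> R).

Definition cvgv X y := nrm (X n - y) @[n --> \oo] --> (0 : R).

Lemma cvgvP X y : cvgv X y <->
  forall e, 0 < e -> exists N, forall n, (N <= n)%N -> nrm (X n - y) < e.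
Proof.
split=> [/cvgrPdist_lt h e e0|h].
  have [N _ hN] := h e e0; exists N => n Nn; have := hN n Nn.
  by rewrite /= sub0r normrN ger0_norm ?nrm_ge0.
apply/cvgrPdist_lt => e e0; have [N hN] := h e e0; exists N => // n /= /hN.
by rewrite sub0r normrN ger0_norm ?nrm_ge0.
Qed.

Lemma cvgv_le X y (M : R) : cvgv X y -> (forall n, nrm (X n) <= M) -> nrm y <= M.
Proof.
move=> /cvgvP h hM; apply/ler_addgt0Pr => e e0.
have [N hN] := h e e0; have := hN N (leqnn N); rewrite nrmB => h1.
rewrite -[y](subrK (X N)) (le_trans (ler_nrmD _ _))// addrC lerD//.
exact: ltW.
Qed.

Lemma cvgv_lin X Y x y a : cvgv X x -> cvgv Y y ->
  cvgv (fun n => a *: X n + Y n) (a *: x + y).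
Proof.
move=> /cvgvP hX /cvgvP hY; apply/cvgvP => e e0.
have k0 : 0 < normc a + 1 by rewrite ltr_wpDl// normc_ge0.
have e20 : 0 < e / 2 by rewrite divr_gt0.
have [N hN] := hX (e / 2 / (normc a + 1)) (divr_gt0 e20 k0).
have [M hM] := hY (e / 2) e20.
exists (maxn N M) => n; rewrite geq_max => /andP[/hN h1 /hM h2].
rewrite opprD addrACA -scalerBr (le_lt_trans (ler_nrmD _ _))// nrmZ [ltRHS]splitr.
rewrite ler_ltD//; rewrite ltr_pdivlMr// in h1.
rewrite (le_trans _ (ltW h1))// mulrC ler_wpM2l ?nrm_ge0// lerDl//.
Qed.

Lemma cvgv_cst y : cvgv (fun=> y) y.
Proof. by apply/cvgvP => e e0; exists 0%N => n _; rewrite subrr nrm0. Qed.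

Lemma cvgv_op T K X y : linop T -> obnd T K -> cvgv X y -> cvgv (T \o X) (T y).
Proof.
move=> hT hK /cvgvP h; apply/cvgvP => e e0.
have k0 : 0 < `|K| + 1 by rewrite ltr_wpDl.
have [N hN] := h (e / (`|K| + 1)) (divr_gt0 e0 k0); exists N => n /hN h1 /=.
rewrite ltr_pdivlMr// in h1; rewrite -(linopB _ _ hT) (le_lt_trans (hK _))//.
rewrite (le_lt_trans _ h1)// mulrC ler_wpM2l ?nrm_ge0//.
by rewrite (le_trans (ler_norm _))// lerDl.
Qed.

Lemma cvgv_unique X y z : cvgv X y -> cvgv X z -> y = z.
Proof.
move=> h1 h2; apply/eqP; rewrite -subr_eq0; apply/eqP/nrm_eq0/eqP.
rewrite eq_le nrm_ge0 andbT.
have h := cvgv_lin (-1) h2 h1; rewrite scaleN1r addrC in h.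
by apply: (cvgv_le h) => n; rewrite scaleN1r addNr nrm0.
Qed.

Lemma cvgv_ip X y z : cvgv X y -> ip (X n) z @[n --> \oo] --> ip y z.
Proof.
move=> /cvgvP h; apply/cvgCP => e e0.
have k0 : 0 < nrm z + 1 by rewrite ltr_wpDl// nrm_ge0.
have [N hN] := h (e / (nrm z + 1)) (divr_gt0 e0 k0); exists N => // n /= /hN h1.
rewrite -ipBl (le_lt_trans (cauchy_schwarz _ _))//.
rewrite ltr_pdivlMr// in h1; rewrite (le_lt_trans _ h1)// ler_wpM2l ?nrm_ge0//.
by rewrite lerDl.
Qed.

Definition osys v := (forall n, v n = 0 \/ nrm (v n) = 1) /\
  (forall m n, m != n -> ip (v m) (v n) = 0).

Lemma pythagoras v (a : nat -> Cx R) N M : osys v ->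
  nrm2 (\sum_(N <= k < M) a k *: v k) = \sum_(N <= k < M) normc (a k) ^+ 2 * nrm2 (v k).
Proof.
move=> [_ ov]; elim: M => [|M ih]; first by rewrite !big_geq// /nrm2 ip0l.
have [NM|MN] := leqP N M; last by rewrite !big_geq// /nrm2 ip0l.
rewrite !big_nat_recr//= nrm2D ih -[nrm2 (a M *: _)]nrmK nrmZ exprMn nrmK.
have -> : ip (\sum_(N <= k < M) a k *: v k) (a M *: v M) = 0.
  rewrite ipZr ip_suml big_nat_cond big1 ?mulr0// => k /andP[/andP[_ kM] _].
  by rewrite ipZl ov ?mulr0// ltn_eqF.
by rewrite /= mulr0 addr0.
Qed.

Lemma ip_osum v (a : nat -> Cx R) x N :
  ip (\sum_(0 <= k < N) a k *: v k) x = \sum_(0 <= k < N) a k * ip (v k) x.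
Proof. by rewrite ip_suml; apply: eq_bigr => k _; rewrite ipZl. Qed.

Lemma osys_nrm2 v n x : osys v -> normc (ip x (v n)) ^+ 2 * nrm2 (v n) = normc (ip x (v n)) ^+ 2.
Proof.
move=> [ov _]; case: (ov n) => [->|vn]; last by rewrite -nrmK vn expr1n mulr1.
by rewrite ip0r normc0E expr0n mul0r.
Qed.

Lemma bessel_osys v x N : osys v ->
  \sum_(0 <= k < N) normc (ip x (v k)) ^+ 2 <= nrm2 x.
Proof.
move=> ov; pose y := \sum_(0 <= k < N) ip x (v k) *: v k.
have := nrm2_ge0 (x + - y); rewrite nrm2D -[nrm2 (- y)]nrmK nrmN nrmK ipNr.
have -> : nrm2 y = \sum_(0 <= k < N) normc (ip x (v k)) ^+ 2.
  by rewrite pythagoras//; apply: eq_bigr => k _; rewrite osys_nrm2.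
have -> : ip x y = (\sum_(0 <= k < N) normc (ip x (v k)) ^+ 2)%:C.
  rewrite ip_sumr rmorph_sum; apply: eq_bigr => k _.
  by rewrite ipZr mulrC mulcJ.
rewrite ReN /=; lra.
Qed.

Lemma ip_osys v m n : osys v -> ip (v m) (v n) = (m == n)%:R * (nrm2 (v n))%:C.
Proof.
move=> [_ ov]; have [->|mn] := eqVneq m n; last by rewrite ov// mul0r.
by rewrite mul1r ipxx nrmK.
Qed.

Definition oser v c x N : l2 := \sum_(0 <= k < N) ((c k)%:C * ip x (v k)) *: v k.

(** By Pythagoras a block of the series has squared norm at most C^2 times the same block of the
    Bessel series of [x], which converges. *)
Lemma oser_cvg v c (C : R) x : osys v -> (forall n, `|c n| <= C) ->
  exists y, cvgv (oser v c x) y.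
Proof.
move=> ov cC; have C0 : 0 <= C by rewrite (le_trans _ (cC 0%N)).
pose b k : R := normc (ip x (v k)) ^+ 2.
have cb : cvgn (series b).
  apply: nondecreasing_is_cvgn.
    by apply: nondecreasing_series => k _ _; exact: sqr_ge0.
  by exists (nrm2 x) => _ [n _ <-]; exact: bessel_osys.
apply: l2_complete => e e0.
have d0 : 0 < e ^+ 2 / (C ^+ 2 + 1) by rewrite divr_gt0 ?exprn_gt0// ltr_wpDl// sqr_ge0.
have key N M : (N <= M)%N -> nrm2 (oser v c x M - oser v c x N) <=
    C ^+ 2 * (series b M - series b N).
  move=> NM; rewrite /oser (big_cat_nat (leq0n N) NM)//= addrAC subrr add0r pythagoras//.
  rewrite /series /= (big_cat_nat (leq0n N) NM)//= [X in _ * X]addrAC subrr add0r mulr_sumr.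
  apply: ler_sum => k _; rewrite normcM exprMn -mulrA osys_nrm2// normc_real.
  by rewrite ler_wpM2r ?sqr_ge0// lerXn2r ?nnegrE.
have /cvg_cauchy/cauchy_ballP/(_ _ d0) := cb.
rewrite near_map2 => -[[A B] [[N _ hN] [M _ hM]] hAB].
exists (maxn N M).
have main m n : (maxn N M <= m)%N -> (m <= n)%N ->
    nrm (oser v c x n - oser v c x m) < e.
  rewrite geq_max => /andP[Nm Mm] mn.
  rewrite -(@ltr_pXn2r _ 2)// ?nnegrE ?nrm_ge0 ?(ltW e0)// nrmK.
  rewrite (le_lt_trans (key _ _ mn))//.
  have := hAB (m, n) (conj (hN m Nm) (hM n (leq_trans Mm mn))).
  rewrite /= /ball/= distrC => h.
  have h2 : series b n - series b m < e ^+ 2 / (C ^+ 2 + 1).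
    by rewrite (le_lt_trans (ler_norm _)).
  rewrite ltr_pdivlMr ?ltr_wpDl ?sqr_ge0// in h2.
  have h3 : 0 <= series b n - series b m.
    by rewrite subr_ge0 nondecreasing_series// => k _ _; exact: sqr_ge0.
  rewrite (le_lt_trans _ h2)// mulrC ler_wpM2l// lerDl//.
move=> m n Nm Nn; have [mn|/ltnW nm] := leqP m n; last exact: main.
by rewrite nrmB main.
Qed.

Lemma oser_lin v c a x y N : oser v c (a *: x + y) N = a *: oser v c x N + oser v c y N.
Proof.
rewrite /oser scaler_sumr -big_split/=; apply: eq_bigr => k _.
by rewrite ipPl scalerA -scalerDl mulrDr; congr (_ *: _); ring.
Qed.

(** Two choices of [c] are used: the powers s_n^p, giving (T^* T)^(p/2), and the constant 1, giving
    the orthogonal projection onto the closed span of the system. *)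
Lemma odiag v c (C : R) : osys v -> (forall n, `|c n| <= C) ->
  exists D, [/\ linop D, obnd D C & forall x, cvgv (oser v c x) (D x)].
Proof.
move=> ov cC; have C0 : 0 <= C by rewrite (le_trans _ (cC 0%N)).
have [D hD] := choice (fun x => oser_cvg x ov cC).
exists D; split=> // [a x y|x].
  have h := cvgv_lin a (hD x) (hD y).
  apply: (cvgv_unique (hD _)).
  rewrite (_ : oser v c (a *: x + y) = fun n => a *: oser v c x n + oser v c y n)//.
  by apply/funext => N; rewrite oser_lin.
apply: (cvgv_le (hD x)) => N.
rewrite -(@ler_pXn2r _ 2)// ?nnegrE ?mulr_ge0 ?nrm_ge0// exprMn !nrmK.
rewrite pythagoras// (le_trans _ (ler_wpM2l (sqr_ge0 C) (bessel_osys x N ov)))//.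
rewrite mulr_sumr; apply: ler_sum => k _.
rewrite normcM exprMn -mulrA osys_nrm2// normc_real.
by rewrite ler_wpM2r ?sqr_ge0// lerXn2r ?nnegrE.
Qed.

Lemma odiag_ip v c D x n : osys v -> (forall x, cvgv (oser v c x) (D x)) ->
  ip (D x) (v n) = (c n)%:C * ip x (v n).
Proof.
move=> ov hD; have h := @cvgv_ip _ _ (v n) (hD x).
apply: (@cvgC_unique R _ \oo _ (fun N => ip (oser v c x N) (v n)) _ _ h).
apply/cvgCP => e e0; exists n.+1 => // N /= nN.
rewrite /oser ip_osum (bigD1_seq n)/= ?mem_index_iota ?iota_uniq//.
rewrite big1 ?addr0; last by move=> k kn; rewrite ip_osys// (negbTE kn) mul0r mulr0.
rewrite ip_osys// eqxx mul1r.
case: (ov.1 n) => [->|vn]; first by rewrite ip0r !mulr0 mul0r subrr normc0E.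
by rewrite -nrmK vn expr1n mulr1 subrr normc0E.
Qed.

(** Every [x] splits into its projection [E x], a limit of combinations of the [v n], and a
    remainder orthogonal to all of them. *)
Lemma osys_ext v (T T' : l2 -> l2) K K' : osys v -> linop T -> obnd T K ->
  linop T' -> obnd T' K' -> (forall n, T (v n) = T' (v n)) ->
  (forall r, (forall n, ip r (v n) = 0) -> T r = T' r) -> T =1 T'.
Proof.
move=> ov hT hK hT' hK' tv tr x.
have c1 : forall n : nat, `|1 : R| <= 1 by move=> _; rewrite normr1.
have [E [lE bE hE]] := odiag ov c1.
have rE n : ip (x - E x) (v n) = 0 by rewrite ipBl (odiag_ip _ _ ov hE) mul1r subrr.
have TE : T (E x) = T' (E x).
  apply: (cvgv_unique (cvgv_op hT hK (hE x))).
  rewrite (_ : T \o _ = T' \o (oser v (fun=> 1) x)).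
    exact: cvgv_op hT' hK' (hE x).
  apply/funext => N /=; rewrite /oser (linop_sum _ _ _ hT) (linop_sum _ _ _ hT').
  by apply: eq_bigr => k _; rewrite (linopZ _ _ hT) (linopZ _ _ hT') tv.
by rewrite -(subrK (E x) x) (linopD _ _ hT) (linopD _ _ hT') TE (tr _ rE).
Qed.

End OrthoSystems.

(** * Schatten norms *)

Section SchattenNormFormula.
Variables (R : realType) (J : choiceType).
Local Notation l2 := (l2 R J).
Variables (T S : l2 -> l2) (K p : R) (s : nat -> R) (u v : nat -> l2).
Hypotheses (lT : linop T) (bT : obnd T K) (TS : adjoint T S) (cT : cptop T).
Hypotheses (sch : is_schmidt T S s u v) (p1 : 1 <= p).
Implicit Types (x y : l2).

Lemma schmidt_osys : osys u /\ osys v.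
Proof.
have [_ _ _ [uv o _ _ _]] := sch; split; split=> [n|m n mn].
- by have [[_ [-> _]]|[_ [-> _]]] := uv n; [left|right].
- by have [] := o m n mn.
- by have [[_ [_ ->]]|[_ [_ ->]]] := uv n; [left|right].
- by have [] := o m n mn.
Qed.

Let ou : osys u := schmidt_osys.1.
Let ov : osys v := schmidt_osys.2.
Let s0 n : 0 <= s n. Proof. by have [] := sch. Qed.
Let p0 : 0 < p. Proof. exact: lt_le_trans p1. Qed.
Let lS : linop S. Proof. exact: adjoint_linop TS. Qed.

Lemma schmidt_le0 n : s n <= s 0%N.
Proof.
by have [_ sd _ _] := sch; elim: n => // n; apply: le_trans (sd n).
Qed.

Lemma schmidt_ker r : (forall n, ip r (v n) = 0) -> T r = 0.
Proof.
have [_ _ sl [_ _ _ _ h]] := sch; move=> rv; apply: nrm_eq0; apply/eqP.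
rewrite eq_le nrm_ge0 andbT; apply/ler_addgt0Pr => e e0; rewrite add0r.
have k0 : 0 < nrm r + 1 by rewrite ltr_wpDl// nrm_ge0.
have /cvgrPdist_lt/(_ _ (divr_gt0 e0 k0))[N _ hN] := sl.
have := hN N (leqnn N); rewrite /= sub0r normrN ger0_norm// => sN.
have := h N r; rewrite big1 ?subr0; last by move=> k _; rewrite rv mulr0 scale0r.
move=> h1; rewrite (le_trans h1)//; rewrite ltr_pdivlMr// in sN.
by rewrite (le_trans _ (ltW sN))// ler_wpM2l// lerDl.
Qed.

Lemma schmidt_STv n : S (T (v n)) = (s n ^+ 2)%:C *: v n.
Proof.
have [_ _ _ [_ _ Tv Su _]] := sch.
by rewrite Tv (linopZ _ _ lS) Su scalerA -rmorphM.
Qed.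

Lemma schmidt_ipST y n : ip (S (T y)) (v n) = (s n ^+ 2)%:C * ip y (v n).
Proof.
by rewrite (adjointC TS) TS schmidt_STv ipZr conjc_real.
Qed.

Let a n := s n `^ p.

Lemma schmidt_pow_bounded n : `|a n| <= s 0%N `^ p.
Proof.
rewrite ger0_norm ?powR_ge0// ge0_ler_powR ?nnegrE ?(ltW p0)//.
exact: schmidt_le0.
Qed.

Lemma powR_half (t : R) : 0 <= t -> (t ^+ 2) `^ (p / 2) = t `^ p.
Proof.
by move=> t0; rewrite -powR_mulrn// -powRrM mulrCA mulfV// mulr1.
Qed.

Lemma powR0_half : (0 : R) `^ (p / 2) = 0.
Proof. by rewrite powR0// mulf_neq0// gt_eqF. Qed.

(** An eigenvector [x] for [l] has coefficients only along the [v n] with s_n^2 = l, so that [D]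
    maps it to l^(p/2) times its projection [E x]. For nonzero [l] the remainder x - E x is in the
    kernel of [T], hence orthogonal to [x], and so E x = x; for l = 0 the factor vanishes. *)
Lemma is_op_power_diag D : linop D -> obnd D (s 0%N `^ p) ->
  (forall x, cvgv (oser v a x) (D x)) -> is_op_power (mx (S \o T)) (p / 2) (mx D).
Proof.
move=> lD bD hD.
have lST : linop (S \o T) by move=> b x y /=; rewrite lT lS.
have bST : obnd (S \o T) (`|K| * `|K|).
  have bT' : obnd T `|K|.
    by move=> z; rewrite (le_trans (bT z))// ler_wpM2r ?nrm_ge0// ler_norm.
  move=> x /=; rewrite (le_trans (adjoint_obnd (normr_ge0 K) TS bT' _))//.
  by rewrite -mulrA ler_wpM2l.
split.
  by rewrite (le_lt_trans (opnorm_mx_le lD (powR_ge0 _ _) bD))// ltry.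
move=> l _ /l2_ex[x <-]; rewrite (mat_apply_mx _ lST bST) (mat_apply_mx _ lD bD) => e.
have {}e : S (T x) = l%:C *: x by apply: val_inj.
suff -> : D x = (l `^ (p / 2))%:C *: x by [].
have hc n : (a n)%:C * ip x (v n) = (l `^ (p / 2))%:C * ip x (v n).
  have := schmidt_ipST x n; rewrite e ipZl => /eqP.
  rewrite -subr_eq0 -mulrBl mulf_eq0 => /orP[|/eqP ->]; last by rewrite !mulr0.
  rewrite -rmorphB -normc_eq0 normc_real normr_eq0 subr_eq0 => /eqP ->.
  by rewrite powR_half.
have c1 : forall n : nat, `|1 : R| <= 1 by move=> _; rewrite normr1.
have [E [lE bE hE]] := odiag ov c1.
have DE : D x = (l `^ (p / 2))%:C *: E x.
  apply: (cvgv_unique (hD x)).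
  have h := cvgv_lin (l `^ (p / 2))%:C (hE x) (@cvgv_cst R J 0); rewrite addr0 in h.
  rewrite (_ : oser v a x = fun n => (l `^ (p / 2))%:C *: oser v (fun=> 1) x n + 0)//.
  apply/funext => N; rewrite addr0 /oser scaler_sumr; apply: eq_bigr => k _.
  by rewrite scalerA hc mul1r.
have [l0|l0] := eqVneq l 0; first by rewrite DE l0 powR0_half !scale0r.
rewrite DE; congr (_ *: _); apply/eqP; rewrite eq_sym -subr_eq0; apply/eqP.
have rE n : ip (x - E x) (v n) = 0 by rewrite ipBl (odiag_ip _ _ ov hE) mul1r subrr.
have xr : ip x (x - E x) = 0.
  have : l%:C * ip x (x - E x) = 0.
    by rewrite -ipZl -e (adjointC TS) (schmidt_ker rE) ip0r.
  move/eqP; rewrite mulf_eq0 -normc_eq0 normc_real normr_eq0 (negbTE l0) => /eqP//.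
have Er : ip (E x) (x - E x) = 0.
  have h := @cvgv_ip _ _ _ _ (x - E x) (hE x).
  apply: (@cvgC_unique R _ \oo _ (fun N => ip (oser v (fun=> 1) x N) (x - E x)) _ _ h).
  rewrite (_ : (fun _ => _) = fun=> 0); first exact: cvg_cst.
  apply/funext => N; rewrite /oser ip_osum big1// => k _.
  by rewrite [ip (v k) _]ipC rE conjc0 mulr0.
by apply: nrm_eq0; rewrite /nrm /nrm2 ipBl xr Er subrr /= sqrtr0.
Qed.

(** The specification has only one solution: it prescribes the values on the [v n], eigenvectors for
    s_n^2, and the value 0 on vectors orthogonal to them, which are eigenvectors for 0. *)
Lemma op_power_diag D : linop D -> obnd D (s 0%N `^ p) ->
  (forall x, cvgv (oser v a x) (D x)) -> op_power (mx (S \o T)) (p / 2) = mx D.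
Proof.
move=> lD bD hD; have hp := is_op_power_diag lD bD hD.
apply: xget_unique => // Q [/opnorm_ltyP[T' [K' [lT' _ bT' ->]]] hQ].
have lST : linop (S \o T) by move=> b x y /=; rewrite lT lS.
have bST : obnd (S \o T) (`|K| * `|K|).
  have bT2 : obnd T `|K|.
    by move=> z; rewrite (le_trans (bT z))// ler_wpM2r ?nrm_ge0// ler_norm.
  move=> x /=; rewrite (le_trans (adjoint_obnd (normr_ge0 K) TS bT2 _))//.
  by rewrite -mulrA ler_wpM2l.
have eig (l : R) x : S (T x) = l%:C *: x -> T' x = (l `^ (p / 2))%:C *: x.
  move=> e; have := hQ l x (l2norm_fin x).
  rewrite (mat_apply_mx _ lST bST) (mat_apply_mx _ lT' bT') /= e => h.
  by apply: val_inj; exact: h.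
congr mx; apply/funext; apply: (osys_ext ov lT' bT' lD bD) => [n|r rv].
  rewrite (eig _ _ (schmidt_STv n)) powR_half//.
  apply: (cvgv_unique (X := fun=> (a n)%:C *: v n)); first exact: cvgv_cst.
  apply/cvgvP => e e0; have /cvgvP/(_ e e0)[N hN] := hD (v n).
  have oM M : (n < M)%N -> oser v a (v n) M = (a n)%:C *: v n.
    move=> nM; rewrite /oser (bigD1_seq n)/= ?mem_index_iota ?iota_uniq//.
    rewrite big1 ?addr0; last first.
      by move=> k kn; rewrite ip_osys// eq_sym (negbTE kn) mul0r mulr0 scale0r.
    rewrite ip_osys// eqxx mul1r; case: (ov.1 n) => [->|vn]; first by rewrite !scaler0.
    by rewrite -nrmK vn expr1n mulr1.
  exists 0%N => m _; have := hN (maxn N n.+1) (leq_maxl _ _).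
  by rewrite (oM _ (leq_maxr _ _)).
have Tr : T r = 0 by exact: schmidt_ker.
have -> : T' r = 0.
  rewrite (eig 0) ?powR0_half ?scale0r//.
  by rewrite Tr (linop0 lS).
apply: (cvgv_unique (X := fun=> 0)); first exact: cvgv_cst.
have := hD r; rewrite (_ : oser v a r = fun=> 0)//.
by apply/funext => N; rewrite /oser big1// => k _; rewrite rv mulr0 scale0r.
Qed.

Lemma re_diag D x N : (forall x, cvgv (oser v a x) (D x)) ->
  \sum_(0 <= k < N) a k * normc (ip x (v k)) ^+ 2 <= Re (ip (D x) x).
Proof.
move=> hD; have h := @cvgv_ip _ _ _ _ x (hD x).
have h1 := @cvg_comp _ _ _ _ (@complex.Re R) \oo _ _ h (@continuous_Re R _).
apply: (@cvgR_ge R _ \oo _ _ _ _ h1); exists N => // M /= NM.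
have -> : Re (ip (oser v a x M) x) = \sum_(0 <= k < M) a k * normc (ip x (v k)) ^+ 2.
  rewrite /oser ip_osum raddf_sum; apply: eq_bigr => k _.
  by rewrite [ip (v k) x]ipC -mulrA mulcJ -rmorphM.
rewrite (big_cat_nat (leq0n N) NM)//= lerDl sumr_ge0// => k _.
by rewrite mulr_ge0 ?powR_ge0 ?sqr_ge0.
Qed.

(** Both sides bound the double sum over [i] and [k] of a_k |v_k(i)|^2, since each nonzero a_k goes
    with a unit vector v_k. The exchange is made on finite pieces, followed by a limit in one
    index. *)
Lemma pos_trace_diag D (M : R) : (forall x, cvgv (oser v a x) (D x)) ->
  (pos_trace (mx D) <= M%:E)%E <-> forall N, \sum_(0 <= k < N) a k <= M.
Proof.
move=> hD; rewrite /pos_trace (esumEFin_le (fun i => Re (mx D i i))).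
have mE i : Re (mx D i i) = Re (ip (D (basis i)) (basis i)) by rewrite ip_basis.
have vE i k : normc (ip (basis i) (v k)) = normc (v k i).
  by rewrite ipC ip_basis normcJ.
split=> [h N|h F].
  have cv : \sum_(k <- index_iota 0 N) a k * sqs (v k) F @[F --> totally] -->
      \sum_(k <- index_iota 0 N) a k * nrm2 (v k).
    apply: (@cvg_sum_fset R nat _ totally _ (fun F k => a k * sqs (v k) F)
      (fun k => a k * nrm2 (v k))) => k.
    by apply: cvgMr; exact: sqs_cvg.
  have -> : \sum_(0 <= k < N) a k = \sum_(k <- index_iota 0 N) a k * nrm2 (v k).
    apply: eq_bigr => k _; have [_ _ _ [uv _ _ _ _]] := sch.
    case: (uv k) => [[sk [_ ->]]|[_ [_ vk]]].
      by rewrite /a sk powR0 ?mul0r// gt_eqF.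
    by rewrite -nrmK vk expr1n mulr1.
  rewrite (@cvgR_le R _ totally _ _ _ _ cv)//.
  apply: filterS (totally_ge fset0) => F _.
  rewrite (le_trans _ (h F))//.
  rewrite (eq_bigr (fun k => \sum_(i <- F) a k * normc (v k i) ^+ 2)); last first.
    by move=> k _; rewrite mulr_sumr.
  rewrite exchange_big/=; apply: ler_sum => i _; rewrite mE.
  rewrite (le_trans _ (re_diag _ N hD))// le_eqVlt; apply/orP; left; apply/eqP.
  by apply: eq_bigr => k _; rewrite vE.
pose g i := fun N => \sum_(0 <= k < N) a k * normc (v k i) ^+ 2.
have cv : \sum_(i <- F) g i N @[N --> \oo] --> \sum_(i <- F) Re (mx D i i).
  apply: (@cvg_sum_fset R J nat \oo _ (fun N i => g i N)) => i.
  have h2 := @cvgv_ip _ _ _ _ (basis i) (hD (basis i)).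
  have h1 := @cvg_comp _ _ _ _ (@complex.Re R) \oo _ _ h2 (@continuous_Re R _).
  rewrite mE; apply: cvg_trans h1; apply: near_eq_cvg; near=> N.
  rewrite /= /oser ip_osum raddf_sum; apply: eq_bigr => k _.
  by rewrite -vE [ip (v k) _]ipC -mulrA mulcJ -rmorphM.
apply: (@cvgR_le R _ \oo _ _ _ _ cv); exists 0%N => // N _ /=.
rewrite exchange_big/= (le_trans _ (h N))//; apply: ler_sum => k _.
rewrite -mulr_sumr -[leRHS]mulr1 ler_wpM2l ?powR_ge0//.
rewrite (le_trans (sqs_le (v k) F))// -nrmK.
by case: (ov.1 k) => ->; rewrite ?nrm0 ?expr0n ?expr1n.
Unshelve. all: by end_near.
Qed.

(** The trace of the diagonal operator with eigenvalues s_n^p is their sum. Comparing with a real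
    threshold [M] includes the case of an infinite norm. *)
Lemma schatten_norm_schmidt (M : R) : 0 <= M ->
  (schatten_norm p%:E (mx T) <= M%:E)%E <->
  forall N, \sum_(0 <= k < N) s k `^ p <= M `^ p.
Proof.
move=> M0; have [D [lD bD hD]] := odiag ov schmidt_pow_bounded.
rewrite /schatten_norm.
have -> : `[< compact_op (mx T) >] = true.
  apply/asboolP/compact_opP; exists T, `|K|; split=> //.
  by move=> z; rewrite (le_trans (bT z))// ler_wpM2r ?nrm_ge0// ler_norm.
rewrite /= (mat_adj_mx TS).
have bT' : obnd T `|K|.
  by move=> z; rewrite (le_trans (bT z))// ler_wpM2r ?nrm_ge0// ler_norm.
rewrite (mat_mul_mx T lS (adjoint_obnd (normr_ge0 K) TS bT')).
rewrite (op_power_diag lD bD hD) -(pos_trace_diag _ hD).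
set t := pos_trace _.
have t0 : (0 <= t)%E.
  apply: esum_ge0 => i _; rewrite lee_fin.
  have := re_diag (basis i) 0 hD; rewrite big_geq// ip_basis; exact.
split=> h.
  have := le_poweR (ltW p0) (poweR_ge0 _ _) h.
  by rewrite -poweRrM mulVf ?gt_eqF// poweRe1.
have pV : 0 <= p^-1 by rewrite invr_ge0 ltW.
have := le_poweR pV t0 h.
by rewrite poweR_EFin -powRrM mulfV ?gt_eqF// powRr1.
Qed.

End SchattenNormFormula.

(** * Convexity inequalities for real powers *)

Section PowerInequalities.
Variable R : realType.
Implicit Types (p q s m x y : R).

(** Young's inequality for [s] and m^(p-1). The tangent is affine in [s], which serves for Jensen's
    inequality and for limits inside sums of p-th powers. *)
Lemma powR_tangent p s m : 1 <= p -> 0 <= s -> 0 <= m ->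
  m `^ p + p * m `^ (p - 1) * (s - m) <= s `^ p.
Proof.
move=> p1 s0 m0; have p0 : 0 < p by exact: lt_le_trans p1.
have [->|pn1] := eqVneq p 1.
  by rewrite !powRr1// subrr powRr0 !mul1r addrC subrK.
have p1' : 0 < p - 1 by rewrite subr_gt0 lt_def pn1.
pose q := p / (p - 1).
have q0 : 0 < q by rewrite divr_gt0.
have pq : p^-1 + q^-1 = 1.
  by rewrite /q invf_div; field; rewrite !gt_eqF.
have := conjugate_powR s0 (powR_ge0 m (p - 1)) p0 q0 pq.
rewrite -powRrM (_ : (p - 1) * q = p); last first.
  by rewrite /q mulrC divfK// gt_eqF.
move=> h; have {}h : p * (s * m `^ (p - 1)) <= s `^ p + (p - 1) * m `^ p.
  have := ler_wpM2l (ltW p0) h.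
  rewrite mulrDr (_ : p * (s `^ p / p) = s `^ p); last by field; rewrite gt_eqF.
  rewrite (_ : p * (m `^ p / q) = (p - 1) * m `^ p)// /q; field.
  by rewrite !gt_eqF.
have e := mulr_powRB1 m0 p0.
have -> : m `^ p + p * m `^ (p - 1) * (s - m) =
    m `^ p + p * (s * m `^ (p - 1)) - p * (m * m `^ (p - 1)) by ring.
rewrite e; lra.
Qed.

(** The total weight W may be less than 1: summing the tangents at m = sum a_i t_i gives (W + p (1 -
    W)) m^p, and the factor exceeds 1 by (p - 1) (1 - W) >= 0. *)
Lemma powR_jensen (I : eqType) (r : seq I) (a t : I -> R) p : 1 <= p ->
  (forall i, 0 <= a i) -> (forall i, 0 <= t i) -> \sum_(i <- r) a i <= 1 ->
  (\sum_(i <- r) a i * t i) `^ p <= \sum_(i <- r) a i * t i `^ p.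
Proof.
move=> p1 a0 t0 a1; set m := \sum_(i <- r) a i * t i.
have p0 : 0 < p by exact: lt_le_trans p1.
have m0 : 0 <= m by apply: sumr_ge0 => i _; rewrite mulr_ge0.
set W := \sum_(i <- r) a i in a1.
have h : W * m `^ p + p * m `^ (p - 1) * (m - W * m) <= \sum_(i <- r) a i * t i `^ p.
  have -> : W * m `^ p + p * m `^ (p - 1) * (m - W * m) =
      \sum_(i <- r) a i * (m `^ p + p * m `^ (p - 1) * (t i - m)).
    under eq_bigr do rewrite mulrDr mulrCA mulrBr.
    rewrite big_split/= -mulr_suml -mulr_sumr sumrB; congr (_ + _ * (_ - _)).
    by rewrite mulr_suml.
  by apply: ler_sum => i _; rewrite ler_wpM2l// powR_tangent.
rewrite (le_trans _ h)//.
have e := mulr_powRB1 m0 p0.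
have -> : W * m `^ p + p * m `^ (p - 1) * (m - W * m) =
    W * m `^ p + p * (1 - W) * (m * m `^ (p - 1)) by ring.
rewrite e -mulrDl -[leLHS]mul1r ler_wpM2r ?powR_ge0//.
have : 0 <= (p - 1) * (1 - W) by rewrite mulr_ge0 ?subr_ge0.
lra.
Qed.

Lemma powR_addl p x y : 1 <= p -> 0 <= x -> 0 <= y ->
  (x + y) `^ p <= 2 `^ p * (x `^ p + y `^ p).
Proof.
move=> p1 x0 y0; have p0 : 0 <= p by exact: le_trans p1.
have h (a b : R) : 0 <= a -> a <= b -> (a + b) `^ p <= 2 `^ p * (a `^ p + b `^ p).
  move=> a0 ab; have b0 := le_trans a0 ab.
  rewrite (@le_trans _ _ ((2 * b) `^ p))//.
    by rewrite ge0_ler_powR ?nnegrE ?addr_ge0 ?mulr_ge0// mulr_natl mulr2n lerD2r.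
  by rewrite powRM// ler_wpM2l ?powR_ge0// lerDr powR_ge0.
have [xy|/ltW yx] := leP x y; first exact: h.
by rewrite addrC [x `^ p + _]addrC h.
Qed.

End PowerInequalities.

(** * Finite Bessel families and singular value expansions *)

Section BesselFamilies.
Variables (R : realType) (J : choiceType).
Local Notation l2 := (l2 R J).
Implicit Types (x y : l2) (T S : l2 -> l2).

(** Takes the place of orthonormality in test families: unlike the latter it is preserved by
    contractions, see [bessel_adj]. *)
Definition bessel m (z : 'I_m -> l2) :=
  forall y, \sum_(l < m) normc (ip y (z l)) ^+ 2 <= nrm2 y.

Lemma bessel_nrm2 m (z : 'I_m -> l2) l : bessel z -> nrm2 (z l) <= 1.
Proof.
move=> hz; have := hz (z l); rewrite (bigD1 l)//= => h.
have {}h : nrm2 (z l) ^+ 2 <= nrm2 (z l).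
  rewrite (le_trans _ h)// ipxx normc_real ger0_norm ?sqr_ge0// nrmK lerDl.
  by apply: sumr_ge0 => k _; exact: sqr_ge0.
have [->//|n0] := eqVneq (nrm2 (z l)) 0.
have np : 0 < nrm2 (z l) by rewrite lt_def n0 nrm2_ge0.
by rewrite -(ler_pM2l np) mulr1 -expr2.
Qed.

Lemma bessel_ord (v : nat -> l2) m : osys v -> bessel (fun l : 'I_m => v l).
Proof. by move=> ov y; rewrite -(big_mkord xpredT (fun l => normc (ip y (v l)) ^+ 2)) bessel_osys. Qed.

Lemma bessel_adj m (z : 'I_m -> l2) T S : bessel z -> adjoint T S -> obnd S 1 ->
  bessel (fun l => T (z l)).
Proof.
move=> hz TS b1 y; under eq_bigr do rewrite -(adjointC TS).
rewrite (le_trans (hz _))// -!nrmK lerXn2r ?nnegrE ?nrm_ge0//.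
by rewrite (le_trans (b1 y))// mul1r.
Qed.

(** A form of [is_schmidt] without the adjoint, which passes at once to the tails of the expansion,
    see [schmidt_series_shift]. *)
Definition schmidt_series T (s : nat -> R) (u v : nat -> l2) :=
  [/\ forall n, 0 <= s n, osys u, osys v &
    forall x, cvgv (fun N => \sum_(0 <= k < N) ((s k)%:C * ip x (v k)) *: u k) (T x)].

Lemma is_schmidt_series T S s u v : is_schmidt T S s u v -> schmidt_series T s u v.
Proof.
move=> sch; have [ou ov] := schmidt_osys sch.
have [s0 _ sl [_ _ _ _ h]] := sch; split=> // x; apply/cvgvP => e e0.
have k0 : 0 < nrm x + 1 by rewrite ltr_wpDl// nrm_ge0.
have /cvgrPdist_lt/(_ _ (divr_gt0 e0 k0))[N _ hN] := sl.
exists N => n Nn; have := hN n Nn; rewrite /= sub0r normrN ger0_norm// => sN.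
rewrite nrmB big_mkord (le_lt_trans (h n x))//; rewrite ltr_pdivlMr// in sN.
by rewrite (le_lt_trans _ sN)// ler_wpM2l// lerDl.
Qed.

Lemma osys_shift v N : osys v -> osys (fun k => v (N + k)%N : l2).
Proof. by move=> [h1 h2]; split=> // m n mn; apply: h2; rewrite eqn_add2l. Qed.

Lemma schmidt_series_shift T s u v N : schmidt_series T s u v ->
  schmidt_series (fun x => T x - \sum_(0 <= k < N) ((s k)%:C * ip x (v k)) *: u k)
    (fun k => s (N + k)%N) (fun k => u (N + k)%N) (fun k => v (N + k)%N).
Proof.
move=> [s0 ou ov h]; split=> [n|||x] //; try exact: osys_shift.
apply/cvgvP => e e0; have /cvgvP/(_ e e0)[M hM] := h x.
exists M => n Mn; have := hM (N + n)%N (leq_trans Mn (leq_addl _ _)).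
congr (_ < _); congr nrm.
rewrite (big_cat_nat (leq0n N) (leq_addr n N))/=.
have -> : \sum_(N <= k < N + n) ((s k)%:C * ip x (v k)) *: u k =
    \sum_(0 <= k < n) ((s (N + k)%N)%:C * ip x (v (N + k)%N)) *: u (N + k)%N.
  rewrite -{1}(add0n N) big_addn addKn; apply: eq_bigr => k _.
  by rewrite addnC.
by rewrite opprB addrA [X in X - _]addrC.
Qed.

(* Bessel's inequality makes the weights below doubly substochastic. *)
Lemma schmidt_series_le T s u v p (C : R) m (z w : 'I_m -> l2) : 1 <= p ->
  schmidt_series T s u v -> (forall N, \sum_(0 <= k < N) s k `^ p <= C) ->
  bessel z -> bessel w ->
  \sum_(l < m) normc (ip (T (z l)) (w l)) `^ p <= C.
Proof.
move=> p1 [s0 ou ov hT] sC hz hw.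
pose X N x : l2 := \sum_(0 <= k < N) ((s k)%:C * ip x (v k)) *: u k.
(* This mean dominates |<z_l, v_k>| |<w_l, u_k>|. Its sums over [k] are bounded by Bessel for [u]
   and [v], those over [l] by Bessel for [z] and [w]. *)
pose wt k l : R := (normc (ip (z l) (v k)) ^+ 2 + normc (ip (w l) (u k)) ^+ 2) / 2.
have wt0 k l : 0 <= wt k l by rewrite divr_ge0 ?addr_ge0 ?sqr_ge0.
have hX N : \sum_(l < m) normc (ip (X N (z l)) (w l)) `^ p <= C.
  apply: (@le_trans _ _ (\sum_(l < m) \sum_(0 <= k < N) wt k l * s k `^ p)).
    apply: ler_sum => l _.
    apply: (le_trans _ (powR_jensen p1 (fun k => wt0 k l) s0 _)).
      have t0 : 0 <= \sum_(0 <= k < N) wt k l * s k.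
        by apply: sumr_ge0 => k _; rewrite mulr_ge0.
      rewrite ge0_ler_powR ?nnegrE ?normc_ge0 ?t0 ?(le_trans ler01)//.
      rewrite /X ip_osum (le_trans (ler_normc_sum _ _ _))//; apply: ler_sum => k _.
      rewrite !normcM normc_real ger0_norm// -mulrA mulrC ler_wpM2r//.
      rewrite /wt [ip (u k) _]ipC normcJ.
      have := sqr_ge0 (normc (ip (z l) (v k)) - normc (ip (w l) (u k))).
      rewrite sqrrB; lra.
    rewrite -mulr_suml big_split/=.
    have b1 := le_trans (bessel_osys (z l) N ov) (bessel_nrm2 l hz).
    have b2 := le_trans (bessel_osys (w l) N ou) (bessel_nrm2 l hw).
    lra.
  rewrite exchange_big/= (le_trans _ (sC N))//; apply: ler_sum => k _.
  rewrite -mulr_suml -[leRHS]mul1r ler_wpM2r ?powR_ge0//.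
  rewrite -mulr_suml big_split/=.
  have b3 : forall (o : nat -> l2), osys o -> nrm2 (o k) <= 1.
    by move=> o [h _]; rewrite -nrmK; case: (h k) => ->; rewrite ?nrm0 ?expr0n ?expr1n.
  have b1 : \sum_(l < m) normc (ip (z l) (v k)) ^+ 2 <= 1.
    under eq_bigr do rewrite ipC normcJ.
    exact: le_trans (hz _) (b3 _ ov).
  have b2 : \sum_(l < m) normc (ip (w l) (u k)) ^+ 2 <= 1.
    under eq_bigr do rewrite ipC normcJ.
    exact: le_trans (hw _) (b3 _ ou).
  lra.
pose c l := normc (ip (T (z l)) (w l)).
pose b N l := normc (ip (X N (z l)) (w l)).
(* Each power of [b N l] is replaced by its tangent at the limit [c l], which is a lower bound and
   converges because it is affine. *)
have cv : \sum_(l <- index_enum 'I_m) (c l `^ p + p * c l `^ (p - 1) * (b N l - c l))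
    @[N --> \oo] --> \sum_(l <- index_enum 'I_m) c l `^ p.
  have -> : \sum_(l <- index_enum 'I_m) c l `^ p =
      \sum_(l <- index_enum 'I_m) (c l `^ p + p * c l `^ (p - 1) * (c l - c l)).
    by apply: eq_bigr => l _; rewrite subrr mulr0 addr0.
  apply: (@cvg_sum_fset R 'I_m nat \oo _
    (fun N l => c l `^ p + p * c l `^ (p - 1) * (b N l - c l))) => l.
  apply: cvgD; first exact: cvg_cst.
  apply: cvgMr; apply: cvgB; last exact: cvg_cst.
  have h := @cvgv_ip _ _ _ _ (w l) (hT (z l)).
  exact: (@cvg_comp _ _ _ _ (@Normc.normc R) \oo _ _ h (@continuous_normc R _)).
apply: (@cvgR_le R _ \oo _ _ _ _ cv); exists 0%N => // N _ /=.
rewrite (le_trans _ (hX N))//; apply: ler_sum => l _.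
by rewrite powR_tangent ?normc_ge0.
Qed.

End BesselFamilies.

(** * Variational form of the Schatten norms and the ideal property *)

Section SchattenCalculus.
Variables (R : realType) (J : choiceType).
Local Notation l2 := (l2 R J).
Implicit Types (x y : l2) (T S : l2 -> l2) (A B : J -> J -> Cx R) (p M : R).

Definition cpt_data T S K s u v :=
  [/\ linop T, obnd T K, adjoint T S, cptop T & is_schmidt T S s u v].

Lemma compact_schmidt A : compact_op A ->
  exists T S K (s : nat -> R) u v, cpt_data T S K s u v /\ A = mx T.
Proof.
move=> /compact_opP[T [K [lT K0 bT cT ->]]].
have [S TS] := adjoint_ex lT bT; have [s [u [v h]]] := schmidt lT bT TS cT.
by exists T, S, K, s, u, v.
Qed.

Lemma schatten_compact (q : \bar R) A : (schatten_norm q A < +oo)%E -> compact_op A.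
Proof. by rewrite /schatten_norm; case: ifPn => // /asboolP. Qed.

(** Testing on the singular vectors gives one direction, [schmidt_series_le] the other. Singular
    values do not occur on the right, so that composition with contractions can be moved onto the
    test families. *)
Lemma schatten_leP T S K s u v p M : cpt_data T S K s u v -> 1 <= p -> 0 <= M ->
  (schatten_norm p%:E (mx T) <= M%:E)%E <->
  forall m (z w : 'I_m -> l2), bessel z -> bessel w ->
    \sum_(l < m) normc (ip (T (z l)) (w l)) `^ p <= M `^ p.
Proof.
move=> [lT bT TS cT sch] p1 M0; rewrite (schatten_norm_schmidt lT bT TS cT sch p1 M0).
have [ou ov] := schmidt_osys sch.
split=> [h m z w hz hw|h N].
  exact: (schmidt_series_le p1 (is_schmidt_series sch)).
rewrite (le_trans _ (h N _ _ (bessel_ord N ov) (bessel_ord N ou)))// big_mkord.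
have [s0 _ _ [uv _ Tv _ _]] := sch.
apply: ler_sum => l _; rewrite Tv ipZl normcM normc_real ger0_norm//.
case: (uv l) => [[-> _]|[_ [ul _]]].
  by rewrite mul0r.
by rewrite ipxx ul expr1n normc_real normr1 mulr1.
Qed.

Lemma schatten_inf A : compact_op A -> schatten_norm +oo%E A = opnorm A.
Proof. by rewrite /schatten_norm => /asboolP ->; rewrite eqxx. Qed.

Lemma schatten_norm_ge0 (q : \bar R) A : (0 <= schatten_norm q A)%E.
Proof.
rewrite /schatten_norm; case: ifP => _; last exact: leey.
by case: ifP => _; [exact: opnorm_ge0|exact: poweR_ge0].
Qed.

Lemma opnorm_le_mx T K M : linop T -> obnd T K -> 0 <= M ->
  (opnorm (mx T) <= M%:E)%E <-> obnd T M.
Proof.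
move=> lT bT M0; split; last exact: opnorm_mx_le.
move=> h x; rewrite (le_trans (obnd_opnorm lT bT x))// ler_wpM2r ?nrm_ge0//.
have fo : opnorm (mx T) \is a fin_num.
  by rewrite ge0_fin_numE ?opnorm_ge0// (le_lt_trans h)// ltry.
by rewrite -lee_fin fineK.
Qed.

Section Diagonal.
Variable d : J -> Cx R.
Hypothesis d1 : forall i, normc (d i) <= 1.

Lemma dop_ex x : exists y : l2, y =1 fun i => d i * x i.
Proof.
apply: (@mk_l2 R J _ (nrm2 x)) => F; rewrite (le_trans _ (sqs_le x F))//.
apply: ler_sum => i _; rewrite normcM exprMn -[leRHS]mul1r ler_wpM2r ?sqr_ge0//.
by rewrite -[leRHS](expr1n _ 2) lerXn2r ?nnegrE ?normc_ge0.
Qed.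

Definition dop x : l2 := projT1 (cid (dop_ex x)).

Lemma dopE x i : dop x i = d i * x i.
Proof. by rewrite /dop; case: cid => y /=. Qed.

Lemma dop_linop : linop dop.
Proof.
move=> a x y; apply: l2P => i; rewrite dopE [RHS]l2D l2Z !dopE l2D l2Z; ring.
Qed.

Lemma dop_obnd : obnd dop 1.
Proof.
move=> x; rewrite mul1r; apply: nrmP; first exact: nrm_ge0.
move=> F; rewrite nrmK (le_trans _ (sqs_le x F))//; apply: ler_sum => i _.
rewrite dopE normcM exprMn -[leRHS]mul1r ler_wpM2r ?sqr_ge0//.
by rewrite -[leRHS](expr1n _ 2) lerXn2r ?nnegrE ?normc_ge0.
Qed.

End Diagonal.

Lemma dop_adjoint d (d1 : forall i, normc (d i) <= 1)
    (d1' : forall i, normc ((d i)^*) <= 1) : adjoint (dop d1) (dop d1').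
Proof.
move=> x y; rewrite /ip; congr (summability.sum _); apply/funext => i.
have e : ((d i)^* * y i)^* = d i * (y i)^*.
  by rewrite [LHS]rmorphM; congr (_ * _); exact: conjcK.
by rewrite !dopE e mulrCA mulrA.
Qed.

Lemma conj_le1 (d : J -> Cx R) : (forall i, normc (d i) <= 1) ->
  forall i, normc ((d i)^*) <= 1.
Proof. by move=> d1 i; rewrite normcJ. Qed.

Lemma dop_bessel d (d1 : forall i, normc (d i) <= 1) m (z : 'I_m -> l2) :
  bessel z -> bessel (fun l => dop d1 (z l)).
Proof.
by move=> hz; apply: (bessel_adj hz (dop_adjoint d1 (conj_le1 d1))); exact: dop_obnd.
Qed.

Definition dmul (d : J -> Cx R) A (e : J -> Cx R) : J -> J -> Cx R :=
  fun i j => d i * A i j * e j.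

Lemma dmul_mx d e T (d1 : forall i, normc (d i) <= 1)
    (e1 : forall i, normc (e i) <= 1) : linop T ->
  dmul d (mx T) e = mx (dop d1 \o T \o dop e1).
Proof.
move=> lT; apply/funext => i; apply/funext => j; rewrite /dmul /mx /= dopE.
have -> : dop e1 (basis j) = e j *: basis j.
  apply: l2P => k; rewrite dopE l2Z basisE.
  by have [->|_] := eqVneq k j; rewrite ?mulr0.
by rewrite (linopZ _ _ lT) l2Z; ring.
Qed.

Lemma dmul_op T K d e (d1 : forall i, normc (d i) <= 1)
    (e1 : forall i, normc (e i) <= 1) : linop T -> 0 <= K -> obnd T K -> cptop T ->
  [/\ linop (dop d1 \o T \o dop e1), obnd (dop d1 \o T \o dop e1) K &
    cptop (dop d1 \o T \o dop e1)].
Proof.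
move=> lT K0 bT cT; split.
- by move=> a x y /=; rewrite !dop_linop lT dop_linop.
- move=> x /=; rewrite (le_trans (dop_obnd d1 _))// mul1r (le_trans (bT _))//.
  by rewrite ler_wpM2l// (le_trans (dop_obnd e1 _))// mul1r.
move=> w w1; have [n|f fh [y hy]] := cT (fun n => dop e1 (w n)).
  by rewrite (le_trans (dop_obnd e1 _))// mul1r.
exists f => //; exists (dop d1 y).
exact: (cvgv_op (dop_linop d1) (dop_obnd d1) hy).
Qed.

Lemma dmul_compact d e A : (forall i, normc (d i) <= 1) ->
  (forall i, normc (e i) <= 1) -> compact_op A -> compact_op (dmul d A e).
Proof.
move=> d1 e1 /compact_opP[T [K [lT K0 bT cT ->]]].
have [h1 h2 h3] := dmul_op d1 e1 lT K0 bT cT.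
by apply/compact_opP; exists (dop d1 \o T \o dop e1), K; rewrite (dmul_mx d1 e1 lT).
Qed.

Lemma ge1_case (q : \bar R) : (1 <= q)%E ->
  (exists p, q = p%:E /\ 1 <= p) \/ q = +oo%E.
Proof.
case: q => [p|_|]; last by rewrite leNgt ltNyr.
  by rewrite lee_fin => p1; left; exists p.
by right.
Qed.

Lemma le_ereal_fin (a b : \bar R) : (0 <= b)%E ->
  (forall M, 0 <= M -> (b <= M%:E)%E -> (a <= M%:E)%E) -> (a <= b)%E.
Proof.
case: b => [b|_ _|]; last by [].
  by rewrite lee_fin => b0 h; exact: h.
exact: leey.
Qed.

(** For finite exponents the diagonal contractions are absorbed by the test families, [e] by [z] and
    the adjoint of [d] by [w]. *)
Lemma schatten_dmul (q : \bar R) d e A : (1 <= q)%E -> (forall i, normc (d i) <= 1) ->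
  (forall i, normc (e i) <= 1) ->
  (schatten_norm q (dmul d A e) <= schatten_norm q A)%E.
Proof.
move=> q1 d1 e1; have [cA|nA] := pselect (compact_op A); last first.
  have -> : schatten_norm q A = +oo%E by rewrite /schatten_norm asboolF.
  exact: leey.
apply: le_ereal_fin => [|M M0]; first exact: schatten_norm_ge0.
have [T [S [K [s [u [v [cd AT]]]]]]] := compact_schmidt cA.
have [lT bT TS cT sch] := cd.
have bT' : obnd T `|K|.
  by move=> x; rewrite (le_trans (bT x))// ler_wpM2r ?nrm_ge0// ler_norm.
have [h1 h2 h3] := dmul_op d1 e1 lT (normr_ge0 K) bT' cT.
have cB := dmul_compact d1 e1 cA.
case: (ge1_case q1) => [[p [-> p1]]|->].
  rewrite AT (dmul_mx d1 e1 lT) => /(iffLR (schatten_leP cd p1 M0)) h.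
  have [S' TS'] := adjoint_ex h1 h2; have [s' [u' [v' sch']]] := schmidt h1 h2 TS' h3.
  apply: (iffRL (schatten_leP (And5 h1 h2 TS' h3 sch') p1 M0)) => m z w hz hw.
  have hz' := dop_bessel e1 hz; have hw' := dop_bessel (conj_le1 d1) hw.
  rewrite (le_trans _ (h _ _ _ hz' hw'))//; apply: ler_sum => l _ /=.
  by rewrite (dop_adjoint d1 (conj_le1 d1)).
rewrite (schatten_inf cA) (schatten_inf cB) AT (dmul_mx d1 e1 lT).
move=> /(iffLR (opnorm_le_mx lT bT M0)) hM.
apply: (iffRL (opnorm_le_mx h1 h2 M0)) => x /=.
rewrite (le_trans (dop_obnd d1 _))// mul1r (le_trans (hM _))//.
by rewrite ler_wpM2l// (le_trans (dop_obnd e1 _))// mul1r.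
Qed.

Lemma entry_le (q : \bar R) A i j : (1 <= q)%E ->
  ((normc (A i j))%:E <= schatten_norm q A)%E.
Proof.
move=> q1; have [cA|nA] := pselect (compact_op A); last first.
  have -> : schatten_norm q A = +oo%E by rewrite /schatten_norm asboolF.
  exact: leey.
apply: le_ereal_fin => [|M M0]; first exact: schatten_norm_ge0.
have [T [S [K [s [u [v [cd AT]]]]]]] := compact_schmidt cA.
have [lT bT TS cT sch] := cd.
case: (ge1_case q1) => [[p [-> p1]]|->].
  rewrite AT lee_fin => /(iffLR (schatten_leP cd p1 M0)) h.
  have b1 k : bessel (fun _ : 'I_1 => basis k : l2).
    move=> y; rewrite big_ord1 ip_basis -nrmK lerXn2r ?nnegrE ?normc_ge0 ?nrm_ge0//.
    exact: normc_nrm.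
  have := h 1%N _ _ (b1 j) (b1 i); rewrite big_ord1 ip_basis -/(mx T i j).
  have p0 : 0 < p by exact: lt_le_trans p1.
  rewrite leNgt => h1; rewrite leNgt; apply: contra h1 => h1.
  by rewrite gt0_ltr_powR ?nnegrE ?normc_ge0.
rewrite (schatten_inf cA) AT => /(iffLR (opnorm_le_mx lT bT M0)) hM.
by rewrite lee_fin /mx (le_trans (normc_nrm _ _))// (le_trans (hM _))// nrm_basis mulr1.
Qed.

End SchattenCalculus.

Lemma cvgC_sum_fset (R : realType) (J : choiceType) (T : Type) (F : set_system T)
    (FF : Filter F) (f : T -> J -> Cx R) (l : J -> Cx R) (r : seq J) :
  (forall i, f x i @[x --> F] --> l i) ->
  \sum_(i <- r) f x i @[x --> F] --> \sum_(i <- r) l i.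
Proof.
move=> h; elim: r => [|i r ih].
  rewrite big_nil (_ : (fun x => _) = fun=> 0); first exact: cvg_cst.
  by apply/funext => x; rewrite big_nil.
rewrite big_cons (_ : (fun x => _) = fun x => f x i + \sum_(j <- r) f x j).
  exact: cvgD (h i) ih.
by apply/funext => x; rewrite big_cons.
Qed.

(** * Decay of tails in the p-norm *)

Section Tails.
Variables (R : realType) (J : choiceType).
Local Notation l2 := (l2 R J).
Implicit Types (x y : l2) (T S : l2 -> l2) (A B : J -> J -> Cx R) (p : R) (F : {fset J}).

Lemma small_tail (a : nat -> R) (C eta : R) : (forall k, 0 <= a k) ->
  (forall N, \sum_(0 <= k < N) a k <= C) -> 0 < eta ->
  exists N, forall M, \sum_(0 <= k < M) a (N + k)%N <= eta.
Proof.
move=> a0 aC eta0; pose E := [set \sum_(0 <= k < N) a k | N in [set: nat]].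
have hE : has_sup E.
  by split; [exists (\sum_(0 <= k < 0) a k), 0%N|exists C => _ [N _ <-]].
have [_ [N _ <-] hN] := sup_adherent eta0 hE.
exists N => M.
have : \sum_(0 <= k < N + M) a k <= sup E.
  by apply: sup_upper_bound => //; exists (N + M)%N.
rewrite (big_cat_nat (leq0n N) (leq_addr M N))/=.
have -> : \sum_(N <= k < N + M) a k = \sum_(0 <= k < M) a (N + k)%N.
  by rewrite -{1}(add0n N) big_addn addKn; apply: eq_bigr => k _; rewrite addnC.
lra.
Qed.

Lemma sum_powR_le (I : eqType) (r : seq I) (t : I -> R) p : 1 <= p ->
  (forall i, 0 <= t i) -> \sum_(i <- r) t i `^ p <= (\sum_(i <- r) t i) `^ p.
Proof.
move=> p1 t0; set m := \sum_(i <- r) t i.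
have p0 : 0 < p by exact: lt_le_trans p1.
have m0 : 0 <= m by exact: sumr_ge0.
rewrite -(mulr_powRB1 m0 p0) mulr_suml big_seq [leRHS]big_seq.
apply: ler_sum => i ir; rewrite -(mulr_powRB1 (t0 i) p0) ler_wpM2l//.
rewrite ge0_ler_powR ?nnegrE ?subr_ge0//.
by rewrite /m (perm_big _ (perm_to_rem ir)) big_cons/= lerDl sumr_ge0.
Qed.

(** The expansion is cut after [N] terms. The tail is controlled by its own singular values; the
    head is estimated with exponent 1, where the sum is linear in the s_k, and this dominates
    exponent [p] by [sum_powR_le]. *)
Lemma schmidt_series_split T s u v p (eta del : R) N m (z w : 'I_m -> l2) : 1 <= p ->
  schmidt_series T s u v -> bessel z -> bessel w -> 0 <= del ->
  (forall k, (k < N)%N -> \sum_(l < m) normc (ip (z l) (v k)) * normc (ip (u k) (w l)) <= del) ->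
  (forall M, \sum_(0 <= k < M) s (N + k)%N `^ p <= eta) ->
  \sum_(l < m) normc (ip (T (z l)) (w l)) `^ p <=
    2 `^ p * ((del * \sum_(0 <= k < N) s k) `^ p + eta).
Proof.
move=> p1 hT hz hw del0 hdel heta.
have p0 : 0 <= p by exact: le_trans p1.
have tail := schmidt_series_le p1 (schmidt_series_shift N hT) heta hz hw.
have [s0 ou ov _] := hT.
pose X x : l2 := \sum_(0 <= k < N) ((s k)%:C * ip x (v k)) *: u k.
pose t l := normc (ip (X (z l)) (w l)).
have t0 l : 0 <= t l by exact: normc_ge0.
have ht : \sum_(l < m) t l <= del * \sum_(0 <= k < N) s k.
  apply: (@le_trans _ _ (\sum_(l < m) \sum_(0 <= k < N)
      s k * (normc (ip (z l) (v k)) * normc (ip (u k) (w l))))).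
    apply: ler_sum => l _; rewrite /t /X ip_osum (le_trans (ler_normc_sum _ _ _))//.
    by apply: ler_sum => k _; rewrite !normcM normc_real ger0_norm// mulrA.
  rewrite exchange_big/= mulrC mulr_suml big_nat_cond [leRHS]big_nat_cond.
  apply: ler_sum => k /andP[/andP[_ kN] _].
  by rewrite -mulr_sumr ler_wpM2l// hdel.
have hS0 : 0 <= \sum_(0 <= k < N) s k by apply: sumr_ge0.
apply: (@le_trans _ _ (\sum_(l < m) 2 `^ p * (t l `^ p +
    normc (ip (T (z l) - X (z l)) (w l)) `^ p))).
  apply: ler_sum => l _; apply: le_trans (powR_addl p1 (t0 l) (normc_ge0 _)).
  rewrite ge0_ler_powR ?nnegrE ?normc_ge0 ?addr_ge0 ?normc_ge0//.
  by rewrite (le_trans _ (ler_normcD _ _))// -ipDl addrC subrK.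
rewrite -mulr_sumr ler_wpM2l ?powR_ge0// big_split/= lerD//.
rewrite (le_trans (sum_powR_le _ p1 t0))// ge0_ler_powR ?nnegrE ?sumr_ge0//.
by rewrite mulr_ge0.
Qed.

Definition ind F (i : J) : Cx R := (i \in F)%:R.
Definition coind F (i : J) : Cx R := (i \notin F)%:R.

Lemma normc_bool (b : bool) : normc (b%:R : Cx R) <= 1.
Proof. by case: b; rewrite ?normc1E ?normc0E. Qed.

Lemma ind1 F i : normc (ind F i) <= 1. Proof. exact: normc_bool. Qed.
Lemma coind1 F i : normc (coind F i) <= 1. Proof. exact: normc_bool. Qed.
Definition diag1 (i : J) : Cx R := 1.
Lemma one1 i : normc (diag1 i) <= 1. Proof. by rewrite normc1E. Qed.

Lemma dop_ind F x : dop (ind1 F) x = trunc F x.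
Proof.
apply: l2P => i; rewrite dopE truncE /ind.
by case: (i \in F); rewrite ?mul1r ?mul0r.
Qed.

Lemma dop_coind F x : dop (coind1 F) x = x - trunc F x.
Proof.
apply: l2P => i; rewrite dopE l2B truncE /coind.
by case: (i \in F); rewrite /= ?mul1r ?mul0r ?subrr ?subr0.
Qed.

Lemma coind_adjoint F : adjoint (dop (coind1 F)) (dop (coind1 F)).
Proof.
have h := dop_adjoint (coind1 F) (conj_le1 (coind1 F)).
move=> x y; rewrite h; congr (ip _ _); apply: l2P => i.
by rewrite !dopE /coind conjc_nat.
Qed.

(** Only [x] is small, so the inequality between means is weighted: the squares belonging to [x] are
    divided by [del], those belonging to [y] multiplied by it, and both parts sum to at most
    [del]. *)
Lemma bessel_amgm m (z w : 'I_m -> l2) x y (del : R) : bessel z -> bessel w ->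
  0 < del -> nrm x <= del -> nrm y <= 1 ->
  \sum_(l < m) normc (ip (z l) x) * normc (ip y (w l)) <= del.
Proof.
move=> hz hw d0 xd y1.
apply: (@le_trans _ _ (\sum_(l < m) (normc (ip (z l) x) ^+ 2 / del +
    del * normc (ip y (w l)) ^+ 2) / 2)).
  apply: ler_sum => l _; rewrite ler_pdivlMr//.
  set al := normc _; set be := normc _.
  have := sqr_ge0 (al - del * be) => h.
  have : 0 <= (al - del * be) ^+ 2 / del by rewrite divr_ge0// ltW.
  rewrite (_ : (al - del * be) ^+ 2 / del = al ^+ 2 / del + del * be ^+ 2 - al * be * 2).
    by rewrite subr_ge0.
  by field; rewrite gt_eqF.
rewrite -mulr_suml big_split/= -mulr_suml -mulr_sumr.
have h1 : \sum_(l < m) normc (ip (z l) x) ^+ 2 <= del ^+ 2.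
  under eq_bigr do rewrite ipC normcJ.
  by rewrite (le_trans (hz x))// -nrmK lerXn2r ?nnegrE ?nrm_ge0 ?(ltW d0).
have h2 : \sum_(l < m) normc (ip y (w l)) ^+ 2 <= 1.
  by rewrite (le_trans (hw y))// -nrmK -(expr1n _ 2) lerXn2r ?nnegrE ?nrm_ge0.
have h3 : (\sum_(l < m) normc (ip (z l) x) ^+ 2) / del <= del.
  by rewrite ler_pdivrMr// -expr2.
have h4 : del * \sum_(l < m) normc (ip y (w l)) ^+ 2 <= del.
  by rewrite -[leRHS]mulr1 ler_wpM2l// ltW.
lra.
Qed.

Lemma near_small (N : nat) (v : nat -> l2) (del : R) : 0 < del ->
  \forall F \near totally, forall k, (k < N)%N -> nrm (v k - trunc F (v k)) <= del.
Proof.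
move=> d0; elim: N => [|N ih]; first by apply: filterS (totally_ge fset0).
apply: filterS2 ih (@trunc_cvg R J (v N) del d0) => F h1 h2 k.
by rewrite ltnS leq_eqVlt => /predU1P[->|]; [exact: ltW|exact: h1].
Qed.

Lemma schatten_tail p A (e : R) : 1 <= p -> (schatten_norm p%:E A < +oo)%E -> 0 < e ->
  \forall F \near totally,
    (schatten_norm p%:E (dmul diag1 A (coind F)) <= e%:E)%E /\
    (schatten_norm p%:E (dmul (coind F) A diag1) <= e%:E)%E.
Proof.
move=> p1 fA e0; have cA := schatten_compact fA.
have p0 : 0 < p by exact: lt_le_trans p1.
have [T [S [K [s [u [v [cd AT]]]]]]] := compact_schmidt cA.
have [lT bT TS cT sch] := cd.
have ss := is_schmidt_series sch; have [s0 ou ov _] := ss.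
have bT' : obnd T `|K|.
  by move=> x; rewrite (le_trans (bT x))// ler_wpM2r ?nrm_ge0// ler_norm.
pose X := fine (schatten_norm p%:E A).
have X0 : 0 <= X by rewrite fine_ge0 ?schatten_norm_ge0.
have hX : (schatten_norm p%:E (mx T) <= X%:E)%E.
  by rewrite -AT fineK// ge0_fin_numE ?schatten_norm_ge0.
have sX := iffLR (schatten_norm_schmidt lT bT TS cT sch p1 X0) hX.
(* [schmidt_series_split] yields 2^p times the sum of a head and a tail; with both at most [eta]
   this is e^p. *)
pose eta := e `^ p / 2 `^ p / 2.
have tp : 0 < 2 `^ p :> R by rewrite powR_gt0.
have eta0 : 0 < eta by rewrite !divr_gt0// powR_gt0.
have [N hN] := small_tail (fun k => powR_ge0 _ _) sX eta0.
pose SN := \sum_(0 <= k < N) s k.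
have SN0 : 0 <= SN by exact: sumr_ge0.
have SN1 : 0 < SN + 1 by rewrite ltr_wpDl.
(* The minimum with 1 keeps del * SN where a p-th power is at most its base; the + 1 covers SN =
   0. *)
pose del := Num.min 1 eta / (SN + 1).
have del0 : 0 < del by rewrite divr_gt0// lt_min ltr01.
have dS : (del * SN) `^ p <= eta.
  have h0 : 0 <= del * SN by rewrite mulr_ge0// ltW.
  have h1 : del * SN <= Num.min 1 eta.
    by rewrite /del mulrAC ler_pdivrMr// ler_wpM2l ?lerDl// le_min ler01 ltW.
  rewrite le_min in h1; have /andP[h2 h3] := h1.
  have [->|n0] := eqVneq (del * SN) 0; first by rewrite powR0 ?ltW// gt_eqF.
  by rewrite (le_trans _ h3)// ge1r_powR// lt_def n0 h0.
have fin : 2 `^ p * ((del * SN) `^ p + eta) <= e `^ p.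
  rewrite (@le_trans _ _ (2 `^ p * (eta + eta)))//.
    by rewrite ler_wpM2l ?powR_ge0// lerD2r.
  rewrite le_eqVlt; apply/orP; left; apply/eqP; rewrite /eta; field.
  by rewrite gt_eqF.
have nv k : nrm (v k) <= 1 by case: (ov.1 k) => ->; rewrite ?nrm0.
have nu k : nrm (u k) <= 1 by case: (ou.1 k) => ->; rewrite ?nrm0.
apply: filterS2 (@near_small N v _ del0) (@near_small N u _ del0) => F hv hu.
split; rewrite AT.
  rewrite (dmul_mx one1 (coind1 F) lT).
  have [h1 h2 h3] := dmul_op one1 (coind1 F) lT (normr_ge0 K) bT' cT.
  have [S' TS'] := adjoint_ex h1 h2; have [s' [u' [v' sch']]] := schmidt h1 h2 TS' h3.
  apply: (iffRL (schatten_leP (And5 h1 h2 TS' h3 sch') p1 (ltW e0))) => m z w hz hw.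
  have hz' := dop_bessel (coind1 F) hz.
  apply: le_trans fin.
  have E l : ip ((dop one1 \o T \o dop (coind1 F)) (z l)) (w l) =
      ip (T (dop (coind1 F) (z l))) (w l).
    by congr (ip _ _); apply: l2P => i; rewrite /= dopE mul1r.
  under eq_bigr do rewrite E.
  apply: (schmidt_series_split p1 ss hz' hw (ltW del0) _ hN) => k kN.
  under eq_bigr do rewrite (coind_adjoint F).
  apply: bessel_amgm => //; rewrite dop_coind; exact: hv.
rewrite (dmul_mx (coind1 F) one1 lT).
have [h1 h2 h3] := dmul_op (coind1 F) one1 lT (normr_ge0 K) bT' cT.
have [S' TS'] := adjoint_ex h1 h2; have [s' [u' [v' sch']]] := schmidt h1 h2 TS' h3.
apply: (iffRL (schatten_leP (And5 h1 h2 TS' h3 sch') p1 (ltW e0))) => m z w hz hw.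
have hw' := dop_bessel (coind1 F) hw.
apply: le_trans fin.
have E l : ip ((dop (coind1 F) \o T \o dop one1) (z l)) (w l) =
    ip (T (z l)) (dop (coind1 F) (w l)).
  rewrite /= (coind_adjoint F); congr (ip (T _) _).
  by apply: l2P => i; rewrite /= dopE mul1r.
under eq_bigr do rewrite E.
apply: (schmidt_series_split p1 ss hz hw' (ltW del0) _ hN) => k kN.
(* [bessel_amgm] expects the small vector in its first slot, so the two families exchange their
   roles. *)
have E2 l : normc (ip (z l) (v k)) * normc (ip (u k) (dop (coind1 F) (w l))) =
    normc (ip (w l) (dop (coind1 F) (u k))) * normc (ip (v k) (z l)).
  by rewrite mulrC -(coind_adjoint F) ipC normcJ [ip (z l) _]ipC normcJ.
under eq_bigr do rewrite E2.
apply: bessel_amgm => //; rewrite dop_coind; exact: hu.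
Qed.

End Tails.

(** * The trace pairing *)

Section Pairing.
Variables (R : realType) (J : choiceType).
Local Notation l2 := (l2 R J).
Implicit Types (x y : l2) (T S : l2 -> l2) (A B : J -> J -> Cx R) (p : R) (F : {fset J}).

Lemma conjv_ex x : exists y : l2, y =1 fun i => (x i)^*.
Proof.
apply: (@mk_l2 R J _ (nrm2 x)) => F; rewrite (le_trans _ (sqs_le x F))//.
by apply: ler_sum => i _; rewrite normcJ.
Qed.

Definition conjv x : l2 := projT1 (cid (conjv_ex x)).

Lemma conjvE x i : conjv x i = (x i)^*.
Proof. by rewrite /conjv; case: cid => y /=. Qed.

Lemma ip_conjv x y : ip (conjv x) (conjv y) = ip y x.
Proof.
rewrite /ip; congr (summability.sum _); apply/funext => i.
by rewrite !conjvE conjcK mulrC.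
Qed.

Lemma nrm_conjv x : nrm (conjv x) = nrm x.
Proof. by rewrite /nrm /nrm2 ip_conjv. Qed.

Lemma osys_conjv v : osys v -> osys (fun n => conjv (v n)).
Proof.
move=> [h1 h2]; split=> [n|m n mn].
  case: (h1 n) => vn; last by right; rewrite nrm_conjv.
  by left; apply: nrm_eq0; rewrite nrm_conjv vn nrm0.
by rewrite ip_conjv h2// eq_sym.
Qed.

Lemma bessel_trunc m (z : 'I_m -> l2) F : bessel z -> bessel (fun l => trunc F (z l)).
Proof.
move=> hz; rewrite (_ : (fun l => _) = fun l => dop (@ind1 R J F) (z l)).
  exact: dop_bessel.
by apply/funext => l; rewrite dop_ind.
Qed.

(** The trace of A B^T cut to a finite rectangle. The two index sets are separate because [pairing]
    is an iterated sum, whose inner sums are completed first. *)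
Definition hpair F1 F2 A B : Cx R := \sum_(i <- F1) \sum_(j <- F2) A i j * B i j.

(** The entries of [U] are the sums of t_k w_k(i) times the conjugate of z_k(j). The pairing is
    bilinear while [ip] is sesquilinear, hence the conjugate vectors. *)
Lemma hpair_mx F1 F2 T U (t : nat -> R) w z : linop T -> schmidt_series U t w z ->
  \sum_(0 <= k < N) (t k)%:C * ip (T (trunc F2 (conjv (z k)))) (trunc F1 (conjv (w k)))
    @[N --> \oo] --> hpair F1 F2 (mx T) (mx U).
Proof.
move=> lT [t0 ow oz hU].
have cv i j : ip (\sum_(0 <= k < N) ((t k)%:C * ip (basis j) (z k)) *: w k) (basis i)
    @[N --> \oo] --> mx U i j.
  by have := @cvgv_ip _ _ _ _ (basis i) (hU (basis j)); rewrite ip_basis.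
have h : \sum_(i <- F1) \sum_(j <- F2) mx T i j *
    ip (\sum_(0 <= k < N) ((t k)%:C * ip (basis j) (z k)) *: w k) (basis i)
    @[N --> \oo] --> hpair F1 F2 (mx T) (mx U).
  apply: (@cvgC_sum_fset R J nat \oo _ (fun N i => \sum_(j <- F2) mx T i j *
    ip (\sum_(0 <= k < N) ((t k)%:C * ip (basis j) (z k)) *: w k) (basis i))) => i.
  apply: (@cvgC_sum_fset R J nat \oo _ (fun N j => mx T i j *
    ip (\sum_(0 <= k < N) ((t k)%:C * ip (basis j) (z k)) *: w k) (basis i))) => j.
  exact: cvgMr (cv i j).
apply: cvg_trans h; apply: near_eq_cvg; near=> N.
have E k : ip (T (trunc F2 (conjv (z k)))) (trunc F1 (conjv (w k))) =
    \sum_(i <- F1) \sum_(j <- F2) mx T i j * (ip (basis j) (z k) * w k i).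
  rewrite /trunc ip_sumr; apply: eq_bigr => i _.
  rewrite ipZr (linop_sum _ _ _ lT) ip_suml mulr_sumr; apply: eq_bigr => j _.
  rewrite (linopZ _ _ lT) ipZl ip_basis !conjvE conjcK [ip (basis j) _]ipC ip_basis.
  by rewrite /mx; ring.
under [RHS]eq_bigr do rewrite E mulr_sumr.
rewrite [RHS]exchange_big/=; apply: eq_bigr => i _.
under [RHS]eq_bigr do rewrite mulr_sumr.
rewrite [RHS]exchange_big/=; apply: eq_bigr => j _.
rewrite ip_osum mulr_sumr; apply: eq_bigr => k _.
by rewrite ip_basis; ring.
Unshelve. all: by end_near.
Qed.

Lemma powR_div p (a b : R) : 0 <= a -> 0 < b -> (a / b) `^ p = a `^ p / b `^ p.
Proof.
move=> a0 b0; have bV : 0 <= b^-1 by rewrite invr_ge0 ltW.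
rewrite (powRM p a0 bV); congr (_ * _).
by rewrite -(powR_inv1 (ltW b0)) -powRrM mulN1r powRN.
Qed.

Lemma hoelder_sum p q (I : Type) (r : seq I) (c t : I -> R) (X Y : R) : 0 < p -> 0 < q ->
  p^-1 + q^-1 = 1 -> 0 < X -> 0 < Y -> (forall i, 0 <= c i) -> (forall i, 0 <= t i) ->
  \sum_(i <- r) c i `^ p <= X `^ p -> \sum_(i <- r) t i `^ q <= Y `^ q ->
  \sum_(i <- r) t i * c i <= X * Y.
Proof.
move=> p0 q0 pq X0 Y0 c0 t0 hc ht.
have young i : (t i * c i) / (X * Y) <= c i `^ p / X `^ p / p + t i `^ q / Y `^ q / q.
  have := conjugate_powR (divr_ge0 (c0 i) (ltW X0)) (divr_ge0 (t0 i) (ltW Y0)) p0 q0 pq.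
  rewrite (powR_div p (c0 i) X0) (powR_div q (t0 i) Y0) => h.
  by rewrite (_ : _ / (X * Y) = c i / X * (t i / Y))// invfM; ring.
rewrite -[leRHS]mul1r -ler_pdivrMr ?mulr_gt0// mulr_suml.
rewrite (le_trans (ler_sum _ (fun i _ => young i)))// big_split/= -!mulr_suml -pq.
rewrite lerD// -[leRHS]mul1r ler_wpM2r ?invr_ge0 ?(ltW p0) ?(ltW q0)//.
  by rewrite ler_pdivrMr ?powR_gt0// mul1r.
by rewrite ler_pdivrMr ?powR_gt0// mul1r.
Qed.

Lemma conj_exp_case p : 1 <= p ->
  (p = 1 /\ hoelder_conjugate p%:E = +oo%E) \/
  exists q, [/\ hoelder_conjugate p%:E = q%:E, 1 < p, 1 < q & p^-1 + q^-1 = 1].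
Proof.
rewrite le_eqVlt => /predU1P[<-|p1]; first by left; rewrite hoelder_conjugate1.
right; exists (p / (p - 1)).
have p0 : 0 < p by exact: lt_trans p1.
have p10 : 0 < p - 1 by rewrite subr_gt0.
split=> //.
- rewrite /hoelder_conjugate /= eqe gt_eqF// -EFinB inver gt_eqF//.
- by rewrite ltr_pdivlMr// mul1r gtrBl.
- by rewrite invf_div; field; rewrite gt_eqF.
Qed.

Lemma conj_exp_ge1 p : 1 <= p -> (1 <= hoelder_conjugate p%:E :> \bar R)%E.
Proof.
case/conj_exp_case => [[_ ->]|[q [-> _ q1 _]]]; first exact: leey.
by rewrite lee_fin ltW.
Qed.

(* The singular value decomposition of B reduces the trace to
   sum_k t_k <A z_k, w_k>, to which Hoelder's inequality applies. *)
Lemma hpair_le p A B (X Y : R) F1 F2 : 1 <= p -> 0 < X -> 0 < Y ->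
  (schatten_norm p%:E A <= X%:E)%E ->
  (schatten_norm (hoelder_conjugate p%:E) B <= Y%:E)%E ->
  normc (hpair F1 F2 A B) <= X * Y.
Proof.
move=> p1 X0 Y0 hA hB.
have cA := schatten_compact (le_lt_trans hA (ltry X)).
have cB := schatten_compact (le_lt_trans hB (ltry Y)).
have [T [S [K [s [u [v [cd AT]]]]]]] := compact_schmidt cA.
have [U [S' [K' [t [w [z [cd' BU]]]]]]] := compact_schmidt cB.
have [lT bT TS cT sch] := cd; have [lU bU US cU sch'] := cd'.
have su := is_schmidt_series sch'; have [t0 ow oz _] := su.
rewrite AT in hA; rewrite BU in hB.
have hs := iffLR (schatten_leP cd p1 (ltW X0)) hA.
have hcv := @hpair_mx F1 F2 _ _ _ _ _ lT su.
rewrite AT BU; apply: (@cvgC_le R _ \oo _ _ _ _ hcv); exists 0%N => // N _ /=.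
rewrite (le_trans (ler_normc_sum _ _ _))//.
under eq_bigr do rewrite normcM normc_real ger0_norm//.
pose c k := normc (ip (T (trunc F2 (conjv (z k)))) (trunc F1 (conjv (w k)))).
have hc : \sum_(0 <= k < N) c k `^ p <= X `^ p.
  rewrite big_mkord; apply: hs; apply: bessel_trunc.
    exact: (@bessel_ord R J (fun k => conjv (z k)) N (osys_conjv oz)).
  exact: (@bessel_ord R J (fun k => conjv (w k)) N (osys_conjv ow)).
have c0 k : 0 <= c k by exact: normc_ge0.
case: (conj_exp_case p1) => [[pE qE]|[q [qE p1' q1 pq]]].
  have cMU : compact_op (mx U) by rewrite -BU.
  rewrite qE (schatten_inf cMU) in hB.
  have hB' := iffLR (opnorm_le_mx lU bU (ltW Y0)) hB.
  have tY k : t k <= Y.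
    have [_ _ _ [wz _ Uz _ _]] := sch'.
    case: (wz k) => [[-> _]|[tk [wk zk]]]; first exact: ltW.
    have := hB' (z k); rewrite Uz nrmZ normc_real wk zk !mulr1.
    by rewrite gtr0_norm.
  rewrite (@le_trans _ _ (\sum_(0 <= k < N) Y * c k))//.
    by apply: ler_sum => k _; exact: (ler_wpM2r (c0 k) (tY k)).
  rewrite -mulr_sumr mulrC ler_wpM2r ?(ltW Y0)//.
  move: hc; rewrite pE powRr1 ?(ltW X0)//; congr (_ <= _).
  by apply: eq_bigr => k _; rewrite powRr1.
rewrite qE in hB.
have ht := iffLR (schatten_norm_schmidt lU bU US cU sch' (ltW q1) (ltW Y0)) hB.
apply: (hoelder_sum (lt_trans ltr01 p1') (lt_trans ltr01 q1)) => //.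
Qed.

Lemma mx_row T S i j : adjoint T S -> mx T i j = (S (basis i) j)^*.
Proof. by move=> TS; rewrite /mx -ip_basis TS ipC ip_basis. Qed.

(** Up to conjugation a row is the image of a basis vector under the adjoint, hence square
    summable. *)
Lemma row_cvg A B i : compact_op A -> compact_op B ->
  exists l : Cx R, fsum (fun j => A i j * B i j) @ totally --> l.
Proof.
move=> /compact_schmidt[T [S [K [s [u [v [[lT bT TS cT sch] ->]]]]]]].
move=> /compact_schmidt[T' [S' [K' [s' [u' [v' [[lT' bT' TS' cT' sch'] ->]]]]]]].
exists (ip (conjv (S (basis i))) (S' (basis i))).
rewrite (_ : (fun j => _) = fun j => conjv (S (basis i)) j * (S' (basis i) j)^*).
  exact: ip_cvg.
by apply/funext => j; rewrite conjvE (mx_row _ _ TS) (mx_row _ _ TS').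
Qed.

Lemma hpair_dmulr F1 F2 A B F : (F `<=` F2)%fset ->
  hpair F1 F2 A B - hpair F1 F A B = hpair F1 F2 (dmul (@diag1 R J) A (coind R F)) B.
Proof.
move=> FF; rewrite /hpair -sumrB; apply: eq_bigr => i _.
rewrite (sum_fsub _ FF) addrAC subrr add0r (sum_fsub _ FF).
rewrite [X in _ = X + _]big_seq [X in _ = X + _]big1 ?add0r; last first.
  by move=> j jF; rewrite /dmul /coind jF /= mulr0 mul0r.
rewrite big_seq [RHS]big_seq; apply: eq_bigr => j.
by rewrite inE => /andP[jF _]; rewrite /dmul /coind /diag1 jF mulr1 mul1r.
Qed.

Lemma hpair_dmull F1 F2 A B F :
  hpair (F1 `\` F)%fset F2 A B = hpair (F1 `\` F)%fset F2 (dmul (coind R F) A (@diag1 R J)) B.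
Proof.
rewrite /hpair big_seq [RHS]big_seq; apply: eq_bigr => i.
rewrite inE => /andP[iF _]; apply: eq_bigr => j _.
by rewrite /dmul /coind /diag1 iF mulr1 mul1r.
Qed.

Lemma pairing_fin A B F :
  (forall i j, ~~ ((i \in F) && (j \in F)) -> A i j * B i j = 0) ->
  pairing A B = hpair F F A B.
Proof.
move=> h; rewrite /pairing /mat_trace /mat_mul /mat_tr.
rewrite (@sum_fin_supp _ _ _ F) => [|i iF].
  rewrite /hpair big_seq [RHS]big_seq; apply: eq_bigr => i iF.
  by apply: sum_fin_supp => j jF; rewrite h// negb_and jF orbT.
rewrite (@sum_fin_supp _ _ _ fset0) ?big_seq_fset0// => j _.
by rewrite h// negb_and iF.
Qed.

(** Identifies the iterated sum [pairing] with the limit over finite squares. The two limits are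
    linked uniformly by Hoelder's inequality applied to the tails of [A]. *)
Lemma pairing_cvg p A B : 1 <= p -> (schatten_norm p%:E A < +oo)%E ->
  (schatten_norm (hoelder_conjugate p%:E) B < +oo)%E ->
  hpair F F A B @[F --> totally] --> pairing A B.
Proof.
move=> p1 fA fB; have cA := schatten_compact fA; have cB := schatten_compact fB.
have [g hg] := choice (fun i => @row_cvg A B i cA cB).
pose Y := fine (schatten_norm (hoelder_conjugate p%:E) B) + 1.
have Y0 : 0 < Y by rewrite ltr_wpDl// fine_ge0// schatten_norm_ge0.
have hY : (schatten_norm (hoelder_conjugate p%:E) B <= Y%:E)%E.
  rewrite -[leLHS]fineK ?lee_fin ?lerDl//.
  by rewrite ge0_fin_numE// schatten_norm_ge0.
have hG F1 : hpair F1 F2 A B @[F2 --> totally] --> fsum g F1.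
  exact: (@cvgC_sum_fset R J _ totally _ (fun F2 i => fsum (fun j => A i j * B i j) F2) g F1 (fun i => @hg i)).
(* Both quantities are limits of pairings of [B] with a tail of [A]: rows outside [F] in the first,
   columns outside [F] within the rows of [F] in the second. *)
have small e : 0 < e -> \forall F \near totally,
    (forall F1 F2, (F `<=` F1)%fset -> normc (fsum g F1 - fsum g F) <= e) /\
    normc (hpair F F A B - fsum g F) <= e.
  move=> e0; have eY : 0 < e / Y by rewrite divr_gt0.
  apply: filterS (schatten_tail p1 fA eY) => F [t1 t2]; split.
    move=> F1 _ FF1; rewrite /fsum (sum_fsub _ FF1) addrAC subrr add0r.
    apply: (@cvgC_le R _ totally _ _ _ _ (hG (F1 `\` F)%fset)).
    apply: filterS (totally_ge fset0) => F2 _; rewrite hpair_dmull.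
    by have := hpair_le (F1 `\` F)%fset F2 p1 eY Y0 t2 hY; rewrite divfK// gt_eqF.
  have h2 : hpair F F2 A B - hpair F F A B @[F2 --> totally] --> fsum g F - hpair F F A B.
    by apply: cvgB; [exact: hG|exact: cvg_cst].
  rewrite normcBC; apply: (@cvgC_le R _ totally _ _ _ _ h2).
  apply: filterS (totally_ge F) => F2 FF2; rewrite hpair_dmulr//.
  by have := hpair_le F F2 p1 eY Y0 t1 hY; rewrite divfK// gt_eqF.
have [l hl] : exists l : Cx R, fsum g @ totally --> l.
  apply: cvgC_cauchy => e e0; have e40 : 0 < e / 4 by rewrite divr_gt0.
  have [F [h _]] := filter_ex (small _ e40).
  exists [set G | (F `<=` G)%fset]; first exact: totally_ge.
  move=> G G' FG FG'; rewrite (le_lt_trans (ler_distcD (fsum g F) _ _))//.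
  rewrite (@le_lt_trans _ _ (e / 4 + e / 4))//; last by lra.
  by rewrite lerD//; [exact: (h G G)|rewrite normcBC; exact: (h G' G')].
have -> : pairing A B = l.
  rewrite /pairing /mat_trace /mat_mul /mat_tr; apply: sum_eq.
  have -> : (fun i => summability.sum (fun j => A i j * B i j)) = g.
    by apply/funext => i; exact: sum_eq (@hg i).
  exact: hl.
apply/cvgCP => e e0; have e20 : 0 < e / 2 by rewrite divr_gt0.
have /cvgCP/(_ _ e20) := hl; apply: filterS2 (small _ e20) => F [_ h1] h2.
by rewrite (le_lt_trans (ler_distcD (fsum g F) _ _))// [ltRHS]splitr ler_ltD.
Qed.

End Pairing.

(** * Matrix units *)

Section MatrixUnits.
Variables (R : realType) (J : choiceType).
Local Notation l2 := (l2 R J).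
Implicit Types (x y : l2).

Lemma bolzano_weierstrass_C (w : nat -> Cx R) (M : R) : (forall n, normc (w n) <= M) ->
  exists2 f : nat -> nat, {homo f : m n / (m < n)%N} &
  exists l : Cx R, w (f n) @[n --> \oo] --> l.
Proof.
have bw (a : nat -> R) : (forall n, `|a n| <= M) ->
    exists2 f : nat -> nat, {homo f : m n / (m < n)%N} &
    exists l : R, a (f n) @[n --> \oo] --> l.
  move=> aM; have [|f fi /cvg_ex[l hl]] := @bolzano_weierstrass R a.
    exists M; split; first exact: num_real.
    by move=> y My n _; rewrite /= (le_trans (aM n))// ltW.
  exists f; last by exists l.
  by move=> m n; rewrite !ltnNge; apply: contra => h; have := fi n m => <-.
move=> wM.
have [|f fi [a ha]] := bw (fun n => Re (w n)).
  by move=> n; rewrite (le_trans (normc_Re _)).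
have [|g gi [b hb]] := bw (fun n => Im (w (f n))).
  by move=> n; rewrite (le_trans (normc_Im _)).
exists (f \o g) => [m n mn|]; first by apply/fi/gi.
exists (Complex a b).
apply/cvgCP => e e0; have e20 : 0 < e / 2 by rewrite divr_gt0.
have /cvgrPdist_lt/(_ _ e20)[N _ hN] := ha; have /cvgrPdist_lt/(_ _ e20) := hb.
apply: filterS2 (nbhs_infty_ge N) => n Nn hn /=.
have := hN (g n) (leq_trans Nn (homo_ge gi n)); rewrite /= => h.
rewrite (le_lt_trans (normc_le _))// [ltRHS]splitr.
have -> : Re (w (f (g n)) - Complex a b) = Re (w (f (g n))) - a by case: (w _).
have -> : Im (w (f (g n)) - Complex a b) = Im (w (f (g n))) - b by case: (w _).
by rewrite ltrD// distrC.
Qed.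

Definition emx (i j : J) : J -> J -> Cx R := fun a b => ((a == i) && (b == j))%:R.

Definition eop (i j : J) x : l2 := ip x (basis j) *: basis i.

Lemma mx_eop i j : mx (eop i j) = emx i j.
Proof.
apply/funext => a; apply/funext => b; rewrite /mx /eop l2Z ip_basis !basisE /emx.
by rewrite [j == b]eq_sym; case: (a == i); case: (b == j); rewrite ?mulr1 ?mulr0 ?mul0r.
Qed.

Lemma eop_linop i j : linop (eop i j).
Proof. by move=> a x y; rewrite /eop ipDl ipZl scalerDl scalerA. Qed.

Lemma eop_obnd i j : obnd (eop i j) 1.
Proof. by move=> x; rewrite /eop nrmZ nrm_basis mulr1 mul1r ip_basis normc_nrm. Qed.

Lemma eop_cptop i j : cptop (eop i j).
Proof.
move=> w w1; have [|f fi [l hl]] := @bolzano_weierstrass_C (fun n => ip (w n) (basis j)) 1.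
  by move=> n; rewrite ip_basis (le_trans (normc_nrm _ _)).
exists f => //; exists (l *: basis i).
apply/cvgrPdist_lt => e e0; have /cvgCP/(_ e e0) := hl; apply: filterS => n h.
by rewrite sub0r normrN ger0_norm ?nrm_ge0// /eop -scalerBl nrmZ nrm_basis mulr1.
Qed.

Lemma emx_compact i j : compact_op (emx i j).
Proof.
apply/compact_opP; exists (eop i j), 1; split => //.
- exact: eop_linop.
- exact: eop_obnd.
- exact: eop_cptop.
- by rewrite mx_eop.
Qed.

Lemma schatten_emx (q : \bar R) i j : (1 <= q)%E -> (schatten_norm q (emx i j) <= 1)%E.
Proof.
have h1 := @eop_linop i j; have h2 := @eop_obnd i j; have h3 := @eop_cptop i j.
have l01 : (0 : R) <= 1 by [].
case/ge1_case => [[p [-> p1]]|->].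
  have [S TS] := adjoint_ex h1 h2; have [s [u [v sch]]] := schmidt h1 h2 TS h3.
  rewrite -mx_eop; apply: (iffRL (schatten_leP (And5 h1 h2 TS h3 sch) p1 l01)).
  move=> m z w hz hw.
  have p0 : 0 < p by exact: lt_le_trans p1.
  (* Each term is at most 1, hence at least its p-th power, and the sum of the terms is the case
     [del] = 1 of [bessel_amgm]. *)
  rewrite powR1; apply: le_trans (bessel_amgm hz hw ltr01 (_ : nrm (basis j) <= 1)
    (_ : nrm (basis i) <= 1)); rewrite ?nrm_basis//.
  apply: ler_sum => l _; rewrite /eop ipZl normcM.
  set t := normc _ * normc _.
  have t0 : 0 <= t by rewrite mulr_ge0 ?normc_ge0.
  have t1 : t <= 1.
    rewrite -[1](mulr1 (1 : R)); apply: ler_pM; rewrite ?normc_ge0//.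
      rewrite ip_basis (le_trans (normc_nrm _ _))// -(ler_pXn2r (n := 2)) ?nnegrE ?nrm_ge0//.
      by rewrite nrmK expr1n bessel_nrm2.
    rewrite (le_trans (cauchy_schwarz _ _))// nrm_basis mul1r -(ler_pXn2r (n := 2)) ?nnegrE ?nrm_ge0//.
    by rewrite nrmK expr1n bessel_nrm2.
  rewrite -(mulr_powRB1 t0 p0) -[leRHS]mulr1 ler_wpM2l//.
  apply: (@le_trans _ _ (1 `^ (p - 1))); last by rewrite powR1.
  by rewrite ge0_ler_powR ?nnegrE ?subr_ge0.
rewrite (schatten_inf (emx_compact i j)) -mx_eop.
by apply: (iffRL (opnorm_le_mx h1 h2 l01)).
Qed.

End MatrixUnits.

(** * Norms of matrices over Schatten classes *)

Section FiniteForms.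
Variables (R : realType) (J : finType).
Local Notation l2 := (l2 R J).

Definition fnrm (al : J -> Cx R) : R := Num.sqrt (\sum_a normc (al a) ^+ 2).

Lemma fnrm_ge0 al : 0 <= fnrm al. Proof. exact: sqrtr_ge0. Qed.

Lemma fvec_ex (al : J -> Cx R) : exists x : l2, x =1 al.
Proof.
apply: (@mk_l2 R J _ (\sum_a normc (al a) ^+ 2)) => F; rewrite /sqs.
rewrite [leRHS](bigID [in F])/= -[leLHS]addr0 lerD ?sumr_ge0// => [|a _]; last exact: sqr_ge0.
by rewrite big_uniq ?fset_uniq.
Qed.

Lemma fvec_sum (x : l2) : x = \sum_a x a *: basis a.
Proof.
apply: l2P => i; rewrite l2_sum (bigD1 i)// l2Z basisE eqxx mulr1 big1 => [|a ai].
  by rewrite [RHS]addr0.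
by rewrite l2Z basisE eq_sym (negbTE ai) mulr0.
Qed.

Lemma fvec_nrm (x : l2) : nrm x = fnrm x.
Proof.
rewrite /nrm /fnrm; congr Num.sqrt.
rewrite /nrm2 {2}(fvec_sum x) ip_sumr.
under eq_bigr => a _ do rewrite ipZr ip_basis mulrC mulcJ.
by elim/big_rec2: _ => // a y1 y2 _ <-; rewrite ReD.
Qed.

Lemma l2norm_fnrm (al : J -> Cx R) : l2norm al = (fnrm al)%:E.
Proof.
have [x xE] := fvec_ex al; have <- : l2val x = al by apply/funext.
by rewrite l2normE fvec_nrm.
Qed.

Lemma fnrm_eq0 al : fnrm al = 0 -> forall a, al a = 0.
Proof.
have [x xE] := fvec_ex al; have -> : al = l2val x by apply/funext.
by rewrite -fvec_nrm => /nrm_eq0 -> a.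
Qed.

Lemma form_le (G : J -> J -> Cx R) (K : R) al be : 0 <= K -> (opnorm G <= K%:E)%E ->
  normc (\sum_a \sum_b al a * G a b * be b) <= K * (fnrm al * fnrm be).
Proof.
move=> K0 hG; have [T [K' [lT _ bT GT]]] := opnorm_ltyP (le_lt_trans hG (ltry _)).
rewrite GT in hG *; have {}hG := iffLR (opnorm_le_mx lT bT K0) hG.
have [x xE] := fvec_ex al; have [y yE] := fvec_ex be.
have -> : \sum_a \sum_b al a * mx T a b * be b = ip (T y) (conjv x).
  rewrite (fvec_sum (conjv x)) {1}(fvec_sum y).
  rewrite ip_sumr; apply: eq_bigr => a _.
  rewrite conjvE ipZr conjcK ip_basis (linop_sum _ _ _ lT) l2_sum mulr_sumr; apply: eq_bigr => b _.
  by rewrite (linopZ _ _ lT) l2Z /mx xE yE; ring.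
have -> : fnrm al = nrm x by rewrite fvec_nrm; congr fnrm; apply/funext => a; rewrite xE.
have -> : fnrm be = nrm y by rewrite fvec_nrm; congr fnrm; apply/funext => a; rewrite yE.
rewrite (le_trans (cauchy_schwarz _ _))// nrm_conjv [nrm x * _]mulrC mulrA ler_wpM2r ?nrm_ge0//; exact: hG.
Qed.

End FiniteForms.

Lemma fnrm_swap (R : realType) (J K : finType) (al : J * K -> Cx R) :
  fnrm (fun s : K * J => al (s.2, s.1)) = fnrm al.
Proof.
rewrite /fnrm; congr Num.sqrt.
by rewrite (reindex (fun s : K * J => (s.2, s.1)))//=; exists (fun s : J * K => (s.2, s.1)) => [[]|[]].
Qed.

Lemma entry_opnorm (R : realType) (J : choiceType) (A : J -> J -> Cx R) i j :
  ((normc (A i j))%:E <= opnorm A)%E.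
Proof.
apply: le_ereal_fin => [|M M0 hM]; first exact: opnorm_ge0.
have [T [K [lT _ bT AT]]] := opnorm_ltyP (le_lt_trans hM (ltry _)).
rewrite AT in hM *; have {}hM := iffLR (opnorm_le_mx lT bT M0) hM.
by rewrite lee_fin /mx (le_trans (normc_nrm _ _))// (le_trans (hM _))// nrm_basis mulr1.
Qed.

Lemma schatten_infZ (R : realType) (J : choiceType) (A : J -> J -> Cx R) (c : Cx R) (M : R) : 0 <= M ->
  (schatten_norm +oo%E A <= M%:E)%E ->
  (schatten_norm +oo (fun i j => c * A i j)%R <= (normc c * M)%:E)%E.
Proof.
move=> M0 h; have cA := schatten_compact (le_lt_trans h (ltry _)).
have [T [K [lT K0 bT cT AT]]] := iffLR (compact_opP A) cA.
rewrite schatten_inf// AT in h; have {}h := iffLR (opnorm_le_mx lT bT M0) h.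
pose T' x := c *: T x.
have lT' : linop T' by move=> a x y; rewrite /T' lT scalerDr !scalerA mulrC.
have bT' : obnd T' (normc c * M).
  by move=> x; rewrite /T' nrmZ -mulrA ler_wpM2l ?normc_ge0.
have cM0 : 0 <= normc c * M by rewrite mulr_ge0 ?normc_ge0.
have E : (fun i j => c * A i j) = mx T'.
  by apply/funext => i; apply/funext => j; rewrite AT.
have cE : compact_op (mx T').
  apply/compact_opP; exists T', (normc c * M); refine (And5 lT' cM0 bT' _ erefl) => w w1.
  have [f fi [y hy]] := cT w w1; exists f => //; exists (c *: y).
  have := @cvgv_lin R J _ _ _ _ c hy (cvgv_cst (0 : l2 R J)).
  by apply: cvg_trans; apply: near_eq_cvg; near=> n; rewrite !addr0.
by rewrite E (schatten_inf cE); apply: opnorm_mx_le.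
Unshelve. all: by end_near.
Qed.

(** * The end point norms on matrices over S_oo and S_1 *)

Section Endpoints.
Variables (R : realType) (I : choiceType).
Local Notation Mx n := ('I_n -> 'I_n -> I -> I -> Cx R).
Implicit Types (F : {fset I}).

Definition trX F n (X : Mx n) : Mx n := fun k l => dmul (ind R F) (X k l) (ind R F).

Lemma hpair_ind F A B : hpair F F (dmul (ind R F) A (ind R F)) B = hpair F F A B.
Proof.
rewrite /hpair big_seq [RHS]big_seq; apply: eq_bigr => i iF.
rewrite big_seq [RHS]big_seq; apply: eq_bigr => j jF.
by rewrite /dmul /ind iF jF mul1r mulr1.
Qed.

Lemma hpairC F A B : hpair F F A B = hpair F F B A :> Cx R.
Proof. by apply: eq_bigr => i _; apply: eq_bigr => j _; rewrite mulrC. Qed.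

Lemma hpairZ F A B (c : Cx R) : hpair F F (fun i j => c * A i j) B = c * hpair F F A B.
Proof.
rewrite /hpair mulr_sumr; apply: eq_bigr => i _; rewrite mulr_sumr.
by apply: eq_bigr => j _; rewrite mulrA.
Qed.

Lemma pairing_ind F A B : pairing (dmul (ind R F) A (ind R F)) B = hpair F F A B.
Proof.
rewrite (@pairing_fin _ _ _ _ F) ?hpair_ind// => i j.
by rewrite negb_and /dmul /ind => /orP[]/negbTE ->; rewrite ?(mulr0, mul0r).
Qed.

Lemma pairingC_ind F A B : pairing A (dmul (ind R F) B (ind R F)) = hpair F F A B.
Proof.
rewrite (@pairing_fin _ _ _ _ F) => [|i j]; first by rewrite hpairC hpair_ind hpairC.
by rewrite negb_and /dmul /ind => /orP[]/negbTE ->; rewrite ?(mulr0, mul0r).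
Qed.

Lemma pairing_emx (A : I -> I -> Cx R) i j : pairing A (emx R i j) = A i j.
Proof.
rewrite /pairing /mat_trace /mat_mul /mat_tr (@sum_fin_supp _ _ _ [fset i]%fset) => [|a].
  rewrite big_seq_fset1 (@sum_fin_supp _ _ _ [fset j]%fset) => [|b].
    by rewrite big_seq_fset1 /emx !eqxx mulr1.
  by rewrite inE /emx => /negbTE ->; rewrite andbF mulr0.
rewrite inE => /negbTE ai; rewrite (@sum_fin_supp _ _ _ fset0) ?big_seq_fset0// => b _.
by rewrite /emx ai mulr0.
Qed.

Lemma Mn_Sinf_ge0 n (X : Mx n) : (0 <= Mn_Sinf X)%E.
Proof. exact: schatten_norm_ge0. Qed.

(** A supremum is nonnegative as soon as one admissible [Y] exists; the empty block, with m = 0, is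
    exhibited. *)
Lemma Mn_S1_ge0 n (X : Mx n) : (0 <= Mn_S1 X)%E.
Proof.
rewrite /Mn_S1; case: ifP => // _; apply: (@le_trans _ _ (opnorm (fun a b : 'I_0 * 'I_n =>
  pairing (X a.2 b.2) ((fun _ _ _ _ => 0) a.1 b.1)))); first exact: opnorm_ge0.
apply: ereal_sup_ubound; exists 0%N => //; exists (fun _ _ _ _ => 0) => //=.
rewrite /Mn_Sinf; apply: (@le_trans _ _ (0%:E : \bar R)); last by rewrite lee_fin.
pose Z (_ : l2 R (I * 'I_0)%type) : l2 R (I * 'I_0)%type := 0.
have l0 : linop Z by move=> a x y; rewrite /Z scaler0 addr0.
have b0 : obnd Z 0 by move=> x; rewrite /Z nrm0 mul0r.
have c0 : compact_op (mx Z).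
  apply/compact_opP; exists Z, 0; refine (And5 l0 (lexx 0) b0 _ erefl) => w _.
  by exists id; [by []|exists 0; rewrite /Z subrr nrm0; exact: cvg_cst].
have -> : (fun _ _ : I * 'I_0 => 0) = mx Z by [].
by rewrite schatten_inf//; apply: opnorm_mx_le.
Qed.

Lemma Sinf_tr F n (X : Mx n) : (Mn_Sinf (trX F X) <= Mn_Sinf X)%E.
Proof.
apply: (@schatten_dmul R _ _ (fun a : I * 'I_n => ind R F a.1) (fun a => ind R F a.1)).
- exact: leey.
- by move=> a; exact: ind1.
- by move=> a; exact: ind1.
Qed.

Lemma Sinf_entry n (X : Mx n) k l i j : ((normc (X k l i j))%:E <= Mn_Sinf X)%E.
Proof.
exact: (@entry_le R _ +oo%E (fun a b : I * 'I_n => X a.2 b.2 a.1 b.1) (i, k) (j, l) (leey _)).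
Qed.

Lemma S1_le n (X : Mx n) m (Y : Mx m) : (Mn_Sinf Y <= 1)%E ->
  (opnorm (fun a b : 'I_m * 'I_n => pairing (X a.2 b.2) (Y a.1 b.1)) <= Mn_S1 X)%E.
Proof.
move=> hY; rewrite /Mn_S1; case: ifP => [_|_]; last exact: leey.
by apply: ereal_sup_ubound; exists m => //; exists Y.
Qed.

(** By duality: the truncation moves onto the test matrix [Y], where it is contractive for the norm
    of S_oo. *)
Lemma S1_tr F n (X : Mx n) : (Mn_S1 (trX F X) <= Mn_S1 X)%E.
Proof.
rewrite {2}/Mn_S1; case: ifPn => [/asboolP h|_]; last exact: leey.
rewrite {1}/Mn_S1 ifT; last first.
  apply/asboolP => k l; apply: le_lt_trans (h k l).
  rewrite /trX; exact: (@schatten_dmul R I 1%E _ _ (X k l) (lexx (1%E : \bar R)) (@ind1 R I F) (@ind1 R I F)).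
apply: ge_ereal_sup => _ [m _ [Y hY <-]]; apply: ereal_sup_ubound; exists m => //.
exists (trX F Y); first exact: le_trans (Sinf_tr F Y) hY.
congr opnorm; apply/funext => a; apply/funext => b.
by rewrite pairing_ind pairingC_ind.
Qed.

Lemma S1_entry n (X : Mx n) k l i j : ((normc (X k l i j))%:E <= Mn_S1 X)%E.
Proof.
pose Y : Mx 1 := fun _ _ => emx R i j.
have hY : (Mn_Sinf Y <= 1)%E.
  rewrite /Mn_Sinf (_ : (fun a b => _) = emx R (i, ord0) (j, ord0)).
    by apply: schatten_emx; exact: leey.
  apply/funext => -[a s]; apply/funext => -[b t]; rewrite /Y /emx /=.
  by rewrite !xpair_eqE !ord1 !eqxx !andbT.
apply: le_trans (S1_le X hY).
have := entry_opnorm (fun a b : 'I_1 * 'I_n => pairing (X a.2 b.2) (Y a.1 b.1)) (ord0, k) (ord0, l).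
by rewrite /= pairing_emx.
Qed.

(** The value of the truncated trace pairing on a factorization of a tensor as in [opproj_norm]. *)
Definition bil F m n (X : Mx m) (Y : Mx n) (al be : 'I_m * 'I_n -> Cx R) : Cx R :=
  \sum_s \sum_t al s * hpair F F (X s.1 t.1) (Y s.2 t.2) * be t.

(** Divided by [a] and truncated, [X] is a test matrix in the supremum defining the norm of [Y]; the
    truncation turns the full pairing into a finite one. *)
Lemma bil_inf1 F m n (X : Mx m) (Y : Mx n) al be (a b : R) : 0 < a -> 0 <= b ->
  (Mn_Sinf X <= a%:E)%E -> (Mn_S1 Y <= b%:E)%E ->
  normc (bil F X Y al be) <= a * b * (fnrm al * fnrm be).
Proof.
move=> a0 b0 hX hY; pose X' : Mx m := fun k l i j => (a^-1)%:C * X k l i j.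
have hX' : (Mn_Sinf (trX F X') <= 1)%E.
  rewrite (le_trans (Sinf_tr _ _))//.
  have := schatten_infZ (a^-1)%:C (ltW a0) hX.
  by rewrite normc_real gtr0_norm ?invr_gt0// mulVf ?gt_eqF.
have := form_le al be b0 (le_trans (S1_le Y hX') hY).
have -> : \sum_s \sum_t al s * pairing (Y s.2 t.2) (trX F X' s.1 t.1) * be t =
    (a^-1)%:C * bil F X Y al be.
  rewrite /bil mulr_sumr; apply: eq_bigr => s _; rewrite mulr_sumr; apply: eq_bigr => t _.
  by rewrite pairingC_ind hpairC hpairZ; ring.
rewrite normcM normc_real gtr0_norm ?invr_gt0// mulrC ler_pdivrMr// => h.
by rewrite (le_trans h)// le_eqVlt; apply/orP; left; apply/eqP; ring.
Qed.

Lemma bil_swap F m n (X : Mx m) (Y : Mx n) al be :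
  bil F X Y al be = bil F Y X (fun s => al (s.2, s.1)) (fun s => be (s.2, s.1)).
Proof.
have sw : bijective (fun s : 'I_n * 'I_m => (s.2, s.1)).
  by exists (fun s : 'I_m * 'I_n => (s.2, s.1)) => [[]|[]].
rewrite /bil (reindex (fun s : 'I_n * 'I_m => (s.2, s.1)))/=; last exact: onW_bij.
apply: eq_bigr => s _; rewrite (reindex (fun s : 'I_n * 'I_m => (s.2, s.1)))/=; last exact: onW_bij.
by apply: eq_bigr => t _; rewrite hpairC.
Qed.

Lemma bil_1inf F m n (X : Mx m) (Y : Mx n) al be (a b : R) : 0 <= a -> 0 < b ->
  (Mn_S1 X <= a%:E)%E -> (Mn_Sinf Y <= b%:E)%E ->
  normc (bil F X Y al be) <= a * b * (fnrm al * fnrm be).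
Proof.
move=> a0 b0 hX hY; rewrite bil_swap -(fnrm_swap al) -(fnrm_swap be) [a * b]mulrC.
exact: bil_inf1.
Qed.

End Endpoints.

Lemma cvge0_le (R : realType) (T : Type) (F : set_system T) {FF : Filter F} (f g : T -> \bar R) :
  (forall x, (0 <= f x)%E) -> (forall x, (f x <= g x)%E) ->
  g x @[x --> F] --> 0%E -> f x @[x --> F] --> 0%E.
Proof.
move=> f0 fg hg; apply: (@squeeze_cvge _ _ _ _ (fun=> 0%E) _ g) hg.
  by apply: nearW => x; rewrite f0 fg.
exact: cvg_cst.
Qed.

Lemma cvge0_lt (R : realType) (T : Type) (F : set_system T) {FF : Filter F} (f : T -> \bar R)
  (e : R) : 0 < e -> f x @[x --> F] --> 0%E -> \forall x \near F, (f x < e%:E)%E.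
Proof.
move=> e0 hf; have e0' : (0%:E < e%:E)%E by rewrite lte_fin.
exact: (hf _ (open_ereal_lt' e0')).
Qed.

(** * Complex interpolation of contractions and functionals *)

Section InterpolationBounds.
Variables (R : realType) (V : lmodType (Cx R)) (N0 N1 : V -> \bar R).
Hypotheses (N0_ge0 : forall x, (0 <= N0 x)%E) (N1_ge0 : forall x, (0 <= N1 x)%E).

Lemma sum_norm_ge0 x : (0 <= sum_norm N0 N1 x)%E.
Proof. by apply: le_ereal_inf_tmp => _ [y _ <-]; rewrite adde_ge0. Qed.

Lemma interp_lt (th : R) x (a : \bar R) : (interp_norm N0 N1 th x < a)%E ->
  exists f (M : R), [/\ (0 <= M) /\ (M%:E < a)%E, calderon N0 N1 f, f th%:C = x,
    forall t : R, (N0 (f (Complex 0%R t)) <= M%:E)%E &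
    forall t : R, (N1 (f (Complex 1%R t)) <= M%:E)%E].
Proof.
move=> /ereal_inf_lt[_ [f [cf fx] <-]] h.
set m := maxe _ _ in h.
have m0 (t : R) : (N0 (f (Complex 0%R t)) <= m)%E.
  by rewrite le_max; apply/orP; left; apply: ereal_sup_ubound; exists t.
have m1 (t : R) : (N1 (f (Complex 1%R t)) <= m)%E.
  by rewrite le_max; apply/orP; right; apply: ereal_sup_ubound; exists t.
have mg : (0 <= m)%E by apply: le_trans (m0 0).
have fm : m \is a fin_num by rewrite ge0_fin_numE// (lt_le_trans h)// leey.
exists f, (fine m); rewrite fineK//; split=> //; split=> //.
by rewrite fine_ge0.
Qed.

Lemma interp_norm_ge0 (th : R) x : (0 <= interp_norm N0 N1 th x)%E.
Proof.
rewrite leNgt; apply/negP => /interp_lt[f [M [[M0 +] _ _ _ _]]].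
by rewrite lte_fin ltNge M0.
Qed.

Section Map.
Variable L : V -> V.
Hypotheses (L_lin : forall (a : Cx R) x y, L (a *: x + y) = a *: L x + L y)
  (L0 : forall x, (N0 (L x) <= N0 x)%E) (L1 : forall x, (N1 (L x) <= N1 x)%E).

Let LB x y : L (x - y) = L x - L y.
Proof. by rewrite addrC -scaleN1r L_lin scaleN1r addrC. Qed.

Let LZ a x : L (a *: x) = a *: L x.
Proof.
have L00 : L 0 = 0 by have := LB 0 0; rewrite !subrr.
by rewrite -[a *: x]addr0 L_lin L00 addr0.
Qed.

Lemma sum_normL x : (sum_norm N0 N1 (L x) <= sum_norm N0 N1 x)%E.
Proof.
apply: le_ereal_inf_tmp => _ [y _ <-].
apply: (@le_trans _ _ (N0 (L y) + N1 (L x - L y)%R)%E).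
  by apply: ereal_inf_lbound; exists (L y).
by rewrite -LB leeD.
Qed.

Lemma bdry_supL N f j : (forall x, (N (L x) <= N x)%E) ->
  (bdry_sup N (L \o f) j <= bdry_sup N f j)%E.
Proof.
move=> LN; apply: ge_ereal_sup => _ [t _ <-]; apply: le_trans (LN _) _.
by apply: ereal_sup_ubound; exists t.
Qed.

Lemma bdry_C0L N f j : (forall x, (0 <= N x)%E) -> (forall x, (N (L x) <= N x)%E) ->
  bdry_C0 N f j -> bdry_C0 N (L \o f) j.
Proof.
move=> Nge LN [h1 h2 h3 h4]; split.
- exact: le_lt_trans (bdry_supL f j LN) h1.
- by move=> s; apply: cvge0_le (h2 s) => t //=; rewrite -LB.
- by apply: cvge0_le h3 => t /=.
- by apply: cvge0_le h4 => t /=.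
Qed.

Lemma calderonL f : calderon N0 N1 f -> calderon N0 N1 (L \o f).
Proof.
move=> [h1 h2 h3 h4 h5]; split.
- apply: le_lt_trans h1; apply: ge_ereal_sup => _ [z zs <-].
  by apply: le_trans (sum_normL _) _; apply: ereal_sup_ubound; exists z.
- move=> z zs; apply: cvge0_le (h2 z zs) => w /=; first exact: sum_norm_ge0.
  by rewrite -LB sum_normL.
- move=> z zs; have [d d1 d2] := h3 z zs; exists (L d).
    exact: le_lt_trans (sum_normL d) d1.
  apply: cvge0_le d2 => w /=; first exact: sum_norm_ge0.
  by rewrite -LB -LZ -LB sum_normL.
- exact: bdry_C0L.
- exact: bdry_C0L.
Qed.

(** Composition with [L] maps the admissible functions for [x] to admissible functions for [L x].
    This makes truncation contractive on M_n(S_p). *)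
Lemma interp_normL (th : R) x : (interp_norm N0 N1 th (L x) <= interp_norm N0 N1 th x)%E.
Proof.
apply: le_ereal_inf_tmp => _ [f [cf fx] <-].
apply: (@le_trans _ _ (maxe (bdry_sup N0 (L \o f) 0) (bdry_sup N1 (L \o f) 1))).
  by apply: ereal_inf_lbound; exists (L \o f) => //; split; [exact: calderonL|rewrite /= fx].
by rewrite ge_max !le_max (bdry_supL f 0 L0) (bdry_supL f 1 L1) orbT.
Qed.

End Map.

Section Functional.
Variable E : V -> Cx R.
Hypotheses (E_lin : forall (a : Cx R) x y, E (a *: x + y) = a * E x + E y)
  (E0 : forall x, ((normc (E x))%:E <= N0 x)%E) (E1 : forall x, ((normc (E x))%:E <= N1 x)%E).

Let EB x y : E (x - y) = E x - E y.
Proof. by rewrite addrC -scaleN1r E_lin mulN1r addrC. Qed.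

Let EZ a x : E (a *: x) = a * E x.
Proof.
have E00 : E 0 = 0 by have := EB 0 0; rewrite !subrr.
by rewrite -[a *: x]addr0 E_lin E00 addr0.
Qed.

Lemma functional_sum_norm x : ((normc (E x))%:E <= sum_norm N0 N1 x)%E.
Proof.
apply: le_ereal_inf_tmp => _ [y _ <-].
apply: (@le_trans _ _ ((normc (E y))%:E + (normc (E (x - y)))%:E)%E).
  by rewrite -EFinD lee_fin (le_trans _ (ler_normcD _ _))// EB addrC subrK.
by rewrite leeD.
Qed.

(** The first three clauses of [calderon] are stated in the norm of X0 + X1, for which [E] is a
    contraction, so they descend to the scalar function. *)
Lemma calderon_strip_hol f : calderon N0 N1 f -> strip_hol (E \o f).
Proof.
move=> [h1 h2 h3 _ _]; split.
- exists (fine (ereal_sup [set sum_norm N0 N1 (f z) | z in @closed_strip R])) => z zs.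
  have h : ((normc (E (f z)))%:E <=
      ereal_sup [set sum_norm N0 N1 (f z) | z in @closed_strip R])%E.
    by apply: le_trans (functional_sum_norm _) _; apply: ereal_sup_ubound; exists z.
  rewrite -lee_fin fineK// ge0_fin_numE//; apply: le_trans h.
  by rewrite lee_fin normc_ge0.
- move=> z zs; apply/(@cvgCP _ _ (within (@closed_strip R) (nbhs z))) => e e0.
  have FF : Filter (within (@closed_strip R) (nbhs z)).
    exact: (within_filter _ (nbhs_filter z)).
  have h := @cvge0_lt _ _ _ FF _ _ e0 (h2 z zs).
  apply: (@filterS _ (within (@closed_strip R) (nbhs z)) FF _ _ _ h) => w /(le_lt_trans (functional_sum_norm _)).
  by rewrite lte_fin EB.
- move=> z zs; have [d _ d2] := h3 z zs.
  apply/cvg_ex; exists (E d).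
  apply/(@cvgCP _ _ ((0 : Cx R)^')) => e e0.
  have h := @cvge0_lt _ _ _ (dnbhs_filter _) _ _ e0 d2.
  apply: (@filterS _ ((0 : Cx R)^') (dnbhs_filter _) _ _ _ h) => w /(le_lt_trans (functional_sum_norm _)).
  rewrite lte_fin EB EZ EB (addrC z).
  by rewrite -[X in X + z](mulr1 w).
Qed.

End Functional.

End InterpolationBounds.

(** * Matrix norms over S_p and their duality *)

Section MatrixNorms.
Variables (R : realType) (I : choiceType).
Local Notation Mx n := ('I_n -> 'I_n -> I -> I -> Cx R).
Implicit Types (F : {fset I}) (p q : R).

Lemma Mn_S1E n (X : Mx n) : Mn_S 1%E X = Mn_S1 X.
Proof. by rewrite /Mn_S eqxx. Qed.

Lemma Mn_SinfE n (X : Mx n) : Mn_S +oo%E X = Mn_Sinf X.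
Proof. by rewrite /Mn_S eqxx. Qed.

Lemma Mn_SE p n (X : Mx n) : 1 < p ->
  Mn_S p%:E X = interp_norm (@Mn_Sinf R I n) (@Mn_S1 R I n) p^-1 X.
Proof. by move=> p1; rewrite /Mn_S/= eqe gt_eqF. Qed.

Lemma Mn_S_case (P : \bar R -> Prop) : P +oo%E -> P 1%E -> (forall p, 1 < p -> P p%:E) ->
  forall q : \bar R, (1 <= q)%E -> P q.
Proof.
move=> h1 h2 h3 q /ge1_case[[p [-> ]]|->//].
by rewrite le_eqVlt => /predU1P[<-|/h3].
Qed.

Lemma Mn_S_ge0 (q : \bar R) n (X : Mx n) : (1 <= q)%E -> (0 <= Mn_S q X)%E.
Proof.
move: q; apply: Mn_S_case => [||p p1].
- by rewrite Mn_SinfE; exact: Mn_Sinf_ge0.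
- by rewrite Mn_S1E; exact: Mn_S1_ge0.
- by rewrite Mn_SE//; apply: interp_norm_ge0 => Y; exact: Mn_Sinf_ge0.
Qed.

Lemma Mn_S_tr (q : \bar R) F n (X : Mx n) : (1 <= q)%E -> (Mn_S q (trX F X) <= Mn_S q X)%E.
Proof.
move: q; apply: Mn_S_case => [||p p1].
- by rewrite !Mn_SinfE; exact: Sinf_tr.
- by rewrite !Mn_S1E; exact: S1_tr.
rewrite !Mn_SE//; apply: (@interp_normL _ _ (@Mn_Sinf R I n) (@Mn_S1 R I n) _ _ (@trX R I F n)).
- by move=> Y; exact: Mn_Sinf_ge0.
- by move=> Y; exact: Mn_S1_ge0.
- move=> a Y Z; apply/funext => k; apply/funext => l; apply/funext => i; apply/funext => j.
  rewrite /trX /dmul -[RHS]/(a * (ind R F i * Y k l i j * ind R F j) + ind R F i * Z k l i j * ind R F j).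
  by rewrite -[(a *: Y + Z) k l i j]/(a * Y k l i j + Z k l i j); ring.
- by move=> Y; exact: Sinf_tr.
- by move=> Y; exact: S1_tr.
Qed.

Lemma strip_hol_entry n (f : Cx R -> Mx n) k l i j :
  calderon (@Mn_Sinf R I n) (@Mn_S1 R I n) f -> strip_hol (fun z => f z k l i j).
Proof.
move=> cf; apply: (@calderon_strip_hol _ _ (@Mn_Sinf R I n) (@Mn_S1 R I n) (fun X => X k l i j)) cf.
- by [].
- by move=> X; exact: Sinf_entry.
- by move=> X; exact: S1_entry.
Qed.

(** The three lines theorem for a single entry. Besides the bound, it shows that a matrix of norm 0
    is zero. *)
Lemma Mn_S_entry (q : \bar R) n (X : Mx n) k l i j : (1 <= q)%E ->
  ((normc (X k l i j))%:E <= Mn_S q X)%E.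
Proof.
move: q; apply: Mn_S_case => [||p p1].
- by rewrite Mn_SinfE; exact: Sinf_entry.
- by rewrite Mn_S1E; exact: S1_entry.
rewrite Mn_SE// leNgt; apply/negP => /interp_lt[|f [M [[M0 +] cf fX h0 h1]]].
  by move=> Y; exact: Mn_Sinf_ge0.
rewrite lte_fin ltNge => /negP; apply; rewrite -fX.
apply: (@three_lines _ (fun z => f z k l i j) M p^-1) => //.
- by rewrite invr_gt0 (lt_trans ltr01 p1) invf_lt1// (lt_trans ltr01 p1).
- exact: strip_hol_entry.
- by move=> t; rewrite -lee_fin (le_trans (Sinf_entry _ _ _ _ _)).
- by move=> t; rewrite -lee_fin (le_trans (S1_entry _ _ _ _ _)).
Qed.

Lemma strip_hol_bil F m n (f : Cx R -> Mx m) (g : Cx R -> Mx n) al be :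
  (forall k l i j, strip_hol (fun z => f z k l i j)) ->
  (forall k l i j, strip_hol (fun z => g z k l i j)) ->
  strip_hol (fun z => bil F (f z) (g z) al be).
Proof.
move=> hf hg; apply: strip_hol_sum => s; apply: strip_hol_sum => t.
apply: strip_holM; last exact: strip_hol_cst.
apply: strip_holM; first exact: strip_hol_cst.
apply: strip_hol_sum => i; apply: strip_hol_sum => j.
by apply: strip_holM.
Qed.

(** Strict bounds provide Calderon functions whose boundary norms stay below [a] and [b]. For p = 1
    the exponents are end points and [bil_1inf] applies directly. *)
Lemma bil_lt p F m n (X : Mx m) (Y : Mx n) al be (a b : R) : 1 <= p -> 0 < a -> 0 < b ->
  (Mn_S p%:E X < a%:E)%E -> (Mn_S (hoelder_conjugate p%:E) Y < b%:E)%E ->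
  normc (bil F X Y al be) <= a * b * (fnrm al * fnrm be).
Proof.
move=> p1 a0 b0; case: (conj_exp_case p1) => [[-> ->]|[q [-> {}p1 q1 pq]]].
  by rewrite Mn_S1E Mn_SinfE => /ltW hX /ltW hY; apply: bil_1inf => //; exact: ltW.
rewrite !Mn_SE// => /interp_lt[|f [M [[M0 +] cf fX f0 f1]]].
  by move=> Z; exact: Mn_Sinf_ge0.
rewrite lte_fin => Ma.
move=> /interp_lt[|g [M' [[M'0 +] cg gY g0 g1]]].
  by move=> Z; exact: Mn_Sinf_ge0.
rewrite lte_fin => M'b.
have ab0 : 0 <= a * b * (fnrm al * fnrm be).
  by rewrite !mulr_ge0 ?fnrm_ge0// ltW.
have p0 : 0 < p by exact: lt_trans p1.
pose h z := bil F (f z) (g (1 - z)) al be.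
have -> : bil F X Y al be = h (p^-1)%:C.
  rewrite /h fX -gY; congr (bil F _ (g _) _ _).
  by apply/eqP; rewrite eq_complex/= subr0 -pq addrC addKr !eqxx.
have e1 (t : R) : (1 : Cx R) - Complex 0 t = Complex 1 (- t).
  by apply/eqP; rewrite eq_complex/= subr0 sub0r !eqxx.
have e2 (t : R) : (1 : Cx R) - Complex 1 t = Complex 0 (- t).
  by apply/eqP; rewrite eq_complex/= subrr sub0r !eqxx.
apply: (@three_lines _ h) => //.
- by rewrite invr_gt0 p0 invf_lt1.
- apply: strip_hol_bil => k l i j; first exact: strip_hol_entry.
  exact: (strip_hol_reflect (strip_hol_entry k l i j cg)).
(* On Re z = 0 the function [f] is measured in S_oo and the reflected [g] in S_1; on Re z = 1 it is
   the other way round. *)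
- move=> t; rewrite /h e1; apply: bil_inf1 => //; first exact: ltW.
    by rewrite (le_trans (f0 t))// lee_fin ltW.
  by rewrite (le_trans (g1 _))// lee_fin ltW.
- move=> t; rewrite /h e2; apply: bil_1inf => //; first exact: ltW.
    by rewrite (le_trans (f1 t))// lee_fin ltW.
  by rewrite (le_trans (g0 _))// lee_fin ltW.
Qed.

Lemma bil0l F m n (X : Mx m) (Y : Mx n) al be : (forall k l i j, X k l i j = 0) ->
  bil F X Y al be = 0.
Proof.
move=> h; rewrite /bil; apply: big1 => s _; apply: big1 => t _; rewrite /hpair.
rewrite (_ : \sum_(_ <- _) _ = 0) ?mulr0 ?mul0r//.
by apply: big1 => i _; apply: big1 => j _; rewrite h mul0r.
Qed.

(* The conventions for products in [0, +oo] are harmless: a factor whose norm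
   vanishes is zero. *)
Lemma bil_le p F m n (X : Mx m) (Y : Mx n) al be : 1 <= p ->
  ((normc (bil F X Y al be))%:E <= l2norm al * Mn_S p%:E X *
     Mn_S (hoelder_conjugate p%:E) Y * l2norm be)%E.
Proof.
move=> p1; have q1 := conj_exp_ge1 p1; have p1' : (1 <= p%:E)%E by [].
have X0 := Mn_S_ge0 X p1'; have Y0 := Mn_S_ge0 Y q1.
set x := Mn_S _ X in X0 *; set y := Mn_S _ Y in Y0 *.
have zero : bil F X Y al be = 0 -> ((normc (bil F X Y al be))%:E <=
    l2norm al * x * y * l2norm be)%E.
  by move=> ->; rewrite normc0E !mule_ge0 ?l2norm_ge0.
rewrite !l2norm_fnrm in zero *.
have [al0|alp] := eqVneq (fnrm al) 0.
  apply: zero; rewrite /bil; apply: big1 => s _; apply: big1 => t _.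
  by rewrite (fnrm_eq0 al0) !mul0r.
have [be0|bep] := eqVneq (fnrm be) 0.
  apply: zero; rewrite /bil; apply: big1 => s _; apply: big1 => t _.
  by rewrite (fnrm_eq0 be0) mulr0.
have {}alp : 0 < fnrm al by rewrite lt_def alp fnrm_ge0.
have {}bep : 0 < fnrm be by rewrite lt_def bep fnrm_ge0.
have norm0 (c : Cx R) : ((normc c)%:E <= 0)%E -> c = 0.
  by rewrite lee_fin => h; apply: Normc.eq0_normc; apply/eqP; rewrite eq_le h normc_ge0.
have [x0|xp] := eqVneq x 0%E.
  apply: zero; apply: bil0l => k l i j; apply: norm0; rewrite -x0; exact: Mn_S_entry.
have [y0|yp] := eqVneq y 0%E.
  apply: zero; rewrite bil_swap; apply: bil0l => k l i j; apply: norm0.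
  by rewrite -y0; exact: Mn_S_entry.
have {}xp : (0 < x)%E by rewrite lt_def xp.
have {}yp : (0 < y)%E by rewrite lt_def yp.
have [xy|] := pselect (x = +oo%E); first by rewrite xy gt0_muley// gt0_mulye// gt0_mulye// leey.
have [yy|] := pselect (y = +oo%E); first by move=> _; rewrite yy gt0_muley ?mule_gt0// gt0_mulye// leey.
move=> /eqP yf /eqP xf.
have {}xf : x \is a fin_num by rewrite ge0_fin_numE// ltey.
have {}yf : y \is a fin_num by rewrite ge0_fin_numE// ltey.
rewrite -(fineK xf) -(fineK yf) -!EFinM lee_fin.
have {}xp : 0 < fine x by rewrite fine_gt0// xp ltey_eq xf.
have {}yp : 0 < fine y by rewrite fine_gt0// yp ltey_eq yf.
set v := _ * fnrm be.
have v0 : 0 < v by rewrite /v !mulr_gt0.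
(* [bil_lt] asks for strict bounds, so both norms are enlarged by a factor [k]. *)
have main k : 1 < k -> normc (bil F X Y al be) <= k * k * v.
  move=> k1; have k0 := lt_trans ltr01 k1.
  have h1 : (x < (k * fine x)%:E)%E by rewrite -{1}(fineK xf) lte_fin ltr_pMl.
  have h2 : (y < (k * fine y)%:E)%E by rewrite -{1}(fineK yf) lte_fin ltr_pMl.
  have := bil_lt F al be p1 (mulr_gt0 k0 xp) (mulr_gt0 k0 yp) h1 h2.
  by congr (_ <= _); rewrite /v; ring.
rewrite leNgt; apply/negP => vlt.
(* The choice k^2 = (1 + r) / 2 lies strictly between 1 and the supposed ratio [r]. *)
pose r := normc (bil F X Y al be) / v.
have r1 : 1 < r by rewrite /r ltr_pdivlMr// mul1r.
have kk : Num.sqrt ((1 + r) / 2) ^+ 2 = (1 + r) / 2 by rewrite sqr_sqrtr//; lra.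
have k1 : 1 < Num.sqrt ((1 + r) / 2) by rewrite -[ltLHS]sqrtr1 ltr_sqrt; lra.
by have := main _ k1; rewrite -ler_pdivrMr// -/r -expr2 kk; lra.
Qed.

End MatrixNorms.

(** * Topologies of pointwise convergence *)

(** The four topologies enter the closure argument only through these two properties: the
    evaluations are continuous, and they detect convergence along filters. *)
Definition ptw_topology (K : Type) (Y X : topologicalType) (g : K -> X -> Y) : Prop :=
  (forall k, continuous (g k)) /\
  forall (T : Type) (F : set_system T) (FF : Filter F) (S : T -> X) (x : X),
    (forall k, g k (S t) @[t --> F] --> g k x) -> S @ F --> x.

Lemma ptw_initial (K : Type) (Y : topologicalType) (X : choiceType) (f : X -> {ptws K -> Y}) :
  @ptw_topology K Y (initial_topology f) (fun k x => f x k).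
Proof.
split=> [k x|T F FF S x h].
  apply: (@continuous_comp (initial_topology f) {ptws K -> Y} Y f (fun y => y k) x).
    exact: (@initial_continuous _ _ f x).
  have /cvg_sup/(_ k) h : nbhs (f x) --> f x by exact: cvg_id.
  move=> U /(@initial_continuous _ _ (fun y : {ptws K -> Y} => y k) (f x)); exact: h.
have fh : (f \o S) @ F --> f x.
  apply/cvg_sup => k U.
  have /= -> := @nbhsE (initial_topology (fun y : {ptws K -> Y} => y k)) (f x).
  move=> [B [[C oC <-] Cx] BU]; apply: filterS BU _.
  by apply: (h k); apply: open_nbhs_nbhs; split.
move=> U [B [[C oC <-] Cx] BU]; apply: filterS BU _.
by apply: fh; apply: open_nbhs_nbhs; split.
Qed.

(** Serves [CB_wot], which is induced from [B_wot] rather than defined by evaluations. *)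
Lemma ptw_comp (K : Type) (Y Z : topologicalType) (X : choiceType) (w : X -> Z)
  (g : K -> Z -> Y) : ptw_topology g ->
  @ptw_topology K Y (initial_topology w) (fun k x => g k (w x)).
Proof.
move=> [h1 h2]; split=> [k x|T F FF S x h].
  apply: (@continuous_comp (initial_topology w) Z Y w (g k) x); last exact: h1.
  exact: (@initial_continuous _ _ w x).
have wh : (w \o S) @ F --> w x by apply: h2.
move=> U [B [[C oC <-] Cx] BU]; apply: filterS BU _.
by apply: wh; apply: open_nbhs_nbhs; split.
Qed.

(* Approximation by a net gives one inclusion; the other one holds since M is
   cut out by linear equations between evaluations, which pass to closures. *)
Lemma closure_ptw (R : realType) (K : Type) (X : topologicalType) (g : K -> X -> Cx R)
    (A M : set X) (E : K -> Cx R -> K -> Prop) (T : Type) (F : set_system T) :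
  ProperFilter F -> ptw_topology g ->
  (forall x, M x -> exists S : T -> X, (forall t, A (S t)) /\
     forall k, g k (S t) @[t --> F] --> g k x) ->
  (forall x, (forall k c k', E k c k' -> g k x = c * g k' x) -> M x) ->
  (forall x k c k', A x -> E k c k' -> g k x = c * g k' x) ->
  M = closure A.
Proof.
move=> FF [h1 h2] hM hE hA; apply/seteqP; split=> x.
  move=> /hM[S [AS gS]] B /(h2 _ _ _ _ _ gS) h.
  by have [t Bt] := @filter_ex _ F _ (fun t => B (S t)) h; exists (S t).
move=> cx; apply: hE => k c k' e.
apply/eqP; rewrite -subr_eq0 -normc_eq0 eq_le normc_ge0 andbT.
apply/ler_addgt0Pr => eps eps0; rewrite add0r.
have hc : g k y - c * g k' y @[y --> x] --> g k x - c * g k' x.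
  by apply: cvgB; [exact: h1|apply: cvgMr; exact: h1].
have /(@cvgCP _ _ _ _ _ _) /(_ eps eps0) h := hc.
have [y [Ay hy]] := cx _ h.
move: hy; rewrite /= (hA _ _ _ _ Ay e) subrr sub0r => hy.
by rewrite -normcN ltW.
Qed.

(** The Cauchy condition in [n] is uniform in [t], so it passes to [b]. It also has to give the
    existence of all limits over [n], without which [lim] would carry no information. *)
Lemma moore_osgood (R : realType) (T : Type) (F : set_system T) (FF : ProperFilter F)
    (a : T -> nat -> Cx R) (b : nat -> Cx R) :
  (forall n, a t n @[t --> F] --> b n) ->
  (forall e : R, 0 < e -> exists N, forall m n, (N <= m)%N -> (N <= n)%N ->
     forall t, normc (a t m - a t n) <= e) ->
  lim (a t n @[n --> \oo]) @[t --> F] --> lim (b n @[n --> \oo]).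
Proof.
move=> ab ac.
have lima (u : nat -> Cx R) : (forall e : R, 0 < e -> exists N, forall m n,
    (N <= m)%N -> (N <= n)%N -> normc (u m - u n) <= e) ->
    u n @[n --> \oo] --> lim (u n @[n --> \oo]).
  move=> hu; have [l hl] : exists l : Cx R, u @ \oo --> l.
    apply: cvgC_cauchy => e e0; have e20 : 0 < e / 2 by rewrite divr_gt0.
    have [N hN] := hu _ e20; exists [set n | (N <= n)%N]; first exact: nbhs_infty_ge.
    move=> m n Nm Nn; rewrite (le_lt_trans (hN _ _ Nm Nn))//.
    by rewrite ltr_pdivrMr// ltr_pMr// ltr1n.
  by have -> : lim (u n @[n --> \oo]) = l by apply: cvg_lim hl; exact: norm_hausdorff.
have bc e : 0 < e -> exists N, forall m n,
    (N <= m)%N -> (N <= n)%N -> normc (b m - b n) <= e.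
  move=> e0; have [N hN] := ac e e0; exists N => m n Nm Nn.
  have h : a t m - a t n @[t --> F] --> b m - b n by apply: cvgB; exact: ab.
  apply: (@cvgC_le R _ F _ _ _ _ h); apply: nearW => t; exact: hN.
have lb := lima b bc.
have la t : a t n @[n --> \oo] --> lim (a t n @[n --> \oo]).
  by apply: lima => e e0; have [N hN] := ac e e0; exists N => m n Nm Nn; exact: hN.
apply/cvgCP => e e0; have e40 : 0 < e / 4 by rewrite divr_gt0.
have [N hN] := ac _ e40.
have limN (u : nat -> Cx R) l : u n @[n --> \oo] --> l ->
    (forall n, (N <= n)%N -> normc (u n - u N) <= e / 4) -> normc (l - u N) <= e / 4.
  move=> hl hu; have h : u n - u N @[n --> \oo] --> l - u N.
    exact: (cvgB hl (cvg_cst _)).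
  by apply: (@cvgC_le R _ \oo _ _ _ _ h); exists N => // n /= Nn; exact: hu.
have b1 : normc (lim (b n @[n --> \oo]) - b N) <= e / 4.
  apply: limN lb _ => n Nn.
  have h : a t n - a t N @[t --> F] --> b n - b N by apply: cvgB; exact: ab.
  by apply: (@cvgC_le R _ F _ _ _ _ h); apply: nearW => t; exact: hN.
have /cvgCP/(_ _ e40) := ab N; apply: filterS => t ht.
have a1 : normc (lim (a t n @[n --> \oo]) - a t N) <= e / 4.
  by apply: limN (la t) _ => n Nn; exact: hN.
have d1 := ler_distcD (a t N) (lim (a t n @[n --> \oo])) (lim (b n @[n --> \oo])).
have d2 := ler_distcD (b N) (a t N) (lim (b n @[n --> \oo])).
have : normc (b N - lim (b n @[n --> \oo])) <= e / 4 by rewrite normcBC.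
lra.
Qed.

(** * Approximation of Schur multipliers *)

Section TruncatedMultipliers.
Variables (R : realType) (I : choiceType) (p : R).
Hypothesis p1 : 1 <= p.
Local Notation Sp := (schatten I (p%:E : \bar R)).
Implicit Types (F : {fset I}) (d e : I -> Cx R).

Definition mkS (q : \bar R) A (h : (schatten_norm q A < +oo)%E) : schatten I q :=
  exist _ A (mem_set h).

Lemma schatten_fin (q : \bar R) (x : schatten I q) : (schatten_norm q (\val x) < +oo)%E.
Proof. exact: (set_mem (valP x)). Qed.

Lemma dmul_lin d e (a : Cx R) A B : dmul d (a *: A + B) e = a *: dmul d A e + dmul d B e.
Proof.
apply/funext => i; apply/funext => j.
rewrite -[RHS]/(a * (d i * A i j * e j) + d i * B i j * e j).
by rewrite /dmul -[(a *: A + B) i j]/(a * A i j + B i j); ring.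
Qed.

Definition dS d e (hd : forall i, normc (d i) <= 1) (he : forall i, normc (e i) <= 1)
  (x : Sp) : Sp :=
  mkS (le_lt_trans (@schatten_dmul R I p%:E _ _ (\val x) p1 hd he) (schatten_fin x)).

Lemma dS_Bop d e hd he (T : Bop I p%:E) : Bop I p%:E (@dS d e hd he \o \val T).
Proof.
have [lT [M M0 hM]] := set_mem (valP T); split.
  by move=> a x y z /lT h; rewrite /= h dmul_lin.
exists M; [exact: M0|move=> x; apply: le_trans (hM x)].
exact: (@schatten_dmul R I p%:E _ _ _ p1 hd he).
Qed.

Definition dT d e hd he (T : Bop I p%:E) : Bop I p%:E := 
  exist (fun f => f \in Bop I p%:E) _ (mem_set (@dS_Bop d e hd he T)).

Lemma dTE d e hd he T (x : Sp) : \val ((\val (@dT d e hd he T)) x) = dmul d (\val ((\val T) x)) e.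
Proof. by []. Qed.

Lemma idB_Bop : Bop I p%:E id.
Proof. by split=> //; exists 1; [exact: ler01|move=> x; rewrite mul1e]. Qed.

Definition idB : Bop I p%:E := exist (fun f => f \in Bop I p%:E) _ (mem_set idB_Bop).

Definition truncT F T : Bop I p%:E := dT (@ind1 R I F) (@ind1 R I F) T.

(** The diagonal of 1 - 2 e_ii for [b] true, that of the identity for [b] false. *)
Definition sgn (i : I) (b : bool) (k : I) : Cx R := if b && (k == i) then -1 else 1.

Lemma sgn_le1 i b k : normc (sgn i b k) <= 1.
Proof. by rewrite /sgn; case: (_ && _); rewrite ?normcN normc1E. Qed.

Lemma sgnK i b k : sgn i b k * sgn i b k = 1.
Proof. by rewrite /sgn; case: (_ && _); rewrite ?mulrNN mulr1. Qed.

Definition sgnT i b j b' : Bop I p%:E := dT (sgn_le1 i b) (sgn_le1 j b') idB.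

(** The multiplier is a contraction and its own inverse. *)
Lemma sgnT_iso i b j b' : isometric_schur_mult I p%:E (sgnT i b j b').
Proof.
split.
  exists (fun k l => sgn i b k * sgn j b' l) => x; rewrite dTE.
  by apply/funext => k; apply/funext => l; rewrite /dmul /schur; ring.
move=> x; rewrite dTE; apply/eqP; rewrite eq_le; apply/andP; split.
  exact: (@schatten_dmul R I p%:E _ _ _ p1 (sgn_le1 i b) (sgn_le1 j b')).
have {1}-> : \val x = dmul (sgn i b) (dmul (sgn i b) (\val x) (sgn j b')) (sgn j b').
  apply/funext => k; apply/funext => l; rewrite /dmul !mulrA sgnK mul1r -mulrA.
  by rewrite sgnK mulr1.
exact: (@schatten_dmul R I p%:E _ _ _ p1 (sgn_le1 i b) (sgn_le1 j b')).
Qed.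

Lemma Bspan_seq (D : set (Bop I p%:E)) T (K : Type) (s : seq K) (c : K -> Cx R)
    (S : K -> Bop I p%:E) : (forall k, D (S k)) ->
  (forall x, \val ((\val T) x) = \sum_(k <- s) c k *: \val ((\val (S k)) x)) -> Bspan D T.
Proof.
move=> DS hT; exists (size s), (fun k => c (tnth (in_tuple s) k)), (fun k => S (tnth (in_tuple s) k)).
by split=> // x; rewrite hT (big_tnth _ _ s).
Qed.

Lemma sum_pick (V : nmodType) F (i : I) (G : I -> V) : (forall k, k != i -> G k = 0) ->
  \sum_(k <- F) G k = if i \in F then G i else 0.
Proof.
move=> h; case: ifPn => iF.
  by rewrite (bigD1_seq i)//= ?big1 ?addr0.
by rewrite big_seq big1// => k kF; apply: h; apply: contraNneq iF => <-.
Qed.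

(* (1 - s_i) / 2 is the coordinate projection at i, so that the matrix unit
   multipliers are combinations of four sign multipliers. *)
Lemma truncT_span F T (A : I -> I -> Cx R) :
  (forall x, \val ((\val T) x) = schur A (\val x)) -> iso_span I p%:E (truncT F T).
Proof.
move=> hT.
(* The four terms of the product of (1 - s_i) / 2 on the left and (1 - s_j) / 2 on the right, hence
   the factor 1/4 and the sign given by the parity of the pair. *)
pose bs : seq (bool * bool) := [:: (false, false); (false, true); (true, false); (true, true)].
pose s := [seq (ij, bb) | ij <- [seq (i, j) | i <- F, j <- F], bb <- bs].
apply: (@Bspan_seq _ _ _ s (fun k => A k.1.1 k.1.2 / 4 * (-1) ^+ (k.2.1 (+) k.2.2))
  (fun k => sgnT k.1.1 k.2.1 k.1.2 k.2.2)) => [k|x]; first exact: sgnT_iso.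
rewrite dTE hT; apply/funext => k; apply/funext => l.
rewrite !fct_sumE /s !big_allpairs/=.
rewrite (@sum_pick _ F k) => [|i ik].
  rewrite (@sum_pick _ F l) => [|j jl].
    rewrite /bs !big_cons big_nil/= /dmul /ind /schur.
    case: (k \in F); case: (l \in F); rewrite /= ?(mul0r, mulr0)//.
    rewrite -![(_ *: _) k l]/(_ * (_ * _ * _)) /sgn !eqxx /=.
    by rewrite ?expr0 ?expr1; field.
  rewrite /= /bs !big_cons big_nil/= /dmul.
  rewrite -![(_ *: _) k l]/(_ * (_ * _ * _)) /sgn [l == j]eq_sym (negbTE jl) !andbF /=.
  by rewrite ?expr0 ?expr1; ring.
apply: big1 => j _; rewrite /= /bs !big_cons big_nil/= /dmul.
rewrite -![(_ *: _) k l]/(_ * (_ * _ * _)) /sgn [k == i]eq_sym (negbTE ik) !andbF /=.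
by rewrite ?expr0 ?expr1; ring.
Qed.

Lemma iso_span_schur T : iso_span I p%:E T -> Mult I p%:E T.
Proof.
move=> [m [c [S [hS hT]]]].
have [A hA] := choice (fun k => (hS k).1).
exists (fun i j => \sum_(k < m) c k * A k i j) => x; rewrite hT.
apply/funext => i; apply/funext => j; rewrite !fct_sumE /schur mulr_suml.
apply: eq_bigr => k _; rewrite hA -[LHS]/(c k * (A k i j * \val x i j)).
by rewrite mulrA.
Qed.

Lemma emx_fin (q : \bar R) (i j : I) : (1 <= q)%E -> (schatten_norm q (emx R i j) < +oo)%E.
Proof. by move=> q1; rewrite (le_lt_trans (schatten_emx i j q1))// ltry. Qed.

Definition eS (q : \bar R) (q1 : (1 <= q)%E) (i j : I) : schatten I q := mkS (emx_fin i j q1).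

Lemma schur_of_entries (T : Bop I p%:E) : (forall (x : Sp) i j,
    \val ((\val T) x) i j = \val x i j * \val ((\val T) (@eS p%:E p1 i j)) i j) ->
  Mult I p%:E T.
Proof.
move=> h; exists (fun i j => \val ((\val T) (@eS p%:E p1 i j)) i j) => x.
by apply/funext => i; apply/funext => j; rewrite h /schur mulrC.
Qed.

Lemma entries_of_schur (T : Bop I p%:E) (x : Sp) i j : Mult I p%:E T ->
    \val ((\val T) x) i j = \val x i j * \val ((\val T) (@eS p%:E p1 i j)) i j.
Proof. by move=> [A hA]; rewrite !hA /schur /= /emx !eqxx mulr1 mulrC. Qed.

Lemma trunc_split (T : Bop I p%:E) (W : lmodType (Cx R)) (phi : Sp -> W) F (x : Sp) :
  linear_on phi -> exists y z : Sp, [/\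
    phi ((\val T) x) = phi y + (phi z + phi ((\val (truncT F T)) x)),
    \val y = dmul (@diag1 R I) (\val ((\val T) x)) (coind R F) &
    \val z = dmul (coind R F) (dmul (@diag1 R I) (\val ((\val T) x)) (ind R F)) (@diag1 R I)].
Proof.
move=> lphi; set v := (\val T) x.
pose y := dS (@one1 R I) (@coind1 R I F) v.
pose w := dS (@one1 R I) (@ind1 R I F) v.
pose z := dS (@coind1 R I F) (@one1 R I) w.
have ind_coind i : ind R F i + coind R F i = 1.
  by rewrite /ind /coind; case: (i \in F); rewrite /= ?addr0 ?add0r.
exists y, z; split=> //.
rewrite -[phi y]scale1r -[phi z]scale1r -(lphi 1 z _ w).
  apply: lphi; apply/funext => i; apply/funext => j.
  rewrite -[RHS]/(1 * (1 * \val v i j * coind R F j) + 1 * \val v i j * ind R F j).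
  by rewrite !mul1r -mulrDr addrC ind_coind mulr1.
apply/funext => i; apply/funext => j.
rewrite -[RHS]/(1 * (coind R F i * (1 * \val v i j * ind R F j) * 1) + ind R F i * \val v i j * ind R F j).
rewrite -[LHS]/(1 * \val v i j * ind R F j).
by rewrite !mul1r mulr1 !mulrA -!mulrDl addrC ind_coind !mul1r.
Qed.

Lemma truncT_wot (T : Bop I p%:E) (phi : schatten_dual I p%:E) (x : Sp) :
  (\val phi) ((\val (truncT F T)) x) @[F --> totally] --> (\val phi) ((\val T) x).
Proof.
have [lphi [M M0 hM]] := set_mem (valP phi).
have M1 : 0 < M + 1 by rewrite ltr_wpDl.
(* There are two tail terms, of at most e / 3 each; the + 1 covers M = 0. *)
apply/cvgCP => e e0; have e20 : 0 < e / 3 / (M + 1) by rewrite !divr_gt0.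
apply: filterS (schatten_tail p1 (schatten_fin ((\val T) x)) e20) => F [t1 t2].
have [y [z [-> yE zE]]] := trunc_split T F x lphi.
have small (u : Sp) : (schatten_norm p%:E (\val u) <= (e / 3 / (M + 1))%:E)%E ->
    normc ((\val phi) u) <= e / 3.
  move=> hu; rewrite -lee_fin (le_trans (hM u))//.
  rewrite (le_trans (lee_wpmul2l _ hu))// -?EFinM ?lee_fin//.
  rewrite mulrA ler_pdivrMr// [leLHS]mulrC.
  by apply: ler_wpM2l; rewrite ?lerDl ?divr_ge0 ?(ltW e0).
have hy : normc ((\val phi) y) <= e / 3.
  by apply: small; rewrite yE; exact: t1.
have hz : normc ((\val phi) z) <= e / 3.
  apply: small; rewrite zE; apply: le_trans t2.
  (* Left and right multiplications commute, so [z] is a truncation of the tail estimated in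
     [t2]. *)
  have -> : dmul (coind R F) (dmul (@diag1 R I) (\val ((\val T) x)) (ind R F)) (@diag1 R I) =
      dmul (@diag1 R I) (dmul (coind R F) (\val ((\val T) x)) (@diag1 R I)) (ind R F).
    by apply/funext => i; apply/funext => j; rewrite /dmul; ring.
  exact: (@schatten_dmul R I p%:E _ _ _ p1 (@one1 R I) (@ind1 R I F)).
rewrite normcBC addrA addrK (le_lt_trans (ler_normcD _ _))//.
rewrite (le_lt_trans (lerD hy hz))//; lra.
Qed.

End TruncatedMultipliers.

(** * Uniform bounds on tensors and weak* convergence *)

Section WeakStar.
Variables (R : realType) (I : choiceType) (p : R).
Hypothesis p1 : 1 <= p.
Local Notation q := (hoelder_conjugate (p%:E : \bar R)).
Local Notation Sp := (schatten I (p%:E : \bar R)).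
Local Notation Sq := (schatten I q).
Local Notation tensor := (I -> I -> I -> I -> Cx R).
Implicit Types (F : {fset I}).

(** A function of the tensor itself, not of a list representing it: by [tensor_pairing_trunc] the
    value of a truncated multiplier may be estimated through any representation or factorization of
    the tensor. *)
Definition diag_sum F (A : I -> I -> Cx R) (t : tensor) : Cx R :=
  \sum_(i <- F) \sum_(j <- F) A i j * t i j i j.

Lemma diag_sumB F A t t' : diag_sum F A (t - t') = diag_sum F A t - diag_sum F A t'.
Proof.
rewrite /diag_sum -sumrB; apply: eq_bigr => i _; rewrite -sumrB; apply: eq_bigr => j _.
by rewrite -[(t - t') i j i j]/(t i j i j - t' i j i j) mulrBr.
Qed.

Lemma diag_sum_sum F A (K : Type) (r : seq K) (P : pred K) (t : K -> tensor) :
  diag_sum F A (\sum_(k <- r | P k) t k) = \sum_(k <- r | P k) diag_sum F A (t k).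
Proof.
rewrite /diag_sum [RHS]exchange_big/=; apply: eq_bigr => i _.
rewrite [RHS]exchange_big/=; apply: eq_bigr => j _.
have -> : (\sum_(k <- r | P k) t k) i j i j = \sum_(k <- r | P k) t k i j i j.
  by elim/big_rec2: _ => [|k a b _ <-].
exact: mulr_sumr.
Qed.

Lemma diag_sum_tensor F A (x y : I -> I -> Cx R) :
  diag_sum F A (fun i j k l => x i j * y k l) = hpair F F (schur A x) y.
Proof.
by rewrite /diag_sum /hpair; apply: eq_bigr => i _; apply: eq_bigr => j _; rewrite /schur mulrA.
Qed.

Variables (T : Bop I p%:E) (A : I -> I -> Cx R).
Hypothesis TA : forall x, \val ((\val T) x) = schur A (\val x).

Lemma tensor_pairing_trunc F u :
  tensor_pairing (truncT p1 F T) u = diag_sum F A (tensor_val u).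
Proof.
rewrite /tensor_val diag_sum_sum; apply: eq_bigr => x _.
by rewrite diag_sum_tensor -TA dTE pairing_ind.
Qed.

Lemma hpair_leE F (x : Sp) (y : Sq) :
  ((normc (hpair F F (\val x) (\val y)))%:E <=
    schatten_norm p%:E (\val x) * schatten_norm q (\val y))%E.
Proof.
have q1 := conj_exp_ge1 p1; have p1' : (1 <= p%:E)%E by [].
have fx := schatten_fin x; have fy := schatten_fin y.
have X0 := schatten_norm_ge0 p%:E (\val x); have Y0 := schatten_norm_ge0 q (\val y).
have {}fx : schatten_norm p%:E (\val x) \is a fin_num by rewrite ge0_fin_numE.
have {}fy : schatten_norm q (\val y) \is a fin_num by rewrite ge0_fin_numE.
have norm0 (c : Cx R) : ((normc c)%:E <= 0)%E -> c = 0.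
  by rewrite lee_fin => h; apply: Normc.eq0_normc; apply/eqP; rewrite eq_le h normc_ge0.
(* [hpair_le] asks for positive bounds; a vanishing norm forces all entries to vanish. *)
have [x0|xp] := eqVneq (schatten_norm p%:E (\val x)) 0%E.
  rewrite x0 mul0e (_ : hpair _ _ _ _ = 0) ?normc0E// /hpair.
  apply: big1 => i _; apply: big1 => j _; rewrite [X in X * _]norm0 ?mul0r//.
  by rewrite -x0; exact: entry_le.
have [y0|yp] := eqVneq (schatten_norm q (\val y)) 0%E.
  rewrite y0 mule0 (_ : hpair _ _ _ _ = 0) ?normc0E// /hpair.
  apply: big1 => i _; apply: big1 => j _; rewrite [X in _ * X]norm0 ?mulr0//.
  by rewrite -y0; exact: entry_le.
rewrite -(fineK fx) -(fineK fy) -EFinM lee_fin.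
have xp' : 0 < fine (schatten_norm p%:E (\val x)) by rewrite fine_gt0// lt_def xp X0 ltey_eq fx.
have yp' : 0 < fine (schatten_norm q (\val y)) by rewrite fine_gt0// lt_def yp Y0 ltey_eq fy.
apply: (hpair_le F F p1 xp' yp'); first by rewrite fineK.
by rewrite fineK.
Qed.

Lemma gamma_norm_bound : exists2 M : R, 0 <= M & forall F t (e : R),
  (@gamma_norm R I p%:E t < e%:E)%E -> normc (diag_sum F A t) <= M * e.
Proof.
have [_ [M M0 hM]] := set_mem (valP T); exists M; first exact: M0.
move=> F t e /ereal_inf_lt[_ [u ut <-] ue].
rewrite -ut /tensor_val diag_sum_sum -lee_fin EFinM.
apply: (@le_trans _ _ (\sum_(x <- u) M%:E *
    (schatten_norm p%:E (\val x.1) * schatten_norm q (\val x.2)))%E).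
  rewrite (@le_trans _ _ (\sum_(x <- u) (normc (hpair F F (\val ((\val T) x.1)) (\val x.2)))%:E)%E)//.
    rewrite sumEFin lee_fin (le_trans (ler_normc_sum _ _ _))//.
    by apply: ler_sum => x _; rewrite diag_sum_tensor -TA.
  apply: lee_sum => x _; apply: le_trans (hpair_leE _ _ _) _.
  rewrite muleA; apply: lee_wpmul2r; first exact: schatten_norm_ge0.
  exact: hM.
rewrite -ge0_sume_distrr => [|x _]; last first.
  by rewrite mule_ge0// schatten_norm_ge0.
by apply: lee_wpmul2l; [exact: M0|exact: ltW].
Qed.

(** [T] is applied to the blocks of the first factor, at the cost of its completely bounded norm,
    uniformly in their size; the rest is [bil_le] for the images. *)
Lemma opproj_norm_bound : CBop I p%:E T -> exists2 M : R, 0 <= M & forall F t (e : R),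
  (@opproj_norm R I p%:E t < e%:E)%E -> normc (diag_sum F A t) <= M * e.
Proof.
move=> [M M0 hM]; exists M; first exact: M0.
move=> F t e /ereal_inf_lt[_ [m [n [al [be [x [y [-> ->]]]]]]] re].
pose X k l := \val ((\val T) (x k l)); pose Y k l := \val (y k l).
have -> : diag_sum F A (\sum_(a : 'I_m * 'I_n) \sum_(b : 'I_m * 'I_n)
    (fun i j k l => al a * (\val (x a.1 b.1)) i j * (\val (y a.2 b.2)) k l * be b)) =
    bil F X Y al be.
  rewrite diag_sum_sum; apply: eq_bigr => a _; rewrite diag_sum_sum; apply: eq_bigr => b _.
  rewrite /diag_sum /hpair mulr_sumr mulr_suml; apply: eq_bigr => i _.
  rewrite mulr_sumr mulr_suml; apply: eq_bigr => j _.
  by rewrite /X /Y TA /schur; ring.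
rewrite -lee_fin EFinM (le_trans (bil_le _ _ _ _ _ p1))//.
have q1 := conj_exp_ge1 p1; have p1' : (1 <= p%:E)%E by [].
apply: (@le_trans _ _ (M%:E * (l2norm al * Mn_S p%:E (fun i j => \val (x i j)) *
  Mn_S q Y * l2norm be))%E); last first.
  by apply: lee_wpmul2l => //; exact: ltW.
rewrite !muleA; apply: lee_wpmul2r; first exact: l2norm_ge0.
apply: lee_wpmul2r; first exact: Mn_S_ge0.
rewrite [(M%:E * _)%E]muleC -muleA; apply: lee_wpmul2l; first exact: l2norm_ge0.
exact: hM.
Qed.

(** [N] stands for either projective norm. Its bound on [diag_sum] makes the evaluations along a
    Cauchy sequence Cauchy uniformly in [F], as [moore_osgood] demands. *)
Lemma weakstar_cvg (N : tensor -> \bar R) (u : nat -> seq (Sp * Sq)) :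
  (exists2 M : R, 0 <= M & forall F t (e : R),
    (N t < e%:E)%E -> normc (diag_sum F A t) <= M * e) ->
  completion N u ->
  lim (tensor_pairing (truncT p1 F T) (u n) @[n --> \oo]) @[F --> totally] -->
    lim (tensor_pairing T (u n) @[n --> \oo]).
Proof.
move=> [M M0 hM] cu; apply: moore_osgood => [n|e e0].
  rewrite /tensor_pairing; apply: (@cvgC_sum_fset R _ _ totally _
    (fun F x => pairing (\val ((\val (truncT p1 F T)) x.1)) (\val x.2))) => x.
  rewrite (_ : (fun F => _) = fun F => hpair F F (\val ((\val T) x.1)) (\val x.2)).
    apply: (@pairing_cvg R I p _ _ p1); exact: schatten_fin.
  by apply/funext => F; rewrite dTE pairing_ind.
have M1 : 0 < M + 1 by rewrite ltr_wpDl.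
have [] := cu (e / (M + 1)); first by rewrite divr_gt0.
move=> [B C] [[N1 _ hN1] [N2 _ hN2]] hBC.
exists (maxn N1 N2) => m n; rewrite !geq_max => /andP[m1 m2] /andP[n1 n2] F.
have h : (N (tensor_val (u m) - tensor_val (u n))%R < (e / (M + 1))%:E)%E.
  by apply: (hBC (m, n)); split; [exact: hN1|exact: hN2].
rewrite !tensor_pairing_trunc -diag_sumB (le_trans (hM F _ _ h))//.
rewrite mulrA ler_pdivrMr// mulrC; apply: ler_wpM2l; first exact: ltW.
by rewrite lerDl.
Qed.

End WeakStar.

(** * The four closures *)

Section Closures.
Variables (R : realType) (I : choiceType) (p : R).
Hypothesis p1 : 1 <= p.
Local Notation q := (hoelder_conjugate (p%:E : \bar R)).
Local Notation Sp := (schatten I (p%:E : \bar R)).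
Local Notation Sq := (schatten I q).
Local Notation tensor := (I -> I -> I -> I -> Cx R).
Implicit Types (F : {fset I}).

Lemma truncT_cb F (T : CBop I p%:E) : CBop I p%:E (truncT p1 F (\val T)).
Proof.
have [M M0 hM] := set_mem (valP T); exists M; first exact: M0.
move=> n X; apply: le_trans (hM n X).
exact: (@Mn_S_tr R I p%:E F n (fun k l => \val ((\val (\val T)) (X k l))) p1).
Qed.

Definition truncC F (T : CBop I p%:E) : CBop I p%:E :=
  exist (fun f => f \in CBop I p%:E) _ (mem_set (truncT_cb F T)).

Lemma entry_dual i j : schatten_dual I p%:E (fun x : Sp => \val x i j).
Proof.
split=> [a x y z ->|]; first by [].
exists 1; [exact: ler01|move=> x; rewrite mul1e].
exact: (@entry_le R I p%:E _ _ _ p1).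
Qed.

Definition entryS i j : schatten_dual I p%:E :=
  exist (fun f => f \in schatten_dual I p%:E) _ (mem_set (entry_dual i j)).

Let q1 := conj_exp_ge1 p1.

Lemma gamma_norm0 : (@gamma_norm R I p%:E 0%R <= 0)%E.
Proof.
apply: ereal_inf_lbound; exists [::]; last by rewrite big_nil.
by rewrite /= /tensor_val big_nil.
Qed.

Lemma opproj_norm0 : (@opproj_norm R I p%:E 0%R <= 0)%E.
Proof.
have x : 'I_0 -> 'I_0 -> Sp by case.
have y : 'I_0 -> 'I_0 -> Sq by case.
(* In the empty factorization the norm of [alpha] is 0, so the product is 0 whatever the norms of
   the empty blocks are. *)
apply: ereal_inf_lbound; exists 0%N, 0%N, (fun=> 0), (fun=> 0), x, y.
split; first by rewrite big1// => -[[]].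
have -> : l2norm (fun _ : 'I_0 * 'I_0 => 0 : Cx R) = 0%E.
  rewrite l2norm_fnrm /fnrm big1 ?sqrtr0// => -[[]]//.
by rewrite !mul0e.
Qed.

(** Embeds the algebraic tensor product in its completion by constant sequences. *)
Lemma completion_cst (N : tensor -> \bar R) (u : seq (Sp * Sq)) : (N 0%R <= 0)%E ->
  completion N (fun=> u).
Proof.
move=> N0 e e0; exists (setT, setT); first by split; exact: filterT.
by move=> [m n] _; rewrite /= subrr (le_lt_trans N0).
Qed.

(** Pairing with x (x) e_ij reads off the entry (i, j) of T x, which makes entries weak*
    continuous. *)
Definition tens (N : tensor -> \bar R) (N0 : (N 0%R <= 0)%E) (x : Sp) i j : completion N :=
  exist (fun f => f \in completion N) _
    (mem_set (@completion_cst N [:: (x, eS q1 i j)] N0)).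

Lemma lim_tens (N : tensor -> \bar R) (N0 : (N 0%R <= 0)%E) (T : Bop I p%:E) (x : Sp) i j :
  lim (tensor_pairing T (\val (tens N0 x i j) n) @[n --> \oo]) = \val ((\val T) x) i j.
Proof.
rewrite /tensor_pairing /= big_seq1 /= lim_cst ?pairing_emx//.
Qed.

(** The equations (T x)_ij = x_ij (T e_ij)_ij as relations between evaluations, in the shape
    required by [closure_ptw]. *)
Definition entry_rel (k : Sp * schatten_dual I p%:E) (c : Cx R) (k' : Sp * schatten_dual I p%:E) :=
  exists x i j, [/\ k = (x, entryS i j), c = \val x i j &
    k' = (@eS R I p%:E p1 i j, entryS i j)].

Definition tens_rel (N : tensor -> \bar R) (N0 : (N 0%R <= 0)%E) (k : completion N) (c : Cx R)
    (k' : completion N) :=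
  exists x i j, [/\ k = tens N0 x i j, c = \val x i j &
    k' = tens N0 (@eS R I p%:E p1 i j) i j].

Lemma closure_wot : Mult I p%:E = @closure (B_wot I p%:E) (iso_span I p%:E).
Proof.
apply: (@closure_ptw R _ (B_wot I p%:E) (fun k T => (\val k.2) ((\val T) k.1))
  (iso_span I p%:E) (Mult I p%:E) entry_rel {fset I} totally).
- exact: ptw_initial.
- move=> T [A hA]; exists (fun F => truncT p1 F T); split.
    by move=> F; apply: truncT_span hA.
  by move=> k; exact: truncT_wot.
- move=> T h; apply: (@schur_of_entries R I p p1) => x i j.
  by apply: (h (x, entryS i j) _ (@eS R I p%:E p1 i j, entryS i j)); exists x, i, j.
- move=> T _ c _ /iso_span_schur hT [x [i [j [-> -> ->]]]].
  exact: (entries_of_schur p1 x i j hT).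
Qed.

Lemma closure_weakstar : Mult I p%:E = @closure (B_weakstar I p%:E) (iso_span I p%:E).
Proof.
apply: (@closure_ptw R _ (B_weakstar I p%:E)
  (fun u T => lim (tensor_pairing T (\val u n) @[n --> \oo])) (iso_span I p%:E) (Mult I p%:E)
  (@tens_rel _ gamma_norm0) {fset I} totally).
- exact: ptw_initial.
- move=> T [A hA]; exists (fun F => truncT p1 F T); split.
    by move=> F; apply: truncT_span hA.
  move=> u; apply: (weakstar_cvg p1 hA (gamma_norm_bound p1 hA)).
  exact: (set_mem (valP u)).
- move=> T h; apply: (@schur_of_entries R I p p1) => x i j.
  have := h (tens gamma_norm0 x i j) (\val x i j) (tens gamma_norm0 (@eS R I p%:E p1 i j) i j).
  by rewrite !lim_tens; apply; exists x, i, j.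
- move=> T _ c _ /iso_span_schur hT [x [i [j [-> -> ->]]]].
  by rewrite !lim_tens; exact: (entries_of_schur p1 x i j hT).
Qed.

Lemma closure_wot_cb : Mult_cb I p%:E = @closure (CB_wot I p%:E) (iso_span_cb I p%:E).
Proof.
apply: (@closure_ptw R _ (CB_wot I p%:E) (fun k T => (\val k.2) ((\val (\val T)) k.1))
  (iso_span_cb I p%:E) (Mult_cb I p%:E) entry_rel {fset I} totally).
- have h : @ptw_topology (Sp * schatten_dual I p%:E) (Cx R) (B_wot I p%:E)
      (fun k T => (\val k.2) ((\val T) k.1)) by exact: ptw_initial.
  exact: (@ptw_comp _ _ (B_wot I p%:E) (CBop I p%:E) (fun T => \val T) _ h).
- move=> T [A hA]; exists (fun F => truncC F T); split.
    by move=> F; apply: truncT_span hA.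
  by move=> k; exact: truncT_wot.
- move=> T h; apply: (@schur_of_entries R I p p1) => x i j.
  by apply: (h (x, entryS i j) _ (@eS R I p%:E p1 i j, entryS i j)); exists x, i, j.
- move=> T _ c _ /iso_span_schur hT [x [i [j [-> -> ->]]]].
  exact: (entries_of_schur p1 x i j hT).
Qed.

Lemma closure_weakstar_cb : Mult_cb I p%:E = @closure (CB_weakstar I p%:E) (iso_span_cb I p%:E).
Proof.
apply: (@closure_ptw R _ (CB_weakstar I p%:E)
  (fun u T => lim (tensor_pairing (\val T) (\val u n) @[n --> \oo])) (iso_span_cb I p%:E) (Mult_cb I p%:E)
  (@tens_rel _ opproj_norm0) {fset I} totally).
- exact: ptw_initial.
- move=> T [A hA]; exists (fun F => truncC F T); split.
    by move=> F; apply: truncT_span hA.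
  move=> u; apply: (weakstar_cvg p1 hA (opproj_norm_bound p1 hA (set_mem (valP T)))).
  exact: (set_mem (valP u)).
- move=> T h; apply: (@schur_of_entries R I p p1) => x i j.
  have := h (tens opproj_norm0 x i j) (\val x i j) (tens opproj_norm0 (@eS R I p%:E p1 i j) i j).
  by rewrite !lim_tens; apply; exists x, i, j.
- move=> T _ c _ /iso_span_schur hT [x [i [j [-> -> ->]]]].
  by rewrite !lim_tens; exact: (entries_of_schur p1 x i j hT).
Qed.

End Closures.

Theorem theorem5p3 (R : realType) (I : choiceType) (p : R) (hp : 1 <= p) :
  (Mult_cb I p%:E = @closure (CB_weakstar I p%:E) (iso_span_cb I p%:E) /\
   Mult_cb I p%:E = @closure (CB_wot I p%:E) (iso_span_cb I p%:E)) /\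
  (Mult I p%:E = @closure (B_weakstar I p%:E) (iso_span I p%:E) /\
   Mult I p%:E = @closure (B_wot I p%:E) (iso_span I p%:E)).
Proof.
split; split.
- exact: closure_weakstar_cb.
- exact: closure_wot_cb.
- exact: closure_weakstar.
- exact: closure_wot.
Qed.
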